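(* Let $Y$ be a Haar system Hardy space, and let $\Gamma,\delta,\varepsilon>0$. Put $\eta=\frac{\varepsilon}{6(1+\varepsilon)}$. Let $n,N\in\mathbb{N}_0$ be chosen such that $$N\ \ge\ 42\,n(n+1)\Bigl\lceil \frac{\Gamma}{\eta\delta}\Bigr\rceil+42+\Bigl\lfloor 4\log_2\Bigl(\frac{\Gamma}{\eta\delta}\Bigr)\Bigr\rfloor. \qquad ( * )$$ Then for every linear operator $T\colon Y_N\to Y_N$ with $\|T\|\le\Gamma$, the following holds: (i) If $\delta=1$ in $( * )$, then the identity $I_{Y_n}$ factors through $T$ or through $I_{Y_N}-T$ with constant $2(1+\varepsilon)$. (ii) If $T$ has $\delta$-large positive diagonal with respect to the Haar basis, then the identity $I_{Y_n}$ factors through $T$ with constant $\frac{1+\varepsilon}{\delta}$. Moreover, if the Haar system $(h_I)_{I\in\mathcal{D}}$ is $K$-unconditional in $Y$ for some $K\ge 1$, then the same conclusions hold with inequality $( * )$ replaced by $$N\ \ge\ 42\,n\Bigl\lceil \frac{K\Gamma}{\eta\delta}\Bigr\rceil+42+\Bigl\lfloor 4\log_2\Bigl(\frac{\Gamma}{\eta\delta}\Bigr)\Bigr\rfloor.$$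
   Context: All Banach spaces are real; $\mathbb{N}_0=\mathbb{N}\cup\{0\}$. **Haar system.** $\mathcal{D}=\{[\frac{i-1}{2^j},\frac{i}{2^j}) : j\in\mathbb{N}_0,\ 1\le i\le 2^j\}$ is the collection of dyadic intervals in $[0,1)$, $\mathcal{D}_n=\{I\in\mathcal{D}: |I|=2^{-n}\}$, $\mathcal{D}_{\le n}=\bigcup_{k=0}^n\mathcal{D}_k$. For $I\in\mathcal{D}$, $I^+$ and $I^-$ are the left and right halves of $I$, and $h_I=\chi_{I^+}-\chi_{I^-}$. Put $h_\varnothing=\chi_{[0,1)}$ and $\mathcal{D}^+=\mathcal{D}\cup\{\varnothing\}$. Let $\iota\colon\mathcal{D}^+\to\mathbb{N}_0$ be the bijection given by $\iota(\varnothing)=0$ and $\iota([\frac{i}{2^j},\frac{i+1}{2^j}))=2^j+i$. Let $H=\operatorname{span}\{h_I: I\in\mathcal{D}^+\}$ and $H_0=\operatorname{span}\{h_I: I\in\mathcal{D}\}$. For $f,g\in H$, $\langle f,g\rangle=\int_0^1 fg$. **Haar system space.** A Haar system space $X$ is the completion of $H$ under a norm $\|\cdot\|_X$ such that (1) if $f,g\in H$ and $|f|,|g|$ have the same distribution, then $\|f\|_X=\|g\|_X$; (2) $\|\chi_{[0,1)}\|_X=1$. **Haar system Hardy space.** Let $r_n=\sum_{I\in\mathcal{D}_n}h_I$, $n\in\mathbb{N}_0$ (Rademacher functions), and let $\mathbf{r}=(r_I)_{I\in\mathcal{D}^+}$ be one of the two families $(r_{\iota(I)})_{I\in\mathcal{D}^+}$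 (independent) or $(r_0)_{I\in\mathcal{D}^+}$ (constant). Given a Haar system space $X$, the space $X(\mathbf{r})$ is the completion of $H$ under $$\Bigl\|\sum_{I\in\mathcal{D}^+}a_Ih_I\Bigr\|_{X(\mathbf{r})}=\Bigl\|s\mapsto\int_0^1\Bigl|\sum_{I\in\mathcal{D}^+}r_I(u)a_Ih_I(s)\Bigr|\,du\Bigr\|_X,$$ and $X_0(\mathbf{r})$ is the closure of $H_0$ in $X(\mathbf{r})$. Throughout, a Haar system Hardy space $Y$ means a space $Y=X_0(\mathbf{r})$ of this form, and $Y_n=\operatorname{span}\{h_I: I\in\mathcal{D}_{\le n}\}\subset Y$ with the norm of $Y$; its Haar basis is $(h_I)_{I\in\mathcal{D}_{\le n}}$. **Unconditionality.** The Haar system is $K$-unconditional in $Y$ if $\|\sum_I\epsilon_Ia_Ih_I\|_Y\le K\|\sum_Ia_Ih_I\|_Y$ for all finitely supported real families $(a_I)_{I\in\mathcal{D}}$ and all signs $\epsilon_I\in\{\pm1\}$. **Diagonal.** A linear operator $T\colon Y_N\to Y_N$ has $\delta$-large positive diagonal (with respect to the Haar basis) if $\langle h_I,Th_I\rangle\ge\delta|I|$ for all $I\in\mathcal{D}_{\le N}$. **Factorization.** For linear operators $S\colon Y_n\to Y_n$ and $T\colon Y_N\to Y_N$, $S$ factors through $T$ with constant $C$ if there are linear operators $B\colon Y_n\to Y_N$ and $A\colon Y_N\to Y_n$ with $\|A\|\|B\|\le C$ and $S=ATB$.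
   Formalization: Part (i), under both bounds on N, additionally assumes n ≤ N: for very small Γ the bound allows N < n, and then the identity of Y_n cannot factor through any operator on the lower-dimensional Y_N (e.g. n = 1, N = 0, T = 0). *)

(* Defs.v *)
From HB Require Import structures.
From mathcomp Require Import all_boot all_order all_algebra finmap.
From mathcomp Require Import all_classical all_reals all_analysis.

Set Implicit Arguments.
Unset Strict Implicit.
Unset Printing Implicit Defensive.
Import Order.TTheory GRing.Theory Num.Theory.
Import numFieldNormedType.Exports.

Local Open Scope classical_set_scope.
Local Open Scope ring_scope.

(* The pair (j, i) with i < 2^j stands for the interval [i/2^j, (i+1)/2^j). *)
Definition dyadic := {j : nat & 'I_(2 ^ j)}.
Definition lvl (I : dyadic) : nat := tag I.
Definition pos (I : dyadic) : nat := tagged I.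

(* [None] stands for the extra index, the empty set. *)
Definition dyadicp := option dyadic.

Definition iota_dyadic (I : dyadicp) : nat :=
  if I is Some J then (2 ^ lvl J + pos J)%N else 0%N.

Section Haar.
Variable R : realType.
Implicit Types (f g : R -> R) (I : dyadic) (a : dyadicp -> R).

Definition dyadic_itv (j i : nat) : set R :=
  `[i%:R / 2 ^+ j, i.+1%:R / 2 ^+ j[%classic.

Definition len I : R := 2 ^- lvl I.

Definition unit_itv : set R := `[0, 1[%classic.

(* Everywhere-defined functions vanishing outside [0,1); equalities below are
   pointwise, which is harmless since all intervals are half-open. *)
Definition haar (I : dyadicp) : R -> R :=
  if I is Some J then
    fun x => \1_(dyadic_itv (lvl J).+1 (pos J).*2) x
             - \1_(dyadic_itv (lvl J).+1 (pos J).*2.+1) x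
  else \1_unit_itv.

Definition pairing f g : R :=
  \int[lebesgue_measure]_(x in unit_itv) (f x * g x).

Definition fin_supp (J : Type) (a : J -> R) := finite_set [set I | a I != 0].

Definition haar_sum (D : set dyadicp) a : R -> R :=
  \sum_(I \in D) a I *: haar I.

Definition haar_span (D : set dyadicp) : set (R -> R) :=
  [set f | exists a, fin_supp a /\ f = haar_sum D a].

Definition Hspace : set (R -> R) := haar_span setT.

Definition same_dist f g := forall A : set R, measurable A ->
  lebesgue_measure (unit_itv `&` f @^-1` A) =
  lebesgue_measure (unit_itv `&` g @^-1` A).

(* A Haar system space is the completion of H under such a norm, hence is
   determined by it; only the values of [hs_norm] on H are meaningful. *)
Record haar_system_space := HaarSystemSpace {
  hs_norm :> (R -> R) -> R;
  hs_normD : forall f g, Hspace f -> Hspace g ->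
    hs_norm (f + g) <= hs_norm f + hs_norm g;
  hs_normZ : forall (c : R) f, Hspace f -> hs_norm (c *: f) = `|c| * hs_norm f;
  hs_norm_eq0 : forall f, Hspace f -> hs_norm f = 0 -> f = 0;
  hs_norm_dist : forall f g, Hspace f -> Hspace g ->
    same_dist (fun x => `|f x|) (fun x => `|g x|) -> hs_norm f = hs_norm g;
  hs_norm1 : hs_norm (\1_unit_itv) = 1
}.

Definition rademacher (n : nat) : R -> R :=
  fun u => \sum_(i < 2 ^ n) haar (Some (Tagged (fun j => 'I_(2 ^ j)) i)) u.

Inductive rad_kind := Independent | Constant.

Definition rad_family (k : rad_kind) (I : dyadicp) : R -> R :=
  match k with
  | Independent => rademacher (iota_dyadic I)
  | Constant => rademacher 0
  end.

(* The X(r)-norm of the finite sum with coefficients [a]. *)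
Definition coef_norm (X : haar_system_space) (k : rad_kind) a : R :=
  X (fun s => \int[lebesgue_measure]_(u in unit_itv)
      `|\sum_(I \in [set: dyadicp]) rad_family k I u * a I * haar I s|).

(* The unique finitely supported family [a] with f = sum_I a_I h_I. *)
Definition haar_coef f : dyadicp -> R :=
  xget (fun=> 0) [set a | fin_supp a /\ f = haar_sum setT a].

(* Norm of a Haar system Hardy space Y = X_0(r) at an element of H_0. *)
Definition hardy_norm (X : haar_system_space) (k : rad_kind) f : R :=
  coef_norm X k (haar_coef f).

Definition unconditional (X : haar_system_space) (k : rad_kind) (K : R) :=
  forall (a : dyadic -> R) (e : dyadic -> bool), fin_supp a ->
    hardy_norm X k (\sum_(I \in [set: dyadic]) ((-1) ^+ e I * a I) *: haar (Some I))
    <= K * hardy_norm X k (\sum_(I \in [set: dyadic]) a I *: haar (Some I)).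

Lemma haar_span_submod_closed (D : set dyadicp) :
  GRing.submod_closed [pred f : R -> R | f \in haar_span D].
Proof.
have E (S : set dyadicp) (d : dyadicp -> R) : finite_set S ->
    (forall J, ~ S J -> d J = 0) ->
    haar_sum D d = \sum_(J <- fset_set (D `&` S)) d J *: haar J.
  move=> fS dS; rewrite -fsbig_finite; last exact: finite_setIr.
  apply/esym; apply: fsbig_widen => [J []//|J [DJ nDS]] /=.
  by rewrite dS ?scale0r// => SJ; apply: nDS.
split=> [|c f g].
  rewrite !inE; exists (fun=> 0); split.
    rewrite /fin_supp (_ : mkset _ = set0)//.
    by rewrite -subset0 => J /=; rewrite eqxx.
  by rewrite (E set0)// setI0 fset_set0 big_seq_fset0.
rewrite !inE => -[a [fa ->]] [b [fb ->]].
pose S := [set J | a J != 0] `|` [set J | b J != 0].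
have fS : finite_set S by rewrite finite_setU.
have aS J : ~ S J -> a J = 0.
  by move=> nS; apply/eqP/negPn/negP => h; apply: nS; left.
have bS J : ~ S J -> b J = 0.
  by move=> nS; apply/eqP/negPn/negP => h; apply: nS; right.
have cS J : ~ S J -> c * a J + b J = 0.
  by move=> nS; rewrite aS// bS// mulr0 addr0.
exists (fun J => c * a J + b J); split.
  apply: sub_finite_set fS => J /= h; apply: contrapT => /cS h0.
  by rewrite h0 eqxx in h.
rewrite (E S a)// (E S b)// (E S)// scaler_sumr -big_split/=.
by apply: eq_bigr => J _; rewrite scalerDl scalerA.
Qed.

(* Y_n as a vector space; it depends on Y only through its norm. *)
Definition Yset (n : nat) : set (R -> R) :=
  haar_span [set Some I | I in [set I | (lvl I <= n)%N]].

Definition Ypred (n : nat) : {pred R -> R} := [pred f | f \in Yset n].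

HB.instance Definition _ n := GRing.isSubmodClosed.Build _ _ (Ypred n)
  (haar_span_submod_closed _).

Definition Yspace (n : nat) := {f : R -> R | f \in Ypred n}.

HB.instance Definition _ n := SubType.on (Yspace n).
HB.instance Definition _ n := Choice.on (Yspace n).
HB.instance Definition _ n := [SubChoice_isSubLmodule of Yspace n by <:].

Lemma haar_Ypred n I : (lvl I <= n)%N -> haar (Some I) \in Ypred n.
Proof.
move=> In; rewrite !inE; exists (fun J => (J == Some I)%:R); split.
  apply: sub_finite_set (finite_set1 (Some I)) => J /=.
  by case: (eqVneq J (Some I)) => //=; rewrite eqxx.
rewrite /haar_sum -(@fsbig_widen _ _ _ _ [set Some I]).
- by rewrite fsbig_set1/= eqxx scale1r.
- by move=> _ -> /=; exists I.
- by move=> J [_ /eqP/negPf JI] /=; rewrite JI scale0r.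
Qed.

Definition haarY n I (In : (lvl I <= n)%N) : Yspace n :=
  exist _ (haar (Some I)) (haar_Ypred In).

Definition Ynorm (X : haar_system_space) (k : rad_kind) n (f : Yspace n) : R :=
  hardy_norm X k (val f).

Definition opnorm (X : haar_system_space) (k : rad_kind) m n
    (T : Yspace m -> Yspace n) : \bar R :=
  ereal_sup [set (Ynorm X k (T f))%:E | f in [set f | Ynorm X k f <= 1]].

Definition large_positive_diagonal (d : R) N (T : Yspace N -> Yspace N) :=
  forall I (IN : (lvl I <= N)%N),
    d * len I <= pairing (haar (Some I)) (val (T (haarY IN))).

Definition factors_through (X : haar_system_space) (k : rad_kind) n N
    (S : {linear Yspace n -> Yspace n}) (T : {linear Yspace N -> Yspace N})
    (C : R) :=
  exists (B : {linear Yspace n -> Yspace N}) (A : {linear Yspace N -> Yspace n}),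
    (opnorm X k A * opnorm X k B <= C%:E)%E /\ S =1 A \o T \o B.

Definition log2 (x : R) : R := ln x / ln 2.

End Haar.

(* Main.v *)
From HB Require Import structures.
Require Import Defs.
From mathcomp Require Import all_boot all_order all_algebra.
From mathcomp Require Import all_classical all_reals all_analysis.
From mathcomp Require Import measurable_realfun fingroup perm zify ring lra.
Import Order.TTheory GRing.Theory Num.Theory.
Local Open Scope ring_scope.
Set Implicit Arguments.
Unset Strict Implicit.
Unset Printing Implicit Defensive.

(** Nodes of the dyadic tree are bit sequences: the empty sequence is [0,1), and
    the Haar function of a node [I] takes at a point with binary expansion [x],
    when [I] is a prefix of [x], the sign given by the bit number [size I].  All
    norms are computed on finite grids, whose cells are the bit sequences of a
    fixed length.  There the outer norm is invariant under permutations and sign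
    changes, hence monotone ([snorm_le]) and contracted by conditional
    expectations ([snorm_cond]).

    A faithful Haar system is given by increasing levels [s] and signs [th].  If
    [pat th s x] lists the bits of [x] in the positions [s], twisted by the signs,
    then the new system is the old one composed with this map, which preserves
    the distribution.  So replacing the Haar functions by the new system is an
    isometry [embed] ([nu_embed]), and its left inverse [compress] is a conditional
    expectation, hence a contraction ([nu_compress]).  It remains to find a system
    for which the compression of [T] is close to a multiple [c] of the identity: it
    is then invertible ([factor_of_approx]), and [1 - T] can be treated in the same
    way with [1 - c] ([factor_of_approx_compl]).

    Signs are chosen at random.  The matrix entries of the compression are sums of
    entries of [T] with random signs, and their second moments are controlled by
    the Hilbert-Schmidt norm of the part of [T] that maps one level into another.
    That norm is at most of order [2 ^- (k0 / 4)] when all levels are at least [k0]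
    ([form_hs_le]): averaging over signs turns a sum of squares into expressions
    in which the bound on [T] can be used, once on rows and once on columns, and
    the product of the two estimates is small whatever the outer norm.  The
    diagonal entries concentrate around the average of the diagonal of [T] over the
    corresponding level, by a martingale argument ([hit_mean_le]).  A first level
    [k0] of order [16 n + 4 log2 (Gamma / kappa)], where [kappa] is [eta * delta],
    beats the number of matrix entries.

    The level averages of the diagonal lie in [[- Gamma, Gamma]], so among enough
    levels there are [n + 1] on which they almost agree ([stable_levels]).  What is
    left is a multiplier that is small and constant on each level.  It costs a
    factor [n + 1], one for each level ([nu_level_mul]), or only the constant [K]
    when the Haar system is unconditional ([unconditional_mul]); this is the
    difference between the two bounds on [N]. *)

(** * Averages over finite types *)

Section Average.
Variable R : realType.

Definition avg (T : finType) (F : T -> R) : R := (\sum_x F x) / #|T|%:R.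

Lemma eq_avg (T : finType) (F G : T -> R) : F =1 G -> avg F = avg G.
Proof. by move=> FG; rewrite /avg (eq_bigr G). Qed.

Lemma avgD (T : finType) (F G : T -> R) :
  avg (fun x => F x + G x) = avg F + avg G.
Proof. by rewrite /avg big_split mulrDl. Qed.

Lemma avgZ (T : finType) c (F : T -> R) : avg (fun x => c * F x) = c * avg F.
Proof. by rewrite /avg -mulr_sumr mulrA. Qed.

Lemma avgN (T : finType) (F : T -> R) : avg (fun x => - F x) = - avg F.
Proof. by rewrite /avg sumrN mulNr. Qed.

Lemma avg_sum (T : finType) (I : Type) (r : seq I) (P : pred I)
    (F : I -> T -> R) :
  avg (fun x => \sum_(i <- r | P i) F i x) = \sum_(i <- r | P i) avg (F i).
Proof. by rewrite /avg exchange_big mulr_suml. Qed.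

Lemma avg_cst (T : finType) (x0 : T) c : avg (fun _ : T => c) = c.
Proof.
rewrite /avg sumr_const -[X in X / _]mulr_natr mulfK// pnatr_eq0 -lt0n.
by apply/card_gt0P; exists x0.
Qed.

Lemma ler_avg (T : finType) (F G : T -> R) :
  (forall x, F x <= G x) -> avg F <= avg G.
Proof. by move=> FG; rewrite ler_wpM2r ?invr_ge0// ler_sum. Qed.

Lemma avg_ge0 (T : finType) (F : T -> R) : (forall x, 0 <= F x) -> 0 <= avg F.
Proof. by move=> F0; rewrite divr_ge0// sumr_ge0. Qed.

Lemma avg_inj (T : finType) (h : T -> T) (F : T -> R) :
  injective h -> avg (fun x => F (h x)) = avg F.
Proof. by move=> hI; rewrite /avg [in RHS](reindex_inj hI). Qed.

Lemma avg_odd (T : finType) (h : T -> T) (F : T -> R) :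
  injective h -> (forall x, F (h x) = - F x) -> avg F = 0.
Proof.
move=> hI Fh; apply/eqP; rewrite -[_ == 0](mulrn_eq0 _ 2) mulr2n.
by rewrite -[X in X + _](avg_inj _ hI) (eq_avg Fh) avgN addNr.
Qed.

Lemma exchange_avg (T U : finType) (F : T -> U -> R) :
  avg (fun x => avg (F x)) = avg (fun y => avg (F^~ y)).
Proof.
rewrite /avg -!mulr_suml exchange_big /= -!mulrA; congr (_ * _).
by rewrite mulrC.
Qed.

Lemma avg_le_ex (T : finType) (x0 : T) (F : T -> R) c :
  avg F <= c -> exists x, F x <= c.
Proof.
move=> Fc; have [x _ xmin] := @arg_minP _ _ _ x0 predT F isT.
exists x; apply: le_trans Fc; rewrite -[leLHS](avg_cst x0).
by apply: ler_avg => y; apply: xmin.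
Qed.

End Average.

(** * Bit patterns *)

Section Bits.
Variable R : realType.
Local Notation avg := (@avg R _).

Definition flipb m (i : nat) (x : m.-tuple bool) : m.-tuple bool :=
  [tuple tnth x j (+) (j == i :> nat) | j < m].

Lemma nth_flipb m i (x : m.-tuple bool) j : (i < m)%N ->
  nth false (flipb i x) j = nth false x j (+) (j == i).
Proof.
move=> im; case: (ltnP j m) => jm.
  rewrite -[j]/(nat_of_ord (Ordinal jm)) -!tnth_nth.
  by rewrite tnth_mktuple.
rewrite !nth_default ?size_tuple//; case: eqP => // ji; lia.
Qed.

Lemma flipbK m i : involutive (@flipb m i).
Proof.
move=> x; apply: eq_from_tnth => j; rewrite !tnth_mktuple.
by case: (_ == _); rewrite ?addbT ?addbF ?negbK.
Qed.

Lemma flipb_inj m i : injective (@flipb m i).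
Proof. exact: inv_inj (@flipbK m i). Qed.

Lemma take_flipb m i (x : m.-tuple bool) k : (k <= i)%N ->
  take k (flipb i x) = take k x.
Proof.
move=> ki; have sE: size (take k (flipb i x)) = size (take k x).
  by rewrite !size_take !size_tuple.
case: (ltnP i m) => im; last first.
  rewrite /flipb; congr take; congr val; apply: eq_from_tnth => j.
  rewrite tnth_mktuple; case: eqP; last by rewrite addbF.
  by have := ltn_ord j; lia.
apply: (@eq_from_nth _ false) => // j jk.
have jk' : (j < k)%N by move: jk; rewrite size_take; case: ifP => //; lia.
by rewrite !nth_take// nth_flipb//; case: eqP; [lia|rewrite addbF].
Qed.

(** Multiplying Haar functions by signs [th] amounts to exchanging the two halves of
    some intervals, that is, to twisting the bits of [x]. *)
Definition tbit (th : seq bool -> bool) (x : seq bool) (i : nat) : bool :=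
  nth false x i (+) th (take i x).

Definition pat th (s : seq nat) (x : seq bool) : seq bool :=
  [seq tbit th x i | i <- s].

Lemma size_pat th s x : size (pat th s x) = size s.
Proof. exact: size_map. Qed.

Lemma tbit_flip_lt th m k (x : m.-tuple bool) i : (i < k)%N -> (k < m)%N ->
  tbit th (flipb k x) i = tbit th x i.
Proof.
move=> ik km; rewrite /tbit nth_flipb// take_flipb ?(ltnW ik)//.
by rewrite ltn_eqF// addbF.
Qed.

Lemma tbit_flip th m k (x : m.-tuple bool) : (k < m)%N ->
  tbit th (flipb k x) k = ~~ tbit th x k.
Proof. by move=> km; rewrite /tbit nth_flipb// take_flipb// eqxx addbT addNb. Qed.

Lemma tbit_take th k (x : seq bool) i : (i < k)%N ->
  tbit th (take k x) i = tbit th x i.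
Proof. by move=> ik; rewrite /tbit nth_take// take_takel// ltnW. Qed.

Lemma pat_take th s k x : all (fun i => i < k)%N s ->
  pat th s (take k x) = pat th s x.
Proof. by move=> /allP sk; apply/eq_in_map => i /sk /tbit_take. Qed.

Lemma pat_flip th s m k (x : m.-tuple bool) :
  all (fun i => i < k)%N s -> (k < m)%N -> pat th s (flipb k x) = pat th s x.
Proof. by move=> /allP sk km; apply/eq_in_map => i /sk ik; apply: tbit_flip_lt. Qed.

Lemma pat_id x k : (k <= size x)%N -> pat (fun=> false) (iota 0 k) x = take k x.
Proof.
move=> kx; apply: (@eq_from_nth _ false).
  by rewrite size_pat size_iota size_take_min; lia.
move=> i; rewrite size_pat size_iota => ik.
by rewrite (nth_map 0%N) ?size_iota// nth_iota// /tbit addbF nth_take.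
Qed.

(** The density, with respect to the uniform distribution of [x], of the event that
    [x] shows the pattern [y] in the first [l] positions of [s]. *)
Definition wgt th (s : seq nat) l (y x : seq bool) : R :=
  2 ^+ l * (pat th (take l s) x == take l y)%:R.

Lemma wgt0 th s y x : wgt th s 0 y x = 1.
Proof. by rewrite /wgt !take0 eqxx expr0 mulr1. Qed.

Lemma wgt_ge0 th s l y x : 0 <= wgt th s l y x.
Proof. by rewrite /wgt mulr_ge0// exprn_ge0. Qed.

Lemma wgtS th s l y x : (l < size s)%N -> (l < size y)%N ->
  wgt th s l.+1 y x = wgt th s l y x *
    (1 + (-1) ^+ (tbit th x (nth 0%N s l) (+) nth false y l)).
Proof.
move=> ls ly; rewrite /wgt (take_nth 0%N)// (take_nth false ly).
rewrite /pat map_rcons -/(pat _ _ _) eqseq_rcons exprS.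
case: eqP => _ /=; last by rewrite !mulr0 mul0r.
by case: (tbit _ _ _); case: nth => /=; rewrite !(mulr0, mulr1, subrr)//; ring.
Qed.

Lemma sorted_take_lt s l i : sorted ltn s -> (l <= i < size s)%N ->
  all (fun k => k < nth 0%N s i)%N (take l s).
Proof.
move=> ss /andP[li iS]; apply/(all_nthP 0%N) => j; rewrite size_take_min => jl.
rewrite nth_take; last by lia.
apply: (sorted_ltn_nth ltn_trans 0%N ss); rewrite ?inE; lia.
Qed.

Lemma wgt_flip th s l y m (x : m.-tuple bool) k :
  all (fun i => i < k)%N (take l s) -> (k < m)%N ->
  wgt th s l y (flipb k x) = wgt th s l y x.
Proof. by move=> sk km; rewrite /wgt pat_flip. Qed.

Section Sorted.
Variables (th : seq bool -> bool) (s : seq nat) (m : nat).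
Hypotheses (ss : sorted ltn s) (sm : all (fun i => i < m)%N s).

Let nth_ltm i : (i < size s)%N -> (nth 0%N s i < m)%N.
Proof. by move=> iS; apply: (allP sm); apply: mem_nth. Qed.

(** Each factor of [wgt] is one plus a sign that changes when one bit of [x] is
    flipped; factors whose bit is not seen by [G] average out. *)
Lemma avg_wgt l l' y (G : m.-tuple bool -> R) :
  (l <= l')%N -> (l' <= size s)%N -> (l' <= size y)%N ->
  (forall i, (l <= i < l')%N -> forall x, G (flipb (nth 0%N s i) x) = G x) ->
  avg (fun x : m.-tuple bool => wgt th s l' y x * G x) =
  avg (fun x : m.-tuple bool => wgt th s l y x * G x).
Proof.
elim: l' => [|l' IH] ll' l's l'y Gf.
  by have -> : l = 0%N by lia.
case: (ltngtP l l'.+1) ll' => // [ll' _|-> //].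
have IH' : avg (fun x : m.-tuple bool => wgt th s l' y x * G x) =
    avg (fun x : m.-tuple bool => wgt th s l y x * G x).
  by apply: IH => [|||i il x]; [lia|lia|lia|apply: Gf; lia].
rewrite -{}IH'.
set k := nth 0%N s l'.
pose F (x : m.-tuple bool) :=
  wgt th s l' y x * ((-1) ^+ (tbit th x k (+) nth false y l')) * G x.
have F0 : avg F = 0.
  apply: (avg_odd (@flipb_inj m k)) => x; rewrite /F Gf; last by lia.
  rewrite wgt_flip ?nth_ltm//; last by apply: sorted_take_lt; rewrite // leqnn.
  rewrite tbit_flip ?nth_ltm// addNb signrN; ring.
rewrite -[RHS]addr0 -F0 -avgD; apply: eq_avg => x.
by rewrite wgtS// /F -/k; ring.
Qed.

Lemma avg_wgt1 l y : (l <= size s)%N -> (l <= size y)%N ->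
  avg (fun x : m.-tuple bool => wgt th s l y x) = 1.
Proof.
move=> ls ly; transitivity (avg (fun x : m.-tuple bool => wgt th s l y x * 1)).
  by apply: eq_avg => x; rewrite mulr1.
rewrite (@avg_wgt 0)//.
rewrite (@eq_avg _ _ _ (fun=> 1)) ?(avg_cst [tuple false | _ < m])// => x.
by rewrite wgt0 mulr1.
Qed.

(** Every pattern has the same probability, by [avg_wgt1]. *)
Lemma avg_pat (F : seq bool -> R) :
  avg (fun x : m.-tuple bool => F (pat th s x)) =
  avg (fun y : (size s).-tuple bool => F y).
Proof.
transitivity (avg (fun x : m.-tuple bool => avg (fun y : (size s).-tuple bool =>
    F y * wgt th s (size s) y x))).
  apply: eq_avg => x; rewrite /avg.
  have sp : size (pat th s x) == size s by rewrite size_pat.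
  rewrite (bigD1 (Tuple sp))//= big1 => [|y yx]; last first.
    rewrite /wgt take_size take_oversize ?size_tuple//.
    by case: eqP => [E|]; [case/eqP: yx; apply: val_inj|rewrite !mulr0].
  rewrite /wgt take_size take_oversize ?size_pat// eqxx mulr1 addr0.
  by rewrite card_tuple card_bool natrX mulfK// expf_neq0.
rewrite exchange_avg; apply: eq_avg => y.
by rewrite avgZ avg_wgt1 ?size_tuple// mulr1.
Qed.

End Sorted.

Lemma all_iota_lt k m : (k <= m)%N -> all (fun i => i < m)%N (iota 0 k).
Proof. by move=> km; apply/allP => i; rewrite mem_iota; lia. Qed.

Lemma avg_take_tuple k m (F : seq bool -> R) : (k <= m)%N ->
  avg (fun x : m.-tuple bool => F (take k x)) =
  avg (fun y : k.-tuple bool => F y).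
Proof.
move=> km; have := avg_pat (fun=> false) (iota_ltn_sorted 0 k) (all_iota_lt km) F.
rewrite [X in _ = X -> _](_ : _ = avg (fun y : k.-tuple bool => F y)); last first.
  by rewrite size_iota.
move=> <-; apply: eq_avg => x; rewrite pat_id// size_tuple//.
Qed.

Lemma sum_bseq_level N k (F : seq bool -> R) : (k <= N)%N ->
  \sum_(J : N.-bseq bool | size J == k) F J = \sum_(y : k.-tuple bool) F y.
Proof.
move=> kN; rewrite (reindex_onto (fun y : k.-tuple bool => insub_bseq N y)
   (fun J : N.-bseq bool => insubd [tuple false | _ < k] (val J))) /=; last first.
  move=> J /eqP Jk; apply: val_inj => /=.
  by rewrite /insub_bseq !insubdK// unfold_in ?insubdK ?unfold_in ?size_tuple ?Jk.
have E (y : k.-tuple bool) : insub_bseq N y = y :> seq bool.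
  by rewrite /insub_bseq insubdK// unfold_in size_tuple.
apply: eq_big => [y|y _]; last by rewrite E.
rewrite E size_tuple eqxx /=; apply/eqP; apply: val_inj.
by rewrite insubdK// unfold_in size_tuple.
Qed.

Lemma sum_level_cst N k (c : R) : (k <= N)%N ->
  \sum_(J : N.-bseq bool | size J == k) c = 2 ^+ k * c.
Proof.
move=> kN; rewrite (sum_bseq_level (fun=> c) kN) sumr_const card_tuple card_bool.
by rewrite -[LHS]mulr_natl natrX.
Qed.

Lemma avg_take N k m (F : seq bool -> R) : (k <= m)%N -> (k <= N)%N ->
  avg (fun x : m.-tuple bool => F (take k x)) =
  2 ^- k * \sum_(J : N.-bseq bool | size J == k) F J.
Proof.
move=> km kN; rewrite avg_take_tuple// sum_bseq_level// /avg.
by rewrite card_tuple card_bool natrX mulrC.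
Qed.

End Bits.

(** * Rearrangement-invariant norms of dyadic step functions *)

Section StepNorm.
Variable R : realType.
Local Notation avg := (@avg R _).

(** What a rearrangement-invariant norm says about functions that are constant on
    the intervals of a dyadic grid.  The grid is a parameter, because functions on
    different grids have to be compared. *)
Record step_norm := StepNorm {
  snorm : forall m, (m.-tuple bool -> R) -> R;
  snormD : forall m (v w : m.-tuple bool -> R),
    snorm (fun x => v x + w x) <= snorm v + snorm w;
  snormZ : forall m c (v : m.-tuple bool -> R),
    snorm (fun x => c * v x) = `|c| * snorm v;
  snorm_dist : forall m m' (v : m.-tuple bool -> R) (w : m'.-tuple bool -> R),
    (forall P : pred R, avg (fun x : m.-tuple bool => (P `|v x|)%:R) =
       avg (fun y : m'.-tuple bool => (P `|w y|)%:R)) -> snorm v = snorm w;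
  snorm1 : forall m, snorm (fun _ : m.-tuple bool => 1) = 1
}.

Variable S : step_norm.
Local Notation nX := (snorm S).

Lemma snorm_abs m (v w : m.-tuple bool -> R) :
  (forall x, `|v x| = `|w x|) -> nX v = nX w.
Proof. by move=> vw; apply: snorm_dist => P; apply: eq_avg => x; rewrite vw. Qed.

Lemma eq_snorm m (v w : m.-tuple bool -> R) : v =1 w -> nX v = nX w.
Proof. by move=> vw; apply: snorm_abs => x; rewrite vw. Qed.

Lemma snorm0 m : nX (fun _ : m.-tuple bool => 0) = 0.
Proof.
rewrite (@eq_snorm _ _ (fun x : m.-tuple bool => 0 * 0)) => [|x]; last first.
  by rewrite mul0r.
by rewrite snormZ normr0 mul0r.
Qed.

Lemma snorm_ge0 m (v : m.-tuple bool -> R) : 0 <= nX v.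
Proof.
have := snormD S v (fun x => - v x).
rewrite (@eq_snorm _ _ (fun _ => 0)) => [|x]; last exact: subrr.
rewrite snorm0 (@snorm_abs _ _ v) => [|x]; last by rewrite normrN.
by lra.
Qed.

Lemma snorm_sum m (I : Type) (r : seq I) (P : pred I)
    (v : I -> m.-tuple bool -> R) :
  nX (fun x => \sum_(i <- r | P i) v i x) <= \sum_(i <- r | P i) nX (v i).
Proof.
elim: r => [|i r IH].
  rewrite big_nil (@eq_snorm _ _ (fun=> 0)) ?snorm0// => x.
  by rewrite big_nil.
rewrite big_cons; case: ifPn => Pi.
  rewrite (@eq_snorm _ _ (fun x => v i x + \sum_(j <- r | P j) v j x)).
    by apply: le_trans (snormD _ _ _) _; rewrite lerD2l.
  by move=> x; rewrite big_cons Pi.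
rewrite (@eq_snorm _ _ (fun x => \sum_(j <- r | P j) v j x))// => x.
by rewrite big_cons (negPf Pi).
Qed.

Lemma snorm_inj m (h : m.-tuple bool -> m.-tuple bool) v :
  injective h -> nX (fun x => v (h x)) = nX v.
Proof.
move=> hI; apply: snorm_dist => P.
by rewrite -(avg_inj (fun x => (P `|v x|)%:R) hI).
Qed.

(** Shrinking one value: the smaller function is a convex combination of the
    larger one and of the same function with one sign changed. *)
Let snorm_le1 m (v w : m.-tuple bool -> R) x0 :
  (forall x, x != x0 -> v x = w x) -> `|v x0| <= `|w x0| -> nX v <= nX w.
Proof.
move=> vw le0; have [w0|w0] := eqVneq (w x0) 0.
  rewrite (@eq_snorm _ _ w)// => x; have [->|/vw//] := eqVneq x x0.
  by move: le0; rewrite w0 normr0 normr_le0 => /eqP ->.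
pose l := (1 + v x0 / w x0) / 2.
pose w' x := if x == x0 then - w x else w x.
have /andP[l0 l1] : - 1 <= v x0 / w x0 <= 1.
  by rewrite -ler_norml normrM normfV ler_pdivrMr ?normr_gt0// mul1r.
rewrite (@eq_snorm _ _ (fun x => l * w x + (1 - l) * w' x)) => [|x].
  apply: le_trans (snormD _ _ _) _; rewrite !snormZ (@snorm_abs _ w' w).
    by rewrite -mulrDl !ger0_norm ?subrKC ?mul1r// /l; lra.
  by move=> x; rewrite /w'; case: eqP => // _; rewrite normrN.
rewrite /w'; case: eqVneq => [->|/vw ->]; last by ring.
by rewrite /l; field.
Qed.

Lemma snorm_le m (v w : m.-tuple bool -> R) :
  (forall x, `|v x| <= `|w x|) -> nX v <= nX w.
Proof.
move=> vw; pose u (s : seq (m.-tuple bool)) x := if x \in s then v x else w x.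
have uw s : nX (u s) <= nX w.
  elim: s => [|y s IH]; first by rewrite (@eq_snorm _ _ w).
  apply: le_trans IH; apply: (@snorm_le1 _ _ _ y) => [x xy|].
    by rewrite /u in_cons (negPf xy).
  by rewrite /u mem_head; case: ifP.
rewrite (@eq_snorm _ _ (u (enum {: m.-tuple bool}))) => [|x]; first exact: uw.
by rewrite /u mem_enum.
Qed.

Lemma snorm_cst m c : nX (fun _ : m.-tuple bool => c) = `|c|.
Proof.
rewrite -[RHS]mulr1 -(snorm1 S m) -snormZ; apply: eq_snorm => x.
by rewrite mulr1.
Qed.

(** Conditional expectations are contractive: averaging over the fibers of [p]
    is averaging over the group of permutations that preserve [p]. *)
Lemma snorm_cond m (T : eqType) (p : m.-tuple bool -> T)
    (v w : m.-tuple bool -> R) :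
  (forall x, w x * #|[pred y | p y == p x]|%:R = \sum_(y | p y == p x) v y) ->
  nX w <= nX v.
Proof.
move=> wE.
pose G := finset (fun g : {perm m.-tuple bool} => [forall x, p (g x) == p x]).
have GP (g : {perm m.-tuple bool}) x : g \in G -> p (g x) = p x.
  by rewrite inE => /forallP/(_ x)/eqP.
have G1 : 1%g \in G by rewrite inE; apply/forallP => x; rewrite perm1.
have G0 : 0 < #|G|%:R :> R by rewrite ltr0n; apply/card_gt0P; exists 1%g.
pose w' x := #|G|%:R^-1 * \sum_(g in G) v (g x).
have w'_fib x y : p y = p x -> w' y = w' x.
  move=> yx; rewrite /w'; congr (_ * _).
  rewrite [RHS](reindex_inj (mulgI (tperm x y))) /=.
  apply: eq_big => [g|g _]; last by rewrite permM tpermL.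
  apply/idP/idP => gG; rewrite inE; apply/forallP => z.
    by rewrite permM GP//; case: tpermP => [->|->|//]; rewrite yx.
  have := GP _ (tperm x y z) gG; rewrite permM tpermK => ->.
  by case: tpermP => [->|->|//]; rewrite yx.
have w'E x : w' x * #|[pred y | p y == p x]|%:R = \sum_(y | p y == p x) v y.
  transitivity (\sum_(y | p y == p x) w' y).
    rewrite mulr_natr -sumr_const; apply: eq_big => // y /eqP yx.
    by apply/esym/w'_fib.
  rewrite -mulr_sumr exchange_big /=.
  rewrite (eq_bigr (fun=> \sum_(y | p y == p x) v y)) => [|g gG].
    by rewrite sumr_const -[X in _ * X]mulr_natr mulrCA mulVf ?gt_eqF// mulr1.
  rewrite [RHS](reindex_inj (@perm_inj _ g)) /=; apply: eq_bigl => y.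
  by rewrite GP.
have ww' x : w x = w' x.
  have fib0 : #|[pred y | p y == p x]|%:R != 0 :> R.
    rewrite pnatr_eq0 -lt0n; apply/card_gt0P; exists x.
    by rewrite inE.
  by apply: (mulIf fib0); rewrite wE w'E.
rewrite (eq_snorm ww') /w' snormZ ger0_norm ?invr_ge0 ?(ltW G0)//.
rewrite ler_pdivrMl//; apply: le_trans (snorm_sum _ _ _) _.
rewrite (eq_bigr (fun=> nX v)) => [|g _]; last exact: snorm_inj (@perm_inj _ g).
by rewrite sumr_const mulr_natl.
Qed.

Lemma avg_le_snorm m (v : m.-tuple bool -> R) :
  avg (fun x : m.-tuple bool => `|v x|) <= nX v.
Proof.
rewrite -(@snorm_abs _ (fun x => `|v x|)) => [|x]; last by rewrite normr_id.
set a := avg _; rewrite -[leLHS]ger0_norm ?avg_ge0// -(snorm_cst m).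
apply: (@snorm_cond _ _ (fun=> true)) => x.
rewrite [RHS](eq_bigl xpredT)// (@eq_card _ _ {: m.-tuple bool})//.
by rewrite /a /avg mulfVK// pnatr_eq0 -lt0n; apply/card_gt0P; exists x.
Qed.

Lemma snorm_pat th s m (v : seq bool -> R) :
  sorted ltn s -> all (fun i => i < m)%N s ->
  nX (fun x : m.-tuple bool => v (pat th s x)) =
  nX (fun y : (size s).-tuple bool => v y).
Proof.
move=> ss sm; apply: snorm_dist => P.
exact: (avg_pat th ss sm (fun y => (P `|v y|)%:R)).
Qed.

End StepNorm.

(** * The inner norm of a Haar system Hardy space *)

Section RademacherAverage.
Variable R : realType.
Variable k : rad_kind.
Implicit Types c : nat -> R.

(** The inner integral of the norm at a point at which the Haar functions of
    level [i] contribute [c i]. *)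
Definition radnorm m c : R :=
  match k with
  | Independent =>
      avg (fun e : m.-tuple bool => `|\sum_(i < m) (-1) ^+ nth false e i * c i|)
  | Constant => `|\sum_(i < m) c i|
  end.

Lemma eq_radnorm m c c' : (forall i, (i < m)%N -> c i = c' i) ->
  radnorm m c = radnorm m c'.
Proof.
move=> cc; rewrite /radnorm; case: k.
  apply: eq_avg => e; congr (`| _ |); apply: eq_bigr => i _.
  by rewrite cc.
by congr (`| _ |); apply: eq_bigr => i _; rewrite cc.
Qed.

Lemma radnorm_ge0 m c : 0 <= radnorm m c.
Proof. by rewrite /radnorm; case: k => //; apply: avg_ge0. Qed.

Lemma radnormD m c c' :
  radnorm m (fun i => c i + c' i) <= radnorm m c + radnorm m c'.
Proof.
rewrite /radnorm; case: k; last by rewrite big_split ler_normD.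
rewrite -avgD; apply: ler_avg => e; apply: le_trans (ler_normD _ _).
by rewrite -big_split /=; under eq_bigr do rewrite mulrDr.
Qed.

Lemma radnormZ m a c : radnorm m (fun i => a * c i) = `|a| * radnorm m c.
Proof.
rewrite /radnorm; case: k; last by rewrite -mulr_sumr normrM.
rewrite -avgZ; apply: eq_avg => e; rewrite -normrM mulr_sumr.
by congr (`| _ |); apply: eq_bigr => i _; rewrite mulrCA.
Qed.

Lemma radnorm_avg m (T : finType) (W : T -> R) (c : T -> nat -> R) :
  (forall x, 0 <= W x) ->
  radnorm m (fun i => avg (fun x => W x * c x i)) <=
  avg (fun x => W x * radnorm m (c x)).
Proof.
move=> W0; have s0 (r : seq T) :
    radnorm m (fun i => \sum_(x <- r) W x * c x i) <=
    \sum_(x <- r) W x * radnorm m (c x).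
  elim: r => [|x r IH].
    rewrite big_nil (@eq_radnorm _ _ (fun i => 0 * 0)) => [|i _].
      by rewrite (radnormZ m 0 (fun=> 0)) normr0 mul0r.
    by rewrite big_nil mul0r.
  rewrite big_cons (@eq_radnorm _ _
    (fun i => W x * c x i + \sum_(y <- r) W y * c y i)) => [|i _].
    apply: le_trans (radnormD _ _ _) _.
    by rewrite radnormZ ger0_norm// lerD2l.
  by rewrite big_cons.
rewrite (@eq_radnorm _ _
  (fun i => #|T|%:R^-1 * \sum_(x : T) W x * c x i)) => [|i _].
  by rewrite radnormZ ger0_norm ?invr_ge0// mulrC ler_wpM2r ?invr_ge0.
by rewrite /avg mulrC.
Qed.

(** The coefficients at a point of a function whose levels [0, 1, ..] have been moved to
    the levels [s]. *)
Definition spread (s : seq nat) c (i : nat) : R :=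
  if i \in s then c (index i s) else 0.

Lemma sum_spread s m (F : nat -> nat -> R) : uniq s ->
  all (fun i => i < m)%N s ->
  \sum_(i < m) (if (i : nat) \in s then F i (index (i : nat) s) else 0) =
  \sum_(j < size s) F (nth 0%N s j) j.
Proof.
move=> us /allP sm.
transitivity (\sum_(i <- s) F i (index i s)); last first.
  rewrite (big_nth 0%N) big_mkord; apply: eq_bigr => j _.
  by rewrite index_uniq.
rewrite -(big_mkord xpredT (fun i => if i \in s then F i (index i s) else 0)).
rewrite -big_mkcond -big_filter; apply: perm_big.
apply: uniq_perm => // [|i]; first by rewrite filter_uniq ?iota_uniq.
rewrite mem_filter mem_index_iota /=; case: (boolP (i \in s)) => //=.
by move=> /sm.
Qed.

Lemma radnorm_spread s m c : sorted ltn s -> all (fun i => i < m)%N s ->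
  radnorm m (spread s c) = radnorm (size s) c.
Proof.
move=> ss sm; have us : uniq s by move: ss; rewrite ltn_sorted_uniq_leq => /andP[].
rewrite /radnorm; case: k; last first.
  by rewrite /spread (sum_spread (fun _ j => c j) us sm).
rewrite -(avg_pat (fun=> false) ss sm
  (fun y => `|\sum_(i < size s) (-1) ^+ nth false y i * c i|)).
apply: eq_avg => e; congr (`| _ |).
transitivity (\sum_(i < m) if (i : nat) \in s then
    (-1) ^+ nth false e i * c (index (i : nat) s) else 0).
  by apply: eq_bigr => i _; rewrite /spread; case: ifP; rewrite ?mulr0.
rewrite (sum_spread (fun i j => (-1) ^+ nth false e i * c j) us sm).
by apply: eq_bigr => j _; rewrite (nth_map 0%N)// /tbit addbF.
Qed.

Lemma radnorm_single m a v : (a < m)%N ->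
  radnorm m (fun i => if i == a then v else 0) = `|v|.
Proof.
move=> am; rewrite (@eq_radnorm _ _ (spread [:: a] (fun=> v))) => [|i _].
  rewrite radnorm_spread//= ?am// /radnorm; case: k; last by rewrite big_ord1.
  rewrite (@eq_avg _ _ _ (fun=> `|v|)) ?(avg_cst [tuple false])// => e.
  by rewrite big_ord1 normrM normrX normrN1 expr1n mul1r.
by rewrite /spread inE.
Qed.

(** The contribution of level [i] to the value of [\sum_J w J * h_J] on the cell
    [x]. *)
Definition comp N (w : N.-bseq bool -> R) (x : seq bool) (i : nat) : R :=
  (-1) ^+ nth false x i * w (insub_bseq N (take i x)).

Definition Phi N (w : N.-bseq bool -> R) (x : seq bool) : R :=
  radnorm N.+1 (comp w x).

Lemma Phi_ge0 N (w : N.-bseq bool -> R) x : 0 <= Phi w x.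
Proof. exact: radnorm_ge0. Qed.

Lemma insub_bseqK N s : (size s <= N)%N -> insub_bseq N s = s :> seq bool.
Proof. by move=> sN; rewrite /insub_bseq insubdK. Qed.

Lemma insub_bseq_val N (J : N.-bseq bool) : insub_bseq N J = J.
Proof. by apply: val_inj; rewrite /= insub_bseqK// size_bseq. Qed.

Lemma avg_cone N (J : N.-bseq bool) : avg (fun x : N.+1.-tuple bool =>
  2 ^+ size J * (take (size J) x == J)%:R) = 1 :> R.
Proof.
have aN := size_bseq J.
rewrite -[RHS](@avg_wgt1 R (fun=> false) (iota 0 N.+1) N.+1 _ _ (size J) J)
  ?iota_ltn_sorted ?all_iota_lt ?size_iota//; last exact: leqW.
apply: eq_avg => x; rewrite /wgt take_iota (_ : minn (size J) N.+1 = size J); last by lia.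
by rewrite pat_id ?size_tuple ?leqW// (take_oversize (leqnn _)).
Qed.

(** Testing against the Haar function of the node [J] recovers the coefficient
    at [J]: at every other level the sum is odd under the flip of one bit. *)
Lemma avg_comp_haar N (w : N.-bseq bool -> R) (J : N.-bseq bool) i :
  (i < N.+1)%N ->
  avg (fun x : N.+1.-tuple bool => 2 ^+ size J * (take (size J) x == J)%:R *
    ((-1) ^+ nth false x (size J) * comp w x i)) =
  if i == size J then w J else 0.
Proof.
set a := size J => iN; have aN : (a <= N)%N := size_bseq J.
pose W (x : seq bool) : R := 2 ^+ a * (take a x == J)%:R.
have Wf l (x : N.+1.-tuple bool) : (a <= l)%N -> W (flipb l x) = W x.
  by move=> al; rewrite /W take_flipb.
rewrite -/(W _); case: (ltngtP i a) => [ia|ai|->].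
- apply: (avg_odd (@flipb_inj _ a)) => x; rewrite -!/(W _) Wf//.
  rewrite nth_flipb; last by lia.
  rewrite /comp nth_flipb; last by lia.
  rewrite take_flipb ?(ltnW ia)// eqxx (ltn_eqF ia) addbF addbT signrN.
  by ring.
- apply: (avg_odd (@flipb_inj _ i)) => x; rewrite -!/(W _) Wf; last exact: ltnW.
  rewrite nth_flipb// /comp nth_flipb// take_flipb// eqxx (ltn_eqF ai).
  by rewrite addbF addbT signrN; ring.
- rewrite -[RHS]mulr1 -[X in _ = _ * X](avg_cone J) -avgZ; apply: eq_avg => x.
  rewrite /comp -/a; case: eqP => [->|]; last by rewrite !mulr0 mul0r.
  by rewrite insub_bseq_val [X in _ * X]mulrA -expr2 sqrr_sign; ring.
Qed.

(** [avg_comp_haar] and the convexity of the inner norm. *)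
Lemma coef_le_Phi N (w : N.-bseq bool -> R) (J : N.-bseq bool) :
  `|w J| <= avg (fun x : N.+1.-tuple bool =>
     2 ^+ size J * (take (size J) x == J)%:R * Phi w x).
Proof.
have aN : (size J < N.+1)%N by rewrite ltnS size_bseq.
rewrite -(radnorm_single _ aN) -(eq_radnorm (@avg_comp_haar _ w J)).
apply: le_trans (radnorm_avg _ _ _) _ => [x|]; first by rewrite mulr_ge0 ?exprn_ge0.
apply: ler_avg => x; rewrite radnormZ normrX normrN1 expr1n mul1r.
exact: lexx.
Qed.

End RademacherAverage.

(** * The norm on Haar coefficients *)

Section CoefNorm.
Variable R : realType.
Local Notation avg := (@avg R _).
Variables (S : step_norm R) (k : rad_kind).
Local Notation nX := (snorm S).

(** [snorm_cond] for a map all of whose fibers have the same size. *)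
Lemma snorm_fiber m (T : eqType) (p : m.-tuple bool -> T) (c : R)
    (v : m.-tuple bool -> R) :
  (forall x, avg (fun y : m.-tuple bool => c * (p y == p x)%:R) = 1) ->
  nX (fun x => avg (fun y : m.-tuple bool => c * (p y == p x)%:R * v y)) <= nX v.
Proof.
move=> c1; apply: (@snorm_cond _ _ _ _ p) => x.
have -> : #|[pred y | p y == p x]|%:R = \sum_y (p y == p x)%:R :> R.
  by rewrite -sum1_card natr_sum [LHS]big_mkcond; apply: eq_bigr => y _; rewrite inE; case: eqP.
have -> : \sum_(y | p y == p x) v y = \sum_y (p y == p x)%:R * v y.
  by rewrite big_mkcond; apply: eq_bigr => y _; case: (_ == _); rewrite ?mul1r ?mul0r.
have := c1 x; rewrite /avg -mulr_sumr => c1x.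
under eq_bigr do rewrite -mulrA.
by rewrite -mulr_sumr -[RHS]mul1r -[X in _ = X * _]c1x; ring.
Qed.

Definition nu N (w : N.-bseq bool -> R) : R :=
  nX (fun x : N.+1.-tuple bool => Phi k w x).

Section Basics.
Variable N : nat.
Implicit Types w : N.-bseq bool -> R.

Lemma eq_nu w w' : w =1 w' -> nu w = nu w'.
Proof.
move=> ww; apply: eq_snorm => x; apply: eq_radnorm => i _.
by rewrite /comp ww.
Qed.

Lemma nu_ge0 w : 0 <= nu w. Proof. exact: snorm_ge0. Qed.

Lemma nuD w w' : nu (fun J => w J + w' J) <= nu w + nu w'.
Proof.
apply: le_trans (snormD _ _ _); apply: snorm_le => x.
rewrite !ger0_norm ?addr_ge0 ?Phi_ge0//.
apply: le_trans (radnormD _ _ _ _); rewrite /Phi.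
by rewrite (@eq_radnorm _ _ _ _ (fun i => comp w x i + comp w' x i))// => i _;
   rewrite /comp mulrDr.
Qed.

Lemma nuZ c w : nu (fun J => c * w J) = `|c| * nu w.
Proof.
rewrite /nu -[`|c|]normr_id -snormZ; apply: eq_snorm => x.
rewrite /Phi -radnormZ; apply: eq_radnorm => i _.
by rewrite /comp mulrCA.
Qed.

Lemma nu0 : nu (fun _ : N.-bseq bool => 0) = 0.
Proof. by rewrite -(@eq_nu (fun J => 0 * 0)) ?nuZ ?normr0 ?mul0r// => J; rewrite mul0r. Qed.

Lemma nuB w w' : nu (fun J => w J - w' J) <= nu w + nu w'.
Proof.
apply: le_trans (nuD _ _) _; rewrite lerD2l.
by rewrite (@eq_nu _ (fun J => -1 * w' J)) ?nuZ ?normrN1 ?mul1r// => J; rewrite mulN1r.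
Qed.

Lemma nu_sum (I : Type) (r : seq I) (P : pred I) (w : I -> N.-bseq bool -> R) :
  nu (fun J => \sum_(i <- r | P i) w i J) <= \sum_(i <- r | P i) nu (w i).
Proof.
elim: r => [|i r IH].
  by rewrite big_nil (@eq_nu _ (fun=> 0)) ?nu0// => J; rewrite big_nil.
rewrite big_cons; case: ifPn => Pi.
  rewrite (@eq_nu _ (fun J => w i J + \sum_(j <- r | P j) w j J)).
    by apply: le_trans (nuD _ _) _; rewrite lerD2l.
  by move=> J; rewrite big_cons Pi.
rewrite (@eq_nu _ (fun J => \sum_(j <- r | P j) w j J))// => J.
by rewrite big_cons (negPf Pi).
Qed.

Lemma sum_by_level (F : N.-bseq bool -> R) :
  \sum_J F J = \sum_(a < N.+1) \sum_(J : N.-bseq bool | size J == a) F J.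
Proof.
rewrite (partition_big (fun J : N.-bseq bool => inord (size J) : 'I_N.+1) predT)//=.
apply: eq_bigr => a _; apply: eq_bigl => J.
by rewrite -val_eqE /= inordK// ltnS size_bseq.
Qed.

(** The level [a] part of an element is dominated pointwise by the conditional
    expectation of its inner norm. *)
Lemma snorm_level a w : (a <= N)%N ->
  nX (fun x : N.+1.-tuple bool => w (insub_bseq N (take a x))) <= nu w.
Proof.
move=> aN; have st (x : N.+1.-tuple bool) : size (take a x) = a.
  by rewrite size_take size_tuple; case: ifP => //; lia.
have c1 (x : N.+1.-tuple bool) :
    avg (fun y : N.+1.-tuple bool => 2 ^+ a * (take a y == take a x)%:R) = 1.
  by rewrite -[RHS](avg_cone R (insub_bseq N (take a x))) insub_bseqK ?st.
have := @snorm_fiber _ _ (fun x : N.+1.-tuple bool => take a x) (2 ^+ a)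
  (fun x : N.+1.-tuple bool => Phi k w x) c1.
apply: le_trans; apply: snorm_le => x; apply: le_trans (coef_le_Phi k w _) _.
rewrite insub_bseqK ?st// ger0_norm// avg_ge0// => y.
by rewrite !mulr_ge0 ?exprn_ge0 ?Phi_ge0.
Qed.

Lemma Phi_level a w (x : N.+1.-tuple bool) : (a <= N)%N ->
  (forall J : N.-bseq bool, size J != a -> w J = 0) ->
  Phi k w x = `|w (insub_bseq N (take a x))|.
Proof.
move=> aN wa; rewrite /Phi (@eq_radnorm _ _ _ _ (fun i => if i == a then
    (-1) ^+ nth false x a * w (insub_bseq N (take a x)) else 0)) => [|i iN].
  by rewrite radnorm_single// normrM normrX normrN1 expr1n mul1r.
rewrite /comp; case: eqP => [->//|/eqP ia].
rewrite wa ?mulr0// insub_bseqK ?size_take ?size_tuple iN//.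
Qed.

Definition single (J I : N.-bseq bool) : R := (I == J)%:R.

Lemma nu_level a w : (a <= N)%N ->
  (forall J : N.-bseq bool, size J != a -> w J = 0) ->
  nu w = nX (fun x : N.+1.-tuple bool => w (insub_bseq N (take a x))).
Proof.
move=> aN wa; apply: snorm_abs => x.
by rewrite (Phi_level x aN wa) normr_id.
Qed.

Lemma nu_level_proj a w : (a <= N)%N ->
  nu (fun J => (size J == a)%:R * w J) <= nu w.
Proof.
move=> aN; rewrite (@nu_level a)//; last first.
  by move=> J /negPf ->; rewrite mul0r.
apply: le_trans (snorm_level w aN); apply: snorm_le => x.
by rewrite normrM; case: (_ == _); rewrite ?normr1 ?normr0 ?mul1r ?mul0r.
Qed.

(** Every level projection is a contraction, and there are [N.+1] levels. *)
Lemma nu_level_mul (m : nat -> R) w rho :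
  (forall a, (a <= N)%N -> `|m a| <= rho) ->
  nu (fun J => m (size J) * w J) <= N.+1%:R * rho * nu w.
Proof.
move=> mr; rewrite (@eq_nu _
    (fun J => \sum_(a < N.+1) m a * ((size J == a)%:R * w J))).
  apply: le_trans (nu_sum _ _ _) _.
  rewrite -[N.+1 in leRHS]card_ord mulr_natl -sumr_const mulr_suml.
  apply: ler_sum => a _; rewrite nuZ; apply: ler_pM => //.
  - exact: nu_ge0.
  - by apply: mr; rewrite -ltnS.
  - by apply: nu_level_proj; rewrite -ltnS.
move=> J; have JN : (size J < N.+1)%N by rewrite ltnS size_bseq.
rewrite (bigD1 (Ordinal JN))//= eqxx mul1r big1 ?addr0// => a aJ.
have -> : (size J == a) = false.
  by apply: contra_neqF aJ => /eqP Ja; apply: val_inj.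
by rewrite mul0r mulr0.
Qed.

Lemma sum_level_le a w : (a <= N)%N ->
  \sum_(J : N.-bseq bool | size J == a) `|w J| <= 2 ^+ a * nu w.
Proof.
move=> aN; rewrite -ler_pdivrMl ?exprn_gt0//.
have := avg_take (fun J => `|w (insub_bseq N J)|) (leqW aN) aN.
under eq_bigr do rewrite insub_bseq_val.
move=> <-; apply: le_trans (snorm_level w aN).
exact: avg_le_snorm.
Qed.

Lemma coef_le_nu w (J : N.-bseq bool) : `|w J| <= 2 ^+ size J * nu w.
Proof.
apply: le_trans (sum_level_le w (size_bseq J)).
by rewrite (bigD1 J)//= lerDl sumr_ge0.
Qed.

Lemma nu_signs b w : (b <= N)%N ->
  (forall J : N.-bseq bool, size J != b -> w J = 0) ->
  (forall J, `|w J| <= 1) -> nu w <= 1.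
Proof.
move=> bN wb w1; rewrite (nu_level bN wb) -(snorm1 S N.+1).
by apply: snorm_le => x; rewrite normr1.
Qed.

(** The fundamental function of the outer norm, at [2 ^- a]. *)
Definition phi a : R :=
  nX (fun x : N.+1.-tuple bool => (take a x == nseq a false)%:R).

Lemma snorm_node a (z : seq bool) : (a <= N)%N -> size z = a ->
  nX (fun x : N.+1.-tuple bool => (take a x == z)%:R) = phi a.
Proof.
move=> aN za; apply: snorm_dist => P.
rewrite (avg_take_tuple (fun y => (P `|(y == z)%:R|)%:R))//; last exact: leqW.
rewrite (avg_take_tuple (fun y => (P `|(y == nseq a false)%:R|)%:R))//; last exact: leqW.
have zs : size z == a by rewrite za.
have zs0 : size (nseq a false) == a by rewrite size_nseq.
rewrite -[RHS](avg_inj _ (@perm_inj _ (tperm (Tuple zs) (Tuple zs0)))).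
apply: eq_avg => y; congr (P `| _%:R |)%:R.
rewrite -[y == z :> seq bool]/(y == Tuple zs).
rewrite -[tperm _ _ y == nseq a false :> seq bool]/(tperm _ _ y == Tuple zs0).
by case: tpermP => [->|->|/eqP/negPf-> /eqP/negPf->]; rewrite ?eqxx// eq_sym.
Qed.

Lemma nu_single J : nu (single J) = phi (size J).
Proof.
rewrite (@nu_level (size J)) ?size_bseq//; last first.
  by move=> I; rewrite /single; case: (eqVneq I J) => [->|//]; rewrite eqxx.
rewrite -(@snorm_node _ J) ?size_bseq//; apply: eq_snorm => x.
rewrite /single -val_eqE /= insub_bseqK// size_take size_tuple.
by have := size_bseq J; case: ifP; lia.
Qed.

Lemma phi_coef w (J : N.-bseq bool) : phi (size J) * `|w J| <= nu w.
Proof.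
have JN := size_bseq J; rewrite -(@snorm_node _ J)// mulrC.
rewrite -[`|w J|]normr_id -snormZ; apply: le_trans (snorm_level w JN).
apply: snorm_le => x; case: eqP => [->|_]; last by rewrite mulr0 normr0.
by rewrite mulr1 normr_id insub_bseq_val.
Qed.

Lemma phi_le a b : (a <= b)%N -> phi b <= phi a.
Proof.
move=> ab; apply: snorm_le => x; rewrite !ger0_norm// ler_nat.
case: eqP => // E; rewrite (_ : take a x == _)// -(take_takel _ ab) E.
by rewrite take_nseq.
Qed.

Lemma phi0 : phi 0 = 1.
Proof. by rewrite -(snorm1 S N.+1); apply: eq_snorm => x; rewrite take0. Qed.

Lemma phiS a : (a < N)%N -> phi a <= 2 * phi a.+1.
Proof.
move=> aN; rewrite mulr_natl mulr2n.
rewrite -[X in X + _](@snorm_node _ (rcons (nseq a false) true)) ?size_rcons ?size_nseq//.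
rewrite -[X in _ + X](@snorm_node _ (rcons (nseq a false) false)) ?size_rcons ?size_nseq//.
apply: le_trans (snormD _ _ _); apply: snorm_le => x.
rewrite (take_nth false) ?size_tuple; last by lia.
rewrite !eqseq_rcons; case: eqP => _ /=; last by rewrite normr0 normr_ge0.
by case: nth => /=; rewrite ?addr0 ?add0r.
Qed.

(** An interval of length [2 ^- a] is a union of [2 ^ (b - a)] of length [2 ^- b]. *)
Lemma phi_doubling a b : (a <= b <= N)%N -> phi a <= 2 ^+ (b - a) * phi b.
Proof.
move=> /andP[]; elim: b => [|b IH] ab bN.
  by move: ab; rewrite leqn0 => /eqP ->; rewrite subnn expr0 mul1r.
case: (ltngtP a b.+1) ab => // [ab _|-> _]; last by rewrite subnn expr0 mul1r.
apply: le_trans (IH _ _) _; [lia|lia|].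
have ab' : (a <= b)%N by lia.
by rewrite (subSn ab') exprSr -mulrA ler_wpM2l ?exprn_ge0// phiS.
Qed.

Lemma phi_ge a : (a <= N)%N -> 2 ^- a <= phi a.
Proof.
move=> aN; have := @phi_doubling 0 a; rewrite phi0 subn0 => /(_ aN).
by rewrite -ler_pdivrMl ?exprn_gt0// mulr1.
Qed.

Lemma phi_le1 a : phi a <= 1. Proof. by rewrite -phi0 phi_le. Qed.

Lemma phi_gt0 a : (a <= N)%N -> 0 < phi a.
Proof. by move=> aN; apply: lt_le_trans (phi_ge aN); rewrite invr_gt0 exprn_gt0. Qed.

Lemma card_bseq_le : \sum_(J : N.-bseq bool) 1 <= 2 ^+ N.+1 :> R.
Proof.
rewrite sum_by_level (eq_bigr (fun a : 'I_N.+1 => 2 ^+ a)) => [|a _]; last first.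
  have aN : (a <= N)%N by rewrite -ltnS.
  by rewrite (sum_bseq_level (fun=> 1 : R) aN) sumr_const card_tuple card_bool natrX.
have : forall M, \sum_(a < M) 2 ^+ a <= 2 ^+ M :> R.
  elim=> [|M IH]; first by rewrite big_ord0 expr0.
  by rewrite big_ord_recr /= exprS; have := IH; lra.
by apply.
Qed.

Lemma sum_coef_le w : \sum_J `|w J| <= 2 ^+ N.+1 * nu w.
Proof.
rewrite sum_by_level.
have H M : (M <= N.+1)%N -> \sum_(a < M) \sum_(J : N.-bseq bool | size J == a) `|w J|
    <= 2 ^+ M * nu w.
  elim: M => [|M IH] MN; first by rewrite big_ord0 mulr_ge0 ?nu_ge0.
  rewrite big_ord_recr /= exprS -mulrA mulr_natl mulr2n.
  by rewrite lerD ?IH ?sum_level_le// ltnW.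
exact: H.
Qed.

(** A crude bound, which suffices for matrices with exponentially small entries. *)
Lemma nu_matrix_le (Z : N.-bseq bool -> N.-bseq bool -> R) z w :
  (forall I L, `|Z I L| <= z) ->
  nu (fun I => \sum_L Z I L * w L) <= z * 4 ^+ N.+1 * nu w.
Proof.
move=> Zz; have z0 : 0 <= z.
  by apply: le_trans (Zz (insub_bseq N [::]) (insub_bseq N [::])).
rewrite (@eq_nu _ (fun I => \sum_J (\sum_L Z J L * w L) * single J I)); last first.
  move=> I; rewrite [RHS](bigD1 I)//= /single eqxx mulr1 [X in _ + X]big1 ?addr0// => J JI.
  by rewrite eq_sym (negPf JI) mulr0.
apply: le_trans (nu_sum _ _ _) _.
apply: (@le_trans _ _ (\sum_(J : N.-bseq bool) z * (2 ^+ N.+1 * nu w))).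
  apply: ler_sum => J _; rewrite nuZ -[leRHS]mulr1; apply: ler_pM => //.
  - exact: nu_ge0.
  - apply: le_trans (ler_norm_sum _ _ _) _.
    apply: le_trans (ler_wpM2l z0 (sum_coef_le w)); rewrite mulr_sumr.
    by apply: ler_sum => L _; rewrite normrM ler_wpM2r.
  - by rewrite nu_single phi_le1.
rewrite -[X in \sum_J X]mul1r -mulr_suml.
apply: le_trans (ler_wpM2r _ card_bseq_le) _.
  by rewrite !mulr_ge0 ?nu_ge0.
by rewrite (_ : 4 = 2 * 2) ?exprMn -?natrM//; lra.
Qed.

End Basics.
End CoefNorm.

(** * Faithful Haar systems *)

Section Faithful.
Variable R : realType.
Local Notation avg := (@avg R _).
Variables (S : step_norm R) (k : rad_kind).
Local Notation nu := (nu S k).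
Variables (n N : nat) (s : seq nat) (th : seq bool -> bool).
Hypotheses (sn : size s = n.+1) (ss : sorted ltn s)
  (sN : all (fun i => i < N.+1)%N s).

(** The coefficient at [J] of the function that replaces the Haar function of
    [I]: a signed sum of Haar functions of level [nth 0 s (size I)]. *)
Definition block (I J : seq bool) : R :=
  (size J == nth 0%N s (size I))%:R * (pat th (take (size I) s) J == I)%:R *
    (-1) ^+ th J.

Definition embed (w : n.-bseq bool -> R) (J : N.-bseq bool) : R :=
  \sum_(I : n.-bseq bool) block I J * w I.

Definition compress (g : N.-bseq bool -> R) (I : n.-bseq bool) : R :=
  2 ^+ size I * \sum_(J : N.-bseq bool) 2 ^- size J * block I J * g J.

Let us : uniq s.
Proof. by move: ss; rewrite ltn_sorted_uniq_leq => /andP[]. Qed.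

Let nth_leN i : (i < n.+1)%N -> (nth 0%N s i <= N)%N.
Proof. by move=> iS; apply: (allP sN); apply: mem_nth; rewrite sn. Qed.

Let take_lt j : (j < n.+1)%N ->
  all (fun i => i < nth 0%N s j)%N (take j s).
Proof. by move=> jn; apply: sorted_take_lt; rewrite // sn leqnn. Qed.

Let size_bseq_lt (I : n.-bseq bool) : (size I < size s)%N.
Proof. by rewrite sn ltnS size_bseq. Qed.

Lemma block_notin (I : n.-bseq bool) (J : seq bool) :
  size J \notin s -> block I J = 0.
Proof.
move=> Js; rewrite /block; case: eqP => [E|]; last by rewrite !mul0r.
by move: Js; rewrite E mem_nth.
Qed.

Lemma blockE (I : n.-bseq bool) (J : seq bool) j :
  (j < n.+1)%N -> size J = nth 0%N s j ->
  block I J = (I == insub_bseq n (pat th (take j s) J))%:R * (-1) ^+ th J.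
Proof.
move=> jn Jj; rewrite /block Jj nth_uniq ?sn ?size_bseq_lt// ?ltnS ?size_bseq//.
have sz : size (pat th (take j s) J) = j by rewrite size_pat size_take sn jn.
congr (_ * _); rewrite -val_eqE /= insub_bseqK ?sz//.
case: eqVneq => [->|jI]; first by rewrite mul1r eq_sym.
rewrite mul0r; case: eqVneq => // E; move: jI.
by rewrite E sz eqxx.
Qed.

Lemma embed_comp (w : n.-bseq bool -> R) (x : N.+1.-tuple bool) i :
  (i < N.+1)%N -> comp (embed w) x i = spread s (comp w (pat th s x)) i.
Proof.
move=> iN; rewrite /comp /embed /spread.
have st : size (take i x) = i by rewrite size_take size_tuple iN.
have vx : insub_bseq N (take i x) = take i x :> seq bool.
  by rewrite insub_bseqK ?st.
have sx : size (insub_bseq N (take i x)) = i by rewrite vx.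
case: ifPn => [is_|is_]; last first.
  rewrite big1 ?mulr0// => I _; rewrite block_notin ?mul0r//.
  by rewrite sx.
have jn : (index i s < n.+1)%N by rewrite -sn index_mem.
have ij : nth 0%N s (index i s) = i by rewrite nth_index.
have bE I := @blockE I (insub_bseq N (take i x)) _ jn (etrans sx (esym ij)).
have tl := take_lt jn; rewrite ij in tl.
rewrite (bigD1 (insub_bseq n (pat th (take (index i s) s) (take i x))))//=.
rewrite big1 => [|I II]; last by rewrite bE vx (negPf II) !mul0r.
rewrite bE vx eqxx mul1r addr0 mulrA -signr_addb (pat_take _ _ tl).
rewrite (nth_map 0%N) ?sn// ij /pat map_take; congr (_ * _).
Qed.

Lemma Phi_embed (w : n.-bseq bool -> R) (x : N.+1.-tuple bool) :
  Phi k (embed w) x = Phi k w (pat th s x).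
Proof.
rewrite /Phi (eq_radnorm k (embed_comp w x)) radnorm_spread//.
by rewrite sn.
Qed.

Lemma nu_embed (w : n.-bseq bool -> R) : nu (embed w) = nu w.
Proof.
rewrite /nu (eq_snorm _ (Phi_embed w)) (snorm_pat S th (Phi k w) ss sN).
by rewrite sn.
Qed.

Let comp_flip_lt (g : N.-bseq bool -> R) (x : N.+1.-tuple bool) i j :
  (i < j)%N -> (j < N.+1)%N -> comp g (flipb j x) i = comp g x i.
Proof.
move=> ij jN; rewrite /comp nth_flipb// take_flipb ?(ltnW ij)//.
by rewrite (ltn_eqF ij) addbF.
Qed.

Let comp_flip (g : N.-bseq bool -> R) (x : N.+1.-tuple bool) i :
  (i < N.+1)%N -> comp g (flipb i x) i = - comp g x i.
Proof.
by move=> iN; rewrite /comp nth_flipb// take_flipb// eqxx addbT signrN mulNr.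
Qed.

Let nth_gt l i j : (l <= j < size s)%N -> (i < nth 0%N s l)%N ->
  (i < nth 0%N s j)%N.
Proof.
case: (ltngtP l j) => // [lj|->//] /= js il.
by apply: ltn_trans il _; apply: (sorted_ltn_nth ltn_trans 0%N ss); rewrite ?inE; lia.
Qed.

(** Levels outside [s] vanish because flipping their bit changes the sign; for a
    level in [s], the later bits of the pattern are independent of it, and the
    weight of its own bit selects the coefficient. *)
Lemma cond_comp (g : N.-bseq bool -> R) (y : n.+1.-tuple bool) i :
  (i < N.+1)%N ->
  avg (fun x : N.+1.-tuple bool => wgt R th s n.+1 y x * comp g x i) =
  spread s (comp (compress g) y) i.
Proof.
move=> iN.
have nul l : (l <= n.+1)%N -> all (fun j => j < i)%N (take l s) ->
    avg (fun x : N.+1.-tuple bool => wgt R th s l y x * comp g x i) = 0.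
  move=> ln tl; apply: (avg_odd (@flipb_inj _ i)) => x.
  by rewrite (wgt_flip R th y x tl iN) comp_flip// mulrN.
have down l : (l <= n.+1)%N -> (forall j, (l <= j < n.+1)%N -> (i < nth 0%N s j)%N) ->
    avg (fun x : N.+1.-tuple bool => wgt R th s n.+1 y x * comp g x i) =
    avg (fun x : N.+1.-tuple bool => wgt R th s l y x * comp g x i).
  move=> ln gt; apply: avg_wgt; rewrite ?size_tuple ?sn// => j lj x.
  by rewrite comp_flip_lt ?gt// ltnS nth_leN//; lia.
rewrite /spread; case: ifPn => [is_|is_]; last first.
  pose l := find (fun j => i < j)%N s.
  have ln : (l <= n.+1)%N by rewrite -sn find_size.
  rewrite (down l) => [||j /andP[lj jn]]; last 2 first.
  - exact: ln.
  - apply: (@nth_gt l); first by rewrite lj sn.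
    by apply: nth_find; rewrite has_find -/l sn; lia.
  apply: nul => //; apply/(all_nthP 0%N) => j; rewrite size_take_min => jl.
  have jl' : (j < l)%N by lia.
  have jS : (j < size s)%N by lia.
  rewrite nth_take//; have := before_find 0%N jl' => /negbT.
  rewrite -leqNgt leq_eqVlt => /predU1P[E|//].
  by move: is_; rewrite -E mem_nth.
set j := index i s.
have jn : (j < n.+1)%N by rewrite -sn index_mem.
have ij : nth 0%N s j = i by rewrite nth_index.
have tl := take_lt jn; rewrite ij in tl.
rewrite (down j.+1)// => [|l jl]; last first.
  have := sorted_ltn_nth ltn_trans 0%N ss; rewrite -[X in (X < _)%N]ij; apply; rewrite ?inE; lia.
pose F (J : seq bool) : R := 2 ^+ j * (pat th (take j s) J == take j y)%:R *
  ((-1) ^+ th J * g (insub_bseq N J)).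
transitivity ((-1) ^+ nth false y j * avg (fun x : N.+1.-tuple bool => F (take i x))).
  rewrite -avgZ -[RHS]add0r -(nul j (ltnW jn) tl) -avgD; apply: eq_avg => x.
  rewrite wgtS ?size_tuple ?sn// ij /F (pat_take _ _ tl) -/(wgt R th s j y x).
  rewrite /comp /tbit signr_addb signr_addb.
  by rewrite /wgt; case: (nth false x i); rewrite /= ?expr0 ?expr1; ring.
rewrite (avg_take F (ltnW iN) (_ : i <= N)%N)// /comp /compress; congr (_ * _).
have szy : size (take j y) = j by rewrite size_take size_tuple jn.
rewrite insub_bseqK ?szy// mulr_sumr big_mkcond mulr_sumr; apply: eq_bigr => J _.
case: eqP => [Ji|/eqP Ji]; last first.
  by rewrite /block szy ij (negPf Ji) !(mul0r, mulr0).
by rewrite /F /block szy ij Ji eqxx insub_bseq_val mul1r; ring.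
Qed.

(** Jensen's inequality. *)
Lemma Phi_compress (g : N.-bseq bool -> R) (y : n.+1.-tuple bool) :
  Phi k (compress g) y <=
  avg (fun x : N.+1.-tuple bool => wgt R th s n.+1 y x * Phi k g x).
Proof.
rewrite /Phi -[X in radnorm _ X]sn -(radnorm_spread k _ ss sN).
rewrite -(eq_radnorm k (cond_comp g y)).
by apply: radnorm_avg => x; apply: wgt_ge0.
Qed.

Lemma nu_compress (g : N.-bseq bool -> R) : nu (compress g) <= nu g.
Proof.
have -> : nu (compress g) =
    snorm S (fun x : N.+1.-tuple bool => Phi k (compress g) (pat th s x)).
  by rewrite (snorm_pat S th (Phi k (compress g)) ss sN) sn.
pose W (x y : N.+1.-tuple bool) : R := 2 ^+ n.+1 * (pat th s y == pat th s x)%:R.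
have WE x y : W x y = wgt R th s n.+1 (pat th s x) y.
  by rewrite /W /wgt !take_oversize ?size_pat ?sn.
apply: (@le_trans _ _ (snorm S (fun x : N.+1.-tuple bool =>
    avg (fun y : N.+1.-tuple bool => W x y * Phi k g y)))).
  apply: snorm_le => x; rewrite !ger0_norm ?Phi_ge0//; last first.
    by apply: avg_ge0 => y; rewrite WE mulr_ge0 ?wgt_ge0 ?Phi_ge0.
  have sp : size (pat th s x) == n.+1 by rewrite size_pat sn.
  have := Phi_compress g (Tuple sp); congr (_ <= _); apply: eq_avg => y.
  by rewrite WE.
apply: snorm_fiber => x.
rewrite -[RHS](@avg_wgt1 R th s N.+1 ss sN n.+1 (pat th s x)) ?size_pat ?sn//.
by apply: eq_avg => y; rewrite -WE.
Qed.

(** By [cond_comp] the value of [compress (embed w)] on the cell [y] comes from the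
    points [x] with pattern [y], where [embed w] has the value of [w] on [y]. *)
Lemma compress_embed (w : n.-bseq bool -> R) : compress (embed w) =1 w.
Proof.
move=> I; set j := size I.
have jn : (j < n.+1)%N by rewrite ltnS size_bseq.
pose y : n.+1.-tuple bool := [tuple nth false I i | i < n.+1].
have yI : take j y = I.
  apply: (@eq_from_nth _ false) => [|i]; rewrite size_take size_tuple jn// => ij.
  rewrite nth_take// -[i]/(nat_of_ord (Ordinal (ltn_trans ij jn))) -tnth_nth.
  by rewrite tnth_mktuple.
have jN : (nth 0%N s j < N.+1)%N by rewrite ltnS nth_leN.
have := cond_comp (embed w) y jN.
have -> : avg (fun x : N.+1.-tuple bool =>
    wgt R th s n.+1 y x * comp (embed w) x (nth 0%N s j)) = comp w y j.
  rewrite -[RHS]mulr1 -[X in _ = _ * X](@avg_wgt1 R th s N.+1 ss sN n.+1 y) ?size_tuple ?sn//.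
  rewrite -avgZ; apply: eq_avg => x; rewrite embed_comp//.
  rewrite /spread mem_nth ?sn// index_uniq ?sn// /wgt.
  rewrite (take_oversize (eq_leq sn)) (take_oversize (eq_leq (size_tuple y))).
  by case: eqP => [->|_]; rewrite ?mulr1 ?mulr0 ?mul0r// mulrC.
rewrite /spread mem_nth ?sn// index_uniq ?sn// /comp yI insub_bseq_val.
by move/(can_inj (signrMK _)) => ->.
Qed.

End Faithful.

(** * Random signs *)

Section RandomSigns.
Variable R : realType.
Local Notation avg := (@avg R _).

Section Orthogonality.
Variable D : finType.
Local Notation signs := {ffun D -> bool}.

Definition flips (J : D) (e : signs) : signs := [ffun I => e I (+) (I == J)].

Lemma flips_inj J : injective (flips J).
Proof.
apply: (@inv_inj _ (flips J)) => e; apply/ffunP => I; rewrite !ffunE.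
by case: (_ == _); rewrite ?addbT ?addbF ?negbK.
Qed.

Lemma sgn_flips J (e : signs) : (-1) ^+ flips J e J = - (-1) ^+ e J :> R.
Proof. by rewrite ffunE eqxx addbT signrN. Qed.

Lemma sgn_flips_neq J I (e : signs) : I != J -> flips J e I = e I.
Proof. by move=> IJ; rewrite ffunE (negPf IJ) addbF. Qed.

(** Pythagoras for sums whose coefficients may themselves depend on the signs: the
    product of two terms is odd under one of the two sign changes. *)
Lemma avg_sqr_signs (P : pred D) (w : D -> signs -> R) :
  (forall J M, P J -> P M -> J != M ->
     (forall e, w J (flips J e) * w M (flips J e) = w J e * w M e) \/
     (forall e, w J (flips M e) * w M (flips M e) = w J e * w M e)) ->
  avg (fun e : signs => (\sum_(J | P J) (-1) ^+ e J * w J e) ^+ 2) =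
  \sum_(J | P J) avg (fun e : signs => w J e ^+ 2).
Proof.
move=> inv; pose c J M (e : signs) : R := ((-1) ^+ e J * w J e) * ((-1) ^+ e M * w M e).
have -> : avg (fun e : signs => (\sum_(J | P J) (-1) ^+ e J * w J e) ^+ 2) =
    \sum_(J | P J) \sum_(M | P M) avg (c J M).
  under [RHS]eq_bigr do rewrite -avg_sum.
  by rewrite -avg_sum; apply: eq_avg => e; rewrite expr2 big_distrlr.
apply: eq_bigr => J PJ; rewrite (bigD1 J)//= big1 ?addr0 => [|M /andP[PM MJ]].
  apply: eq_avg => e; rewrite /c; have := sqrr_sign R (e J).
  by rewrite !expr2 => E; rewrite mulrACA E mul1r.
have JM : J != M by rewrite eq_sym.
case: (inv J M PJ PM JM) => [/(_ _) H|/(_ _) H].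
  apply: (avg_odd (@flips_inj J)) => e; rewrite /c mulrACA H sgn_flips.
  by rewrite sgn_flips_neq//; ring.
apply: (avg_odd (@flips_inj M)) => e; rewrite /c mulrACA H sgn_flips.
by rewrite sgn_flips_neq//; ring.
Qed.

Lemma sum_sqr_signs (P : pred D) (a : D -> R) :
  \sum_(J | P J) a J ^+ 2 = avg (fun e : signs => (\sum_(J | P J) (-1) ^+ e J * a J) ^+ 2).
Proof.
rewrite (avg_sqr_signs (w := fun J _ => a J)) => [|J M _ _ _]; last by left.
by apply: eq_bigr => J _; rewrite (avg_cst [ffun=> false]).
Qed.

End Orthogonality.

(** * Hilbert-Schmidt bounds *)

Section HilbertSchmidt.
Variables (S : step_norm R) (k : rad_kind) (N : nat).
Local Notation nu := (nu S k).
Local Notation phi := (phi S N).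
Variables (tau : N.-bseq bool -> N.-bseq bool -> R) (Gamma : R).
Hypotheses (Gamma_ge0 : 0 <= Gamma)
  (tau_le : forall w, nu (fun I => \sum_J tau I J * w J) <= Gamma * nu w).

(** The bilinear form of the operator: the pairing of the Haar function of [I]
    with the image of the Haar function of [J]. *)
Definition form (I J : N.-bseq bool) : R := 2 ^- size I * tau I J.

Let tau_single I J : \sum_L tau I L * single R J L = tau I J.
Proof.
rewrite (bigD1 J)//= /single eqxx mulr1 big1 ?addr0// => L /negPf ->.
by rewrite mulr0.
Qed.

Let nu_tau_single J : nu (fun I => tau I J) <= Gamma * phi (size J).
Proof.
rewrite -(nu_single S k J); apply: le_trans (tau_le _).
by rewrite (eq_nu S k (fun I => tau_single I J)).
Qed.

Lemma form_diag_le J : `|form J J| <= Gamma * 2 ^- size J.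
Proof.
rewrite /form normrM ger0_norm ?invr_ge0 ?exprn_ge0// mulrC.
rewrite ler_wpM2r ?invr_ge0 ?exprn_ge0//.
have p0 := phi_gt0 S (size_bseq J); rewrite -(ler_pM2l p0) [leRHS]mulrC.
exact: le_trans (phi_coef S k (fun I => tau I J) J) (nu_tau_single J).
Qed.

(** Averaging over signs on the level [b] replaces the squares by the coefficients of
    the image of a sum of signed Haar functions.  Each of them is at most
    [Gamma / phi a], and the sum of their absolute values is at most
    [2 ^ a * Gamma]. *)
Lemma form_row_le a b : (a <= N)%N -> (b <= N)%N ->
  \sum_(I : N.-bseq bool | size I == a) \sum_(J : N.-bseq bool | size J == b) form I J ^+ 2 <=
  Gamma ^+ 2 * (2 ^- a / phi a).
Proof.
move=> aN bN; have p0 := phi_gt0 S aN.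
under eq_bigr do rewrite (sum_sqr_signs _ (form _)).
rewrite -avg_sum -[leRHS](avg_cst ([ffun=> false] : {ffun N.-bseq bool -> bool})).
apply: ler_avg => e.
pose w (J : N.-bseq bool) : R := (size J == b)%:R * (-1) ^+ e J.
pose y I := \sum_J tau I J * w J.
have w1 : nu w <= 1.
  apply: (nu_signs S k bN) => [J /negPf Jb|J]; first by rewrite /w Jb mul0r.
  rewrite /w normrM normrX normrN1 expr1n mulr1.
  by case: (_ == _); rewrite ?normr1 ?normr0.
have y1 : nu y <= Gamma.
  by apply: le_trans (tau_le w) _; rewrite ler_piMr.
have E (I : N.-bseq bool) : size I == a ->
    \sum_(J : N.-bseq bool | size J == b) (-1) ^+ e J * form I J = 2 ^- a * y I.
  move=> /eqP Ia; rewrite /y mulr_sumr big_mkcond; apply: eq_bigr => J _.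
  by rewrite /form /w Ia; case: (_ == _); rewrite ?mul1r ?mul0r ?mulr0//; ring.
apply: (@le_trans _ _ (\sum_(I : N.-bseq bool | size I == a)
    (2 ^- a * 2 ^- a * Gamma / phi a) * `|y I|)).
  apply: ler_sum => I Ia; rewrite E//.
  have yI : `|y I| <= Gamma / phi a.
    rewrite ler_pdivlMr// mulrC -(eqP Ia).
    exact: le_trans (phi_coef S k y I) y1.
  have -> : (2 ^- a * y I) ^+ 2 = 2 ^- a * (2 ^- a * (`|y I| * `|y I|)).
    by rewrite -[_ * `|y I|]expr2 real_normK ?num_real//; ring.
  by rewrite -!mulrA !ler_wpM2l ?invr_ge0 ?exprn_ge0// mulrA ler_wpM2r.
rewrite -mulr_sumr; apply: le_trans (ler_wpM2l _ (sum_level_le S k y aN)) _.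
  by rewrite !mulr_ge0 ?invr_ge0 ?exprn_ge0// ltW.
apply: le_trans (ler_wpM2l _ (ler_wpM2l _ y1)) _.
- by rewrite !mulr_ge0 ?invr_ge0 ?exprn_ge0// ltW.
- by rewrite exprn_ge0.
rewrite le_eqVlt; apply/orP; left; apply/eqP; field.
by rewrite gt_eqF//= expf_neq0.
Qed.

(** As in [form_row_le], with signs on the level [a]; a second choice of signs, on the
    level [b], bounds the sum of absolute values. *)
Lemma form_col_le a b : (a <= N)%N -> (b <= N)%N ->
  \sum_(I : N.-bseq bool | size I == a) \sum_(J : N.-bseq bool | size J == b) form I J ^+ 2 <=
  Gamma ^+ 2 * phi b.
Proof.
move=> aN bN; have p0 := phi_gt0 S bN.
rewrite exchange_big /=.
under eq_bigr => J _ do rewrite (sum_sqr_signs _ (form^~ J)).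
rewrite -avg_sum -[leRHS](avg_cst ([ffun=> false] : {ffun N.-bseq bool -> bool})).
apply: ler_avg => e.
pose z J := \sum_(I : N.-bseq bool | size I == a) (-1) ^+ e I * form I J.
rewrite -/(z _).
have zle (J : N.-bseq bool) : size J == b -> `|z J| <= Gamma * phi b.
  move=> /eqP Jb; rewrite -Jb; apply: le_trans (nu_tau_single J).
  apply: le_trans (ler_norm_sum _ _ _) _.
  apply: (@le_trans _ _ (\sum_(I : N.-bseq bool | size I == a) 2 ^- a * `|tau I J|)).
    apply: ler_sum => I /eqP Ia; rewrite normrM normrX normrN1 expr1n mul1r.
    by rewrite /form normrM Ia ger0_norm ?invr_ge0 ?exprn_ge0.
  by rewrite -mulr_sumr ler_pdivrMl ?exprn_gt0// sum_level_le.
pose sg (J : N.-bseq bool) : R := (size J == b)%:R * Num.sg (z J).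
have sg1 : nu sg <= 1.
  apply: (nu_signs S k bN) => [J /negPf Jb|J]; first by rewrite /sg Jb mul0r.
  rewrite /sg normrM normr_sg.
  by case: (_ == _); case: (_ != _); rewrite ?normr1 ?normr0 ?mul1r ?mul0r.
have zsum : \sum_(J : N.-bseq bool | size J == b) `|z J| <= Gamma.
  pose y I := \sum_J tau I J * sg J.
  have -> : \sum_(J : N.-bseq bool | size J == b) `|z J| =
      \sum_(I : N.-bseq bool | size I == a) (-1) ^+ e I * (2 ^- a * y I).
    under eq_bigr => J _ do rewrite normrEsg mulr_sumr.
    rewrite exchange_big; apply: eq_bigr => I /eqP Ia.
    rewrite /y !mulr_sumr big_mkcond; apply: eq_bigr => J _.
    rewrite /form /sg Ia; case: (_ == _); last by rewrite mul0r !mulr0.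
    by rewrite mul1r; ring.
  apply: (@le_trans _ _ (\sum_(I : N.-bseq bool | size I == a) 2 ^- a * `|y I|)).
    apply: ler_sum => I _; apply: le_trans (ler_norm _) _.
    by rewrite !normrM normrX normrN1 expr1n mul1r ger0_norm ?invr_ge0 ?exprn_ge0.
  rewrite -mulr_sumr ler_pdivrMl ?exprn_gt0//.
  apply: le_trans (sum_level_le S k y aN) _; rewrite ler_wpM2l ?exprn_ge0//.
  by apply: le_trans (tau_le sg) _; rewrite ler_piMr.
apply: (@le_trans _ _ (\sum_(J : N.-bseq bool | size J == b) Gamma * phi b * `|z J|)).
  apply: ler_sum => J Jb; rewrite -real_normK ?num_real// expr2.
  by rewrite ler_wpM2r// zle.
rewrite -mulr_sumr; apply: le_trans (ler_wpM2l _ zsum) _.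
  by rewrite mulr_ge0// ltW.
by rewrite expr2 mulrAC.
Qed.

(** The minimum of the two previous bounds is at most their geometric mean, in which
    the fundamental functions cancel up to the length of the longer intervals. *)
Lemma form_hs_le k0 a b : (k0 <= a <= N)%N -> (k0 <= b <= N)%N ->
  \sum_(I : N.-bseq bool | size I == a) \sum_(J : N.-bseq bool | size J == b) form I J ^+ 2 <=
  Gamma ^+ 2 * Num.sqrt (2 ^- k0).
Proof.
move=> /andP[ka aN] /andP[kb bN].
have h1 := form_row_le aN bN; have h2 := form_col_le aN bN.
set h := \sum_(I | _) _ in h1 h2 *.
have h0 : 0 <= h by do 2!apply: sumr_ge0 => ? _; rewrite sqr_ge0.
have pa := phi_gt0 S aN; have pb := phi_gt0 S bN.
have inv2 c d : (c <= d)%N -> 2 ^- d <= 2 ^- c :> R.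
  by move=> cd; rewrite lef_pV2 ?posrE ?exprn_gt0// ler_eXn2l// ltr1n.
have key : 2 ^- a / phi a * phi b <= 2 ^- k0.
  case: (leqP a b) => [ab|/ltnW ba].
    apply: le_trans (inv2 _ _ ka); rewrite mulrAC -mulrA ler_piMr ?invr_ge0 ?exprn_ge0//.
    by rewrite ler_pdivrMr// mul1r phi_le.
  apply: le_trans (inv2 _ _ kb).
  rewrite mulrAC ler_pdivrMr// ler_pdivrMl ?exprn_gt0//.
  apply: le_trans (phi_doubling S (_ : b <= a <= N)%N) _; first by rewrite ba.
  by rewrite mulrA -[X in 2 ^+ X / _](subnK ba) exprD mulfK ?expf_neq0.
rewrite -(ler_pXn2r (_ : 0 < 2)%N) ?nnegrE ?mulr_ge0 ?sqr_ge0 ?sqrtr_ge0//.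
rewrite [leRHS]exprMn sqr_sqrtr ?invr_ge0 ?exprn_ge0//.
rewrite expr2; apply: le_trans (ler_pM h0 h0 h1 h2) _.
rewrite (_ : _ * _ * _ = Gamma ^+ 2 ^+ 2 * (2 ^- a / phi a * phi b)); last first.
  by rewrite !expr2; ring.
by rewrite ler_wpM2l ?sqr_ge0.
Qed.

End HilbertSchmidt.
End RandomSigns.

(** * Second moments of the compressed operator *)

Section SecondMoment.
Variable R : realType.
Local Notation avg := (@avg R _).
Variables (n N : nat) (s : seq nat) (k0 : nat).
Hypotheses (sn : size s = n.+1) (ss : sorted ltn s)
  (sN : all (fun i => i < N.+1)%N s) (sk : all (fun i => k0 <= i)%N s).
Local Notation signs := {ffun N.-bseq bool -> bool}.
Implicit Types (e : signs) (t : N.-bseq bool -> N.-bseq bool -> R).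

Definition sign_of e (J : seq bool) : bool := e (insub_bseq N J).

Local Notation lev I := (nth 0%N s (size I)).

Let us : uniq s.
Proof. by move: ss; rewrite ltn_sorted_uniq_leq => /andP[]. Qed.

Let lev_lt (I : n.-bseq bool) : (size I < size s)%N.
Proof. by rewrite sn ltnS size_bseq. Qed.

Let nth_leN i : (i < n.+1)%N -> (nth 0%N s i <= N)%N.
Proof. by move=> iS; apply: (allP sN); apply: mem_nth; rewrite sn. Qed.

Let nth_ge i : (i < n.+1)%N -> (k0 <= nth 0%N s i)%N.
Proof. by move=> iS; apply: (allP sk); apply: mem_nth; rewrite sn. Qed.

Lemma pat_flips (M : N.-bseq bool) e r x : all (fun i => i < size M)%N r ->
  pat (sign_of (flips M e)) r x = pat (sign_of e) r x.
Proof.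
move=> /allP rM; apply/eq_in_map => i /rM iM; rewrite /tbit /sign_of.
rewrite sgn_flips_neq//; apply: contraTneq iM => <-.
rewrite -leqNgt; apply: leq_trans (size_insub_bseq _ _) _.
by rewrite size_take_min geq_minl.
Qed.

(** The node [J] occurs in the system function of [I]. *)
Definition hit e (I J : seq bool) : bool :=
  (size J == lev I) && (pat (sign_of e) (take (size I) s) J == I).

Lemma block_hit e (I : seq bool) (J : N.-bseq bool) :
  block R s (sign_of e) I J = (-1) ^+ e J * (hit e I J)%:R.
Proof.
by rewrite /block /hit /sign_of insub_bseq_val -mulnb natrM mulrC.
Qed.

Lemma hit_flips e (M : N.-bseq bool) (I : n.-bseq bool) J :
  (lev I <= size M)%N -> hit (flips M e) I J = hit e I J.
Proof.
move=> IM; rewrite /hit pat_flips//; apply/allP => i is_.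
have ls : (size I <= size I < size s)%N by rewrite leqnn lev_lt.
exact: leq_trans (allP (sorted_take_lt ss ls) _ is_) IM.
Qed.

Lemma hit_disj e (I L : n.-bseq bool) J : I != L -> hit e I J -> hit e L J = false.
Proof.
move=> IL /andP[/eqP JI /eqP PI]; apply: contraNF IL => /andP[/eqP JL /eqP PL].
have IL : size I = size L.
  by apply/eqP; rewrite -(nth_uniq 0%N (lev_lt I) (lev_lt L) us) -JI JL.
by apply/eqP/val_inj; rewrite /= -PI -PL IL.
Qed.

(** The form evaluated on the functions of the random system that replace the Haar
    functions of [I] and [L]. *)
Definition cform t e (I L : n.-bseq bool) : R :=
  \sum_(I' : N.-bseq bool) \sum_(L' : N.-bseq bool)
    block R s (sign_of e) I I' * t I' L' * block R s (sign_of e) L L'.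

Definition hs t a b : R :=
  \sum_(I : N.-bseq bool | size I == a) \sum_(J : N.-bseq bool | size J == b) t I J ^+ 2.

Lemma cform_tr t e I L : cform t e I L = cform (fun J K => t K J) e L I.
Proof.
rewrite /cform exchange_big; apply: eq_bigr => J _; apply: eq_bigr => K _.
by rewrite /=; ring.
Qed.

Let ind_sqr_le (b : bool) (x : R) : (b%:R * x) ^+ 2 <= x ^+ 2.
Proof. by case: b; rewrite ?mul1r// mul0r expr0n sqr_ge0. Qed.

Let sqr2 (x y : R) : (x + y) ^+ 2 <= 2 * (x ^+ 2 + y ^+ 2).
Proof. by have := sqr_ge0 (x - y); nra. Qed.

(** The later system function is expanded first.  Whether [J] occurs in it is
    independent of the signs on the level of [J]; if it does, then it does not occur
    in the other function, and its sign is free. *)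
Let cform_offdiag_le0 t (I L : n.-bseq bool) : I != L -> (size I <= size L)%N ->
  avg (fun e => cform t e I L ^+ 2) <= hs t (lev I) (lev L).
Proof.
move=> IL sIL; have lIL : (lev I <= lev L)%N.
  case: (ltngtP (size I) (size L)) sIL => // [sIL _|-> //].
  by apply: ltnW; apply: (sorted_ltn_nth ltn_trans 0%N ss); rewrite ?inE ?lev_lt.
pose g J e := \sum_(I' : N.-bseq bool | size I' == lev I)
  (-1) ^+ e I' * ((hit e I I')%:R * t I' J).
have -> : avg (fun e => cform t e I L ^+ 2) = avg (fun e =>
    (\sum_(J : N.-bseq bool | size J == lev L)
       (-1) ^+ e J * ((hit e L J)%:R * g J e)) ^+ 2).
  apply: eq_avg => e; congr (_ ^+ 2); rewrite /cform exchange_big [RHS]big_mkcond.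
  apply: eq_bigr => J _; case: ifPn => [JL|/negPf JL]; last first.
    by apply: big1 => I' _; rewrite [X in _ * X]block_hit /hit JL !mulr0.
  rewrite /g !mulr_sumr [RHS]big_mkcond; apply: eq_bigr => I' _.
  case: ifPn => [_|/negPf I'I]; last by rewrite block_hit {1}/hit I'I !(mulr0, mul0r).
  rewrite !block_hit; move: ((-1) ^+ _) ((-1) ^+ _) (_%:R) (_%:R) => a b c d.
  by ring.
have gflip J (M : N.-bseq bool) e : size M = lev L -> hit e I M = false -> g J (flips M e) = g J e.
  move=> ML hM; apply: eq_bigr => I' _; rewrite hit_flips ?ML//.
  case: (eqVneq I' M) => [->|IM]; first by rewrite hM !(mul0r, mulr0).
  by rewrite sgn_flips_neq.
rewrite avg_sqr_signs => [|J M /eqP JL /eqP ML JM]; last first.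
  left => e; rewrite !hit_flips ?JL//.
  case hJ : (hit e L J); last by rewrite !mul0r.
  have hI : hit e I J = false by apply: hit_disj hJ; rewrite eq_sym.
  by rewrite !gflip.
rewrite /hs exchange_big; apply: ler_sum => J _.
apply: (@le_trans _ _ (avg (fun e => g J e ^+ 2))).
  by apply: ler_avg => e; apply: ind_sqr_le.
rewrite /g avg_sqr_signs => [|I' M /eqP II' /eqP IM _]; last first.
  by left => e; rewrite !hit_flips ?II'.
apply: ler_sum => I' _; rewrite -[leRHS](avg_cst ([ffun=> false] : signs)).
by apply: ler_avg => e; apply: ind_sqr_le.
Qed.

Lemma hs_tr t a b : hs (fun J K => t K J) a b = hs t b a.
Proof. by rewrite /hs exchange_big. Qed.

Lemma cform_offdiag_le t (I L : n.-bseq bool) : I != L ->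
  avg (fun e => cform t e I L ^+ 2) <= hs t (lev I) (lev L).
Proof.
move=> IL; case: (leqP (size I) (size L)) => [|/ltnW] sIL.
  exact: cform_offdiag_le0.
rewrite -hs_tr (eq_avg (fun e => congr1 (fun x => x ^+ 2) (cform_tr t e I L))).
by apply: cform_offdiag_le0; rewrite // eq_sym.
Qed.

(** Off-diagonal terms of a quadratic form in the signs.  They are ordered by rank so
    that [avg_sqr_signs] applies: flipping the sign of the larger index of two does
    not affect the coefficient of the smaller one. *)
Let half t e (I : n.-bseq bool) : R :=
  \sum_(J : N.-bseq bool | size J == lev I) (-1) ^+ e J * ((hit e I J)%:R *
    \sum_(K : N.-bseq bool | (size K == lev I) && (enum_rank K < enum_rank J)%N)
      (-1) ^+ e K * ((hit e I K)%:R * t K J)).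

Let half_le t I : avg (fun e => half t e I ^+ 2) <=
  \sum_(J : N.-bseq bool | size J == lev I)
    \sum_(K : N.-bseq bool | (size K == lev I) && (enum_rank K < enum_rank J)%N) t K J ^+ 2.
Proof.
rewrite /half.
pose g (J : N.-bseq bool) e :=
  \sum_(K : N.-bseq bool | (size K == lev I) && (enum_rank K < enum_rank J)%N)
      (-1) ^+ e K * ((hit e I K)%:R * t K J).
have gflip (J M : N.-bseq bool) e : size M = lev I -> (enum_rank J <= enum_rank M)%N ->
    g J (flips M e) = g J e.
  move=> MI JM; apply: eq_bigr => K /andP[_ KJ]; rewrite hit_flips ?MI//.
  rewrite sgn_flips_neq//; apply: contraTneq KJ => ->.
  by rewrite -leqNgt.
rewrite (avg_sqr_signs (w := fun J e => (hit e I J)%:R * g J e)); last first.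
  move=> J M /eqP JI /eqP MI JM.
  case: (leqP (enum_rank J) (enum_rank M)) => [le|/ltnW le]; [right|left] => e.
    by rewrite !hit_flips ?MI// !gflip.
  by rewrite !hit_flips ?JI// !gflip.
apply: ler_sum => J _; apply: (@le_trans _ _ (avg (fun e => g J e ^+ 2))).
  by apply: ler_avg => e; apply: ind_sqr_le.
rewrite /g avg_sqr_signs => [|K M /andP[/eqP KI _] /andP[/eqP MI _] _]; last first.
  by left => e; rewrite !hit_flips ?KI.
apply: ler_sum => K _; rewrite -[leRHS](avg_cst ([ffun=> false] : signs)).
by apply: ler_avg => e; apply: ind_sqr_le.
Qed.

Let split_rank (P : pred (N.-bseq bool)) (F : N.-bseq bool -> R) J : P J ->
  \sum_(K | P K) F K = F J +
    (\sum_(K | P K && (enum_rank K < enum_rank J)%N) F K +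
     \sum_(K | P K && (enum_rank J < enum_rank K)%N) F K).
Proof.
move=> PJ; rewrite (bigD1 J)//=; congr (_ + _).
rewrite (bigID (fun K : N.-bseq bool => enum_rank K < enum_rank J)%N) /=; congr (_ + _).
  apply: eq_bigl => K; rewrite -andbA; congr (_ && _).
  by case: eqVneq => [->|//]; rewrite ltnn.
apply: eq_bigl => K; rewrite -andbA -leqNgt; congr (_ && _).
by rewrite [RHS]ltn_neqAle (inj_eq val_inj) (inj_eq enum_rank_inj) eq_sym.
Qed.

Lemma cform_diagE t e I : cform t e I I =
  \sum_(J : N.-bseq bool | size J == lev I) (hit e I J)%:R * t J J +
  (half t e I + half (fun J K => t K J) e I).
Proof.
pose b J : R := (-1) ^+ e J * (hit e I J)%:R.
have bb J : b J * b J = (hit e I J)%:R.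
  have := sqrr_sign R (e J); rewrite expr2 => E.
  by rewrite /b mulrACA E mul1r -natrM mulnb andbb.
have -> : cform t e I I = \sum_(J : N.-bseq bool | size J == lev I)
    \sum_(K : N.-bseq bool | size K == lev I) b K * t K J * b J.
  rewrite /cform exchange_big [RHS]big_mkcond; apply: eq_bigr => J _.
  case: ifPn => [_|/negPf JI]; last first.
    by apply: big1 => K _; rewrite [X in _ * X]block_hit /hit JI !mulr0.
  rewrite [RHS]big_mkcond; apply: eq_bigr => K _; rewrite !block_hit.
  by case: ifPn => [//|/negPf KI]; rewrite {1}/hit KI !(mulr0, mul0r).
under eq_bigr => J JI do rewrite (split_rank _ JI).
rewrite !big_split /=; congr (_ + (_ + _)).
- by apply: eq_bigr => J _; rewrite mulrAC bb.
- apply: eq_bigr => J _; rewrite !mulr_sumr; apply: eq_bigr => K _.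
  by rewrite /b mulrC -!mulrA.
- rewrite (exchange_big_dep (fun K : N.-bseq bool => size K == lev I)) /=; last first.
    by move=> J K _ /andP[].
  apply: eq_bigr => J JI; rewrite !mulr_sumr; apply: eq_big => [K|K _].
    by rewrite JI.
  by rewrite /b [_ * _ * b _]mulrAC -!mulrA.
Qed.

Section Mean.
Variables (u : N.-bseq bool -> R) (g : R) (I : n.-bseq bool).
Hypothesis u_le : forall J : N.-bseq bool, size J = lev I -> `|u J| <= g * 2 ^- lev I.

Let lI : (lev I <= N)%N. Proof. by apply: nth_leN; rewrite ltnS size_bseq. Qed.

Let A m e : R := \sum_(J : N.-bseq bool | size J == lev I)
  wgt R (sign_of e) s m I J * u J.

Let count_below a (B : seq bool) : (a <= lev I)%N -> size B = a ->
  \sum_(J : N.-bseq bool | size J == lev I) (take a J == B)%:R = 2 ^+ (lev I - a) :> R.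
Proof.
move=> aI Ba; rewrite (sum_bseq_level (fun J => (take a J == B)%:R : R) lI).
have := avg_take_tuple (fun y => (y == B)%:R : R) aI.
have Bs : size B == a by rewrite Ba.
have -> : avg (fun y : a.-tuple bool => (y == B :> seq bool)%:R) = 2 ^- a.
  rewrite /avg (bigD1 (Tuple Bs))//= eqxx big1 => [|y yB]; last first.
    by rewrite -[y == B :> seq bool]/(y == Tuple Bs) (negPf yB).
  by rewrite addr0 mul1r card_tuple card_bool natrX.
rewrite /avg card_tuple card_bool natrX.
move/(canRL (mulfVK _)) => ->; last by rewrite expf_neq0.
by rewrite -[X in _ * 2 ^+ X](subnKC aI) exprD mulKf ?expf_neq0.
Qed.

(** By [wgtS] one more level multiplies every weight by one plus a sign.  The increment
    is therefore a sum over the nodes of level [nth 0 s m], with their signs, and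
    [avg_sqr_signs] applies. *)
Let step_le m : (m < size I)%N ->
  avg (fun e => (A m.+1 e - A m e) ^+ 2) <= g ^+ 2 * 4 ^+ m * 2 ^- k0.
Proof.
move=> mI; have mn : (m < n.+1)%N by apply: ltn_trans mI _; rewrite ltnS size_bseq.
set km := nth 0%N s m.
have kmI : (km < lev I)%N.
  by apply: (sorted_ltn_nth ltn_trans 0%N ss); rewrite ?inE ?lev_lt ?sn.
have kmN : (km <= N)%N by apply: leq_trans lI; apply: ltnW.
have tl : all (fun i => i < km)%N (take m s).
  by apply: sorted_take_lt; rewrite // sn leqnn.
pose v (B : N.-bseq bool) : R :=
  \sum_(J : N.-bseq bool | (size J == lev I) && (take km J == B))
    (-1) ^+ (nth false J km (+) nth false I m) * u J.
have g0 : 0 <= g.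
  rewrite -(pmulr_lge0 _ (_ : 0 < 2 ^- lev I)); last by rewrite invr_gt0 exprn_gt0.
  apply: le_trans (u_le (_ : size (insub_bseq N (nseq (lev I) false)) = _)) => //.
  by rewrite insub_bseqK size_nseq.
have v_le (B : N.-bseq bool) : size B = km -> `|v B| <= g * 2 ^- km.
  move=> Bk; apply: le_trans (ler_norm_sum _ _ _) _.
  apply: (@le_trans _ _ (\sum_(J : N.-bseq bool | (size J == lev I) && (take km J == B))
      g * 2 ^- lev I)).
    apply: ler_sum => J /andP[/eqP JI _].
    by rewrite normrM normrX normrN1 expr1n mul1r u_le.
  rewrite big_mkcondr /= (eq_bigr (fun J : N.-bseq bool => g * 2 ^- lev I * (take km J == B)%:R)).
    rewrite -mulr_sumr (count_below (ltnW kmI) Bk) -mulrA.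
    have E : 2 ^+ lev I = 2 ^+ km * 2 ^+ (lev I - km) :> R.
      by rewrite -exprD subnKC// ltnW.
    by rewrite E invfM mulfVK ?expf_neq0.
  by move=> J _; case: eqP; rewrite ?mulr1 ?mulr0.
have -> : avg (fun e => (A m.+1 e - A m e) ^+ 2) = avg (fun e =>
    (\sum_(B : N.-bseq bool | size B == km) (-1) ^+ e B *
       (wgt R (sign_of e) s m I B * v B)) ^+ 2).
  apply: eq_avg => e; congr (_ ^+ 2); rewrite /A -sumrB.
  rewrite (partition_big (fun J : N.-bseq bool => insub_bseq N (take km J))
    (fun B : N.-bseq bool => size B == km)) /=; last first.
    move=> J /eqP JI; rewrite insub_bseqK size_take JI kmI//.
  apply: eq_bigr => B /eqP Bk; rewrite /v !mulr_sumr; apply: eq_big => [J|J].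
    case: eqP => //= JI; rewrite -val_eqE /= insub_bseqK//.
    by rewrite size_take JI kmI.
  move=> /andP[/eqP JI /eqP JB].
  have tB : take km J = B by rewrite -JB insub_bseqK// size_take JI kmI.
  rewrite wgtS ?lev_lt ?sn// /wgt -(pat_take _ J tl) tB /tbit tB -/km.
  by rewrite /sign_of insub_bseq_val !signr_addb; ring.
have wflip e (B M : N.-bseq bool) : size M = km ->
    wgt R (sign_of (flips M e)) s m I B = wgt R (sign_of e) s m I B.
  by move=> Mk; rewrite /wgt pat_flips ?Mk.
rewrite avg_sqr_signs => [|B M /eqP Bk /eqP Mk _]; last first.
  by left => e; rewrite !wflip.
apply: (@le_trans _ _ (\sum_(B : N.-bseq bool | size B == km)
    (2 ^+ m * (g * 2 ^- km)) ^+ 2)).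
  apply: ler_sum => B /eqP Bk; rewrite -[leRHS](avg_cst ([ffun=> false] : signs)).
  apply: ler_avg => e; rewrite -real_normK ?num_real//.
  have vB := v_le _ Bk.
  rewrite ler_sqr ?nnegrE ?normr_ge0 ?mulr_ge0 ?exprn_ge0 ?invr_ge0 ?exprn_ge0//.
  rewrite normrM; apply: ler_pM => //; rewrite ger0_norm ?wgt_ge0//.
  by rewrite /wgt ler_piMr ?exprn_ge0//; case: eqP.
rewrite sum_level_cst//.
have -> : 2 ^+ km * (2 ^+ m * (g * 2 ^- km)) ^+ 2 = g ^+ 2 * 4 ^+ m * 2 ^- km :> R.
  rewrite (_ : 4 = 2 ^+ 2) -?exprM 1?mulnC ?exprM; last by rewrite expr2; lra.
  by field; rewrite expf_neq0.
rewrite ler_wpM2l ?mulr_ge0 ?sqr_ge0 ?exprn_ge0//.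
by rewrite lef_pV2 ?posrE ?exprn_gt0// ler_eXn2l ?ltr1n// nth_ge.
Qed.

(** The squared deviations of [2 ^- m * A m] from its mean obey the recursion
    [d m.+1 <= (d m + g ^+ 2 * 2 ^- k0) / 2]. *)
Lemma hit_mean_le :
  avg (fun e => (\sum_(J : N.-bseq bool | size J == lev I) (hit e I J)%:R * u J -
     2 ^- size I * \sum_(J : N.-bseq bool | size J == lev I) u J) ^+ 2) <=
  g ^+ 2 * 2 ^- k0.
Proof.
have rec m : (m <= size I)%N ->
    avg (fun e => (2 ^- m * (A m e - A 0 e)) ^+ 2) <= g ^+ 2 * 2 ^- k0.
  elim: m => [_|m IH mI].
    rewrite (eq_avg (G := fun=> 0)) => [|e]; last by rewrite subrr mulr0 expr0n.
    by rewrite (avg_cst [ffun=> false]) mulr_ge0 ?sqr_ge0 ?invr_ge0 ?exprn_ge0.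
  apply: (@le_trans _ _ (avg (fun e => 2^-1 * ((2 ^- m * (A m e - A 0 e)) ^+ 2 +
      2 ^- m * 2 ^- m * (A m.+1 e - A m e) ^+ 2)))).
    apply: ler_avg => e.
    have := sqr2 (2 ^- m * (A m e - A 0 e)) (2 ^- m * (A m.+1 e - A m e)).
    rewrite (exprS 2 m) invfM; set c := 2 ^- m; set x := A _ _; set y := A _ _; set z := A _ _.
    by rewrite !expr2 => h; lra.
  rewrite avgZ avgD avgZ.
  have {}IH := IH (ltnW mI); have := step_le mI.
  rewrite -(ler_pM2l (_ : 0 < 2 ^- m * 2 ^- m)); last by rewrite mulr_gt0// invr_gt0 exprn_gt0.
  have -> : 2 ^- m * 2 ^- m * (g ^+ 2 * 4 ^+ m * 2 ^- k0) = g ^+ 2 * 2 ^- k0 :> R.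
    rewrite (_ : 4 = 2 ^+ 2) -?exprM 1?mulnC ?exprM; last by rewrite expr2; lra.
    by field; rewrite !expf_neq0.
  by lra.
apply: le_trans (rec _ (leqnn _)); rewrite le_eqVlt; apply/orP; left; apply/eqP.
apply: eq_avg => e; congr (_ ^+ 2); rewrite mulrBr /A; congr (_ - _ * _).
  rewrite mulr_sumr; apply: eq_bigr => J JI.
  rewrite /hit JI /wgt (take_oversize (leqnn (size I))).
  by rewrite mulrA mulKf ?expf_neq0.
by apply: eq_bigr => J _; rewrite wgt0 mul1r.
Qed.

End Mean.

(** The deviation of the compressed form from the diagonal form given by the
    averages of the diagonal of [t] over the levels in [s]. *)
Definition deviation t e (I L : n.-bseq bool) : R :=
  cform t e I L - (I == L)%:R *
    (2 ^- size I * \sum_(J : N.-bseq bool | size J == lev I) t J J).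

(** The constant is the sum of [4], from splitting a diagonal entry into two [half]
    sums and a mean, and [2], from the deviation of that mean. *)
Lemma deviation_le t G sig (I L : n.-bseq bool) :
  (forall a b, (k0 <= a <= N)%N -> (k0 <= b <= N)%N -> hs t a b <= G ^+ 2 * sig) ->
  (forall J, `|t J J| <= G * 2 ^- size J) -> 2 ^- k0 <= sig ->
  avg (fun e => deviation t e I L ^+ 2) <= 6 * G ^+ 2 * sig.
Proof.
move=> hsG tG ksig.
have sig0 : 0 <= sig by apply: le_trans ksig; rewrite invr_ge0 exprn_ge0.
have Gs0 : 0 <= G ^+ 2 * sig by rewrite mulr_ge0 ?sqr_ge0.
have levP (M : n.-bseq bool) : (k0 <= lev M <= N)%N.
  by rewrite nth_ge ?nth_leN// ltnS size_bseq.
case: (eqVneq I L) => [<-|IL]; last first.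
  rewrite (eq_avg (G := fun e => cform t e I L ^+ 2)) => [|e]; last first.
    by rewrite /deviation (negPf IL) mul0r subr0.
  apply: le_trans (cform_offdiag_le t IL) _.
  by have := hsG _ _ (levP I) (levP L); lra.
pose d e := \sum_(J : N.-bseq bool | size J == lev I) (hit e I J)%:R * t J J -
     2 ^- size I * \sum_(J : N.-bseq bool | size J == lev I) t J J.
pose t' J K := t K J.
have dE e : deviation t e I I = (half t e I + half t' e I) + d e.
  by rewrite /deviation eqxx mul1r cform_diagE /d -/t'; ring.
have d_le : avg (fun e => d e ^+ 2) <= G ^+ 2 * sig.
  apply: le_trans (hit_mean_le (g := G) _) _ => [J JI|]; first by rewrite -JI.
  by rewrite ler_wpM2l ?sqr_ge0.
have h_le : avg (fun e => half t e I ^+ 2) + avg (fun e => half t' e I ^+ 2) <= G ^+ 2 * sig.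
  apply: le_trans (hsG _ _ (levP I) (levP I)).
  apply: le_trans (lerD (half_le t I) (half_le t' I)) _.
  rewrite [leRHS]/hs exchange_big /=.
  have -> : \sum_(J : N.-bseq bool | size J == lev I)
     \sum_(K : N.-bseq bool | (size K == lev I) && (enum_rank K < enum_rank J)%N) t' K J ^+ 2 =
     \sum_(J : N.-bseq bool | size J == lev I)
     \sum_(K : N.-bseq bool | (size K == lev I) && (enum_rank J < enum_rank K)%N) t K J ^+ 2.
    rewrite (exchange_big_dep (fun K : N.-bseq bool => size K == lev I)) /=; last first.
      by move=> J K _ /andP[].
    by apply: eq_bigr => J JI; apply: eq_bigl => K; rewrite JI.
  rewrite -big_split; apply: ler_sum => J JI /=; rewrite [leRHS](split_rank _ JI).
  by rewrite lerDr sqr_ge0.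
apply: (@le_trans _ _ (avg (fun e => 4 * (half t e I ^+ 2 + half t' e I ^+ 2) + 2 * d e ^+ 2))).
  apply: ler_avg => e; rewrite dE.
  have := sqr2 (half t e I + half t' e I) (d e).
  by have := sqr2 (half t e I) (half t' e I); lra.
by rewrite avgD !avgZ avgD; lra.
Qed.

(** The sum of all the second moments is an average over the choices of signs, so some
    choice does at least as well. *)
Lemma deviation_small t G sig :
  (forall a b, (k0 <= a <= N)%N -> (k0 <= b <= N)%N -> hs t a b <= G ^+ 2 * sig) ->
  (forall J, `|t J J| <= G * 2 ^- size J) -> 2 ^- k0 <= sig ->
  exists e, forall I L, deviation t e I L ^+ 2 <= 6 * G ^+ 2 * sig * 4 ^+ n.+1.
Proof.
move=> hsG tG ksig.
have sig0 : 0 <= sig by apply: le_trans ksig; rewrite invr_ge0 exprn_ge0.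
have [|e eP] := @avg_le_ex R _ ([ffun=> false] : signs)
    (fun e => \sum_I \sum_L deviation t e I L ^+ 2) (6 * G ^+ 2 * sig * 4 ^+ n.+1).
  rewrite avg_sum.
  apply: (@le_trans _ _ (\sum_(I : n.-bseq bool) \sum_(L : n.-bseq bool) 6 * G ^+ 2 * sig)).
    apply: ler_sum => I _; rewrite avg_sum; apply: ler_sum => L _.
    exact: deviation_le.
  have h (c : R) : 0 <= c -> \sum_(L : n.-bseq bool) c <= 2 ^+ n.+1 * c.
    move=> c0; rewrite -[X in \sum_L X]mul1r -mulr_suml.
    by apply: ler_wpM2r => //; apply: card_bseq_le.
  have c0 : 0 <= 6 * G ^+ 2 * sig by rewrite -mulrA mulr_ge0// mulr_ge0 ?sqr_ge0.
  apply: le_trans (ler_sum _ (fun I _ => h _ c0)) _.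
  apply: le_trans (h _ _) _; first by rewrite mulr_ge0 ?exprn_ge0.
  rewrite mulrA -exprMn mulrC.
  by rewrite (_ : 2 * 2 = 4 :> R)//; lra.
exists e => I L; apply: le_trans eP.
rewrite (bigD1 I)//= (bigD1 L)//= -addrA lerDl addr_ge0// ?sumr_ge0// => *.
  by rewrite sqr_ge0.
by apply: sumr_ge0 => *; rewrite sqr_ge0.
Qed.

End SecondMoment.

(** * Stabilization of the diagonal *)

Section Pigeonhole.
Variable R : realType.

Lemma pigeonhole_seq (r : seq nat) (f : nat -> nat) (b n : nat) :
  (forall a, a \in r -> f a < b)%N -> (n * b < size r)%N ->
  exists v, (n < size [seq a <- r | f a == v])%N.
Proof.
move=> fb rn; apply: contrapT => nex.
have le v : (size [seq a <- r | f a == v] <= n)%N.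
  by rewrite leqNgt; apply/negP => h; apply: nex; exists v.
suff : (size r <= n * b)%N by rewrite leqNgt rn.
have -> : size r = (\sum_(v < b) size [seq a <- r | f a == v])%N.
  rewrite (eq_bigr (fun v : 'I_b => \sum_(a <- r) (f a == v)))%N; last first.
    by move=> v _; rewrite size_filter -sum1_count big_mkcond.
  rewrite exchange_big /= -sum1_size !big_seq; apply: eq_bigr => a /fb fab.
  rewrite (bigD1 (Ordinal fab))//= eqxx big1 ?addn0// => v va.
  by case: eqP => // E; case/eqP: va; apply: val_inj.
rewrite mulnC -[b in (b * n)%N]card_ord -sum_nat_const.
exact: leq_sum.
Qed.

(** The interval from [- G] to [G] is cut into [b] pieces; the end point [G] alone makes
    a further class. *)
Lemma stable_levels (f : nat -> R) (G : R) (b n k0 N : nat) : 0 < G -> (0 < b)%N ->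
  (forall a, (k0 <= a <= N)%N -> `|f a| <= G) -> (n * b.+1 < N.+1 - k0)%N ->
  exists s, [/\ size s = n.+1, sorted ltn s, all (fun i => i < N.+1)%N s,
    all (fun i => k0 <= i)%N s &
    forall a c, a \in s -> c \in s -> `|f a - f c| <= 2 * G / b%:R].
Proof.
move=> G0 b0 fG nb.
have b0R : 0 < b%:R :> R by rewrite ltr0n.
pose g a := (f a + G) * (b%:R / (2 * G)).
have c0 : 0 < b%:R / (2 * G) by rewrite divr_gt0// mulr_gt0.
have rP a : a \in iota k0 (N.+1 - k0) -> (k0 <= a <= N)%N.
  by rewrite mem_iota; lia.
have g_itv a : (k0 <= a <= N)%N -> 0 <= g a <= b%:R.
  move=> /fG; rewrite ler_norml => /andP[fl fu]; rewrite /g mulr_ge0 ?(ltW c0)//=; last by lra.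
  by rewrite mulrA ler_pdivrMr ?mulr_gt0// mulrC ler_wpM2l ?(ltW b0R)//; lra.
have [a /rP/g_itv/andP[a0 ab]||v nv] := @pigeonhole_seq (iota k0 (N.+1 - k0))
    (fun a => Num.truncn (g a)) b.+1 n.
- by rewrite ltnS -(ler_nat R); apply: le_trans ab; apply: (andP (truncn_itv a0)).1.
- by rewrite size_iota.
pose r := [seq a <- iota k0 (N.+1 - k0) | Num.truncn (g a) == v].
exists (take n.+1 r); have sub a : a \in take n.+1 r -> (k0 <= a <= N)%N /\ Num.truncn (g a) = v.
  by move=> /mem_take; rewrite mem_filter => /andP[/eqP ? /rP].
split.
- by rewrite size_takel.
- apply: take_sorted; apply: sorted_filter; first exact: ltn_trans.
  exact: iota_ltn_sorted.
- by apply/allP => a /sub[/andP[]]; rewrite ltnS.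
- by apply/allP => a /sub[/andP[]].
move=> a c /sub[/g_itv/andP[a0 _] av] /sub[/g_itv/andP[c0' _] cv].
have := truncn_itv a0; have := truncn_itv c0'.
rewrite av cv -[v.+1%:R]natr1 => /andP[c1 c2] /andP[a1 a2].
have E : f a - f c = (g a - g c) / (b%:R / (2 * G)).
  by rewrite /g; field; rewrite !gt_eqF.
rewrite E normrM [X in _ * X]ger0_norm ?invr_ge0 ?(ltW c0)// invf_div.
have q0 : 0 <= 2 * G / b%:R by rewrite divr_ge0 ?mulr_ge0 ?(ltW G0).
apply: ler_piMl => //.
by rewrite ler_norml; lra.
Qed.

End Pigeonhole.

(** * Matrices *)

Section Matrices.
Variable R : realType.

Definition mv (D E : finType) (M : D -> E -> R) (w : E -> R) (I : D) : R :=
  \sum_J M I J * w J.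

Lemma mv_comp (D E F : finType) (M : D -> E -> R) (M' : E -> F -> R) w I :
  mv M (mv M' w) I = mv (fun I L => \sum_J M I J * M' J L) w I.
Proof.
rewrite /mv; under eq_bigr do rewrite mulr_sumr.
rewrite exchange_big; apply: eq_bigr => L _; rewrite mulr_suml.
by apply: eq_bigr => J _; rewrite mulrA.
Qed.

Lemma eq_mv (D E : finType) (M M' : D -> E -> R) w w' I :
  (forall J, M I J = M' I J) -> w =1 w' -> mv M w I = mv M' w' I.
Proof. by move=> MM ww; apply: eq_bigr => J _; rewrite MM ww. Qed.

Lemma mv1 (D : finType) (w : D -> R) : mv (fun I J => (I == J)%:R) w =1 w.
Proof.
move=> I; rewrite /mv (bigD1 I)//= eqxx mul1r big1 ?addr0// => J JI.
by rewrite eq_sym (negPf JI) mul0r.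
Qed.

(** The square matrices indexed by a finite type are those indexed by ordinals. *)
Lemma mv_invertible (D : finType) (M : D -> D -> R) :
  (forall w, mv M w =1 (fun=> 0) -> w =1 (fun=> 0)) ->
  exists M', forall w, mv M' (mv M w) =1 w /\ mv M (mv M' w) =1 w.
Proof.
move=> Minj; pose A := \matrix_(i < #|D|, j < #|D|) M (enum_val i) (enum_val j).
have mvA (B : 'M[R]_#|D|) (w : D -> R) I :
    mv (fun I J => B (enum_rank I) (enum_rank J)) w I =
    (B *m \col_j w (enum_val j)) (enum_rank I) 0.
  rewrite !mxE /mv (reindex (@enum_val D predT)) /=.
    by apply: eq_bigr => j _; rewrite !mxE enum_valK.
  by exists enum_rank => x _; [apply: enum_valK|apply: enum_rankK].
have mvE (B : 'M[R]_#|D|) (w : D -> R) :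
    \col_j mv (fun I J => B (enum_rank I) (enum_rank J)) w (enum_val j) =
    B *m \col_j w (enum_val j).
  by apply/colP => j; rewrite mxE mvA enum_valK.
have MA w I : mv M w I = mv (fun I J => A (enum_rank I) (enum_rank J)) w I.
  by apply: eq_mv => // J; rewrite mxE !enum_rankK.
have Au : A \in unitmx.
  rewrite -unitmx_tr -row_free_unit; apply/inj_row_free => v vA.
  have Av : A *m v^T = 0 by rewrite -[A]trmxK -trmx_mul vA trmx0.
  have w0 : (fun I => v 0 (enum_rank I)) =1 (fun=> 0).
    apply: Minj => I; rewrite MA mvA.
    rewrite (_ : \col_j _ = v^T) ?Av ?mxE//.
    by apply/colP => j; rewrite !mxE enum_valK.
  by apply/rowP => j; rewrite mxE -[j]enum_valK w0.
exists (fun I J => invmx A (enum_rank I) (enum_rank J)) => w; split=> I.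
  rewrite mvA (_ : \col_j _ = A *m \col_j w (enum_val j)).
    by rewrite mulKmx// mxE enum_rankK.
  by rewrite -mvE; apply/colP => j; rewrite !mxE MA.
by rewrite MA mvA mvE mulKVmx// mxE enum_rankK.
Qed.

End Matrices.

(** * Factorization for coefficient matrices *)

Section Factorization.
Variable R : realType.
Variables (S : step_norm R) (k : rad_kind) (n N : nat).
Local Notation nu := (nu S k).

Definition matrix_factor (tau : N.-bseq bool -> N.-bseq bool -> R) (C : R) :=
  exists (B : N.-bseq bool -> n.-bseq bool -> R) (A : n.-bseq bool -> N.-bseq bool -> R),
  [/\ forall w, nu (mv B w) <= nu w, forall g, nu (mv A g) <= C * nu g &
      forall w, mv A (mv tau (mv B w)) =1 w].

Lemma nu_eq0 (w : n.-bseq bool -> R) : nu w <= 0 -> w =1 (fun=> 0).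
Proof.
move=> w0 J; apply/normr0_eq0/eqP; rewrite eq_le normr_ge0 andbT.
apply: le_trans (coef_le_nu S k w J) _.
by rewrite pmulr_rle0 ?exprn_gt0.
Qed.

(** The matrix is bounded below by [c - r]; in finite dimension it is invertible. *)
Lemma approx_invertible (M : n.-bseq bool -> n.-bseq bool -> R) c r :
  r < c -> (forall w, nu (fun I => mv M w I - c * w I) <= r * nu w) ->
  exists M', (forall w, mv M' (mv M w) =1 w) /\
             (forall w, nu (mv M' w) <= (c - r)^-1 * nu w).
Proof.
move=> rc Mc; have cr0 : 0 < c - r by rewrite subr_gt0.
have low w : (c - r) * nu w <= nu (mv M w).
  have r0 : `|c| * nu w <= nu (mv M w) + r * nu w.
    rewrite -nuZ; apply: le_trans (lerD (lexx _) (Mc w)).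
    rewrite (eq_nu S k (w' := fun I => mv M w I - (mv M w I - c * w I))) ?nuB//.
    by move=> I; rewrite subKr.
  have : c * nu w <= `|c| * nu w by rewrite ler_wpM2r ?nu_ge0 ?ler_norm.
  by rewrite mulrBl; lra.
have [|M' M'P] := @mv_invertible R _ M.
  move=> w w0; apply: nu_eq0; rewrite -(pmulr_rle0 _ cr0).
  by apply: le_trans (low w) _; rewrite (eq_nu S k w0) nu0.
exists M'; split=> w; first by have [] := M'P w.
rewrite ler_pdivlMl//; apply: le_trans (low _) _.
by rewrite (eq_nu S k (M'P w).2).
Qed.

Section FromSystem.
Variables (s : seq nat) (th : seq bool -> bool).
Hypotheses (sn : size s = n.+1) (ss : sorted ltn s)
  (sN : all (fun i => i < N.+1)%N s).

Let B (J : N.-bseq bool) (I : n.-bseq bool) : R := block R s th I J.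
Let A (I : n.-bseq bool) (J : N.-bseq bool) : R :=
  2 ^+ size I * (2 ^- size J * block R s th I J).

Let BE w : mv B w =1 embed s th w. Proof. by []. Qed.
Let AE g : mv A g =1 compress s th g.
Proof.
by move=> I; rewrite /mv /A /compress mulr_sumr; apply: eq_bigr => J _; rewrite !mulrA.
Qed.

Let U (tau : N.-bseq bool -> N.-bseq bool -> R) (I L : n.-bseq bool) : R :=
  \sum_J (\sum_K A I K * tau K J) * B J L.

Let UE tau w : mv A (mv tau (mv B w)) =1 mv (U tau) w.
Proof. by move=> I; rewrite mv_comp mv_comp. Qed.

Lemma factor_of_approx (tau : N.-bseq bool -> N.-bseq bool -> R) (c r C : R) :
  (forall w : n.-bseq bool -> R,
    nu (fun I => compress s th (mv tau (embed s th w)) I - c * w I) <= r * nu w) ->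
  r < c -> (c - r)^-1 <= C -> matrix_factor tau C.
Proof.
move=> Uc rc cC; have [|M [M1 M2]] := @approx_invertible (U tau) c r rc.
  move=> w; rewrite -(eq_nu S k (w := fun I => compress s th (mv tau (embed s th w)) I - c * w I)) ?Uc// => I.
  by rewrite -UE AE.
exists B, (fun I J => \sum_K M I K * A K J); split=> [w|g|w I].
- by rewrite (eq_nu S k (BE w)) nu_embed.
- rewrite -(eq_nu S k (mv_comp M A g)); apply: le_trans (M2 _) _.
  rewrite (eq_nu S k (AE g)); apply: ler_pM cC _; rewrite ?nu_ge0 ?nu_compress//.
  by rewrite invr_ge0 subr_ge0 ltW.
- rewrite -mv_comp -[RHS](M1 w I); exact: eq_mv.
Qed.

(** Compressing the identity gives the identity, by [compress_embed]. *)
Lemma factor_of_approx_compl (tau : N.-bseq bool -> N.-bseq bool -> R) (c r C : R) :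
  (forall w : n.-bseq bool -> R,
    nu (fun I => compress s th (mv tau (embed s th w)) I - c * w I) <= r * nu w) ->
  r < 1 - c -> (1 - c - r)^-1 <= C ->
  matrix_factor (fun I J => (I == J)%:R - tau I J) C.
Proof.
move=> Uc rc cC; apply: (@factor_of_approx _ (1 - c) r) => // w.
rewrite (eq_nu S k (w' := fun I => -1 * (compress s th (mv tau (embed s th w)) I - c * w I))).
  by rewrite nuZ normrN1 mul1r Uc.
move=> I; have -> : @compress R n N s th (mv (fun I J => (I == J)%:R - tau I J) (embed s th w)) I =
    @compress R n N s th (embed s th w) I - @compress R n N s th (mv tau (embed s th w)) I.
  rewrite /compress -mulrBr -sumrB; congr (_ * _); apply: eq_bigr => J _.
  rewrite -mulrBr; congr (_ * _); rewrite -[X in X - _](mv1 (embed s th w)) /mv -sumrB.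
  by apply: eq_bigr => K _; rewrite mulrBl.
by rewrite (compress_embed th sn ss sN); ring.
Qed.

End FromSystem.

Section Stabilize.
Variables (tau : N.-bseq bool -> N.-bseq bool -> R) (Gamma kappa Lambda : R) (M k0 : nat).
Hypotheses (Gamma_gt0 : 0 < Gamma) (kappa_gt0 : 0 < kappa) (M_gt0 : (0 < M)%N).
Hypothesis tau_le : forall w, nu (mv tau w) <= Gamma * nu w.
Hypothesis mult_le : forall (m : nat -> R) (rho : R) (w : n.-bseq bool -> R),
  (forall a, (a <= n)%N -> `|m a| <= rho) ->
  nu (fun I => m (size I) * w I) <= Lambda * rho * nu w.
Hypothesis M_ge : Lambda * Gamma <= M%:R * kappa.
Hypothesis k0_ge : Gamma ^+ 4 * 2 ^+ (16 * n + 18) <= kappa ^+ 4 * 2 ^+ k0.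
Hypothesis N_ge : (n * (21 * M).+1 < N.+1 - k0)%N.

Definition diag_sum a : R := \sum_(J : N.-bseq bool | size J == a) form tau J J.

Let diag_le a : (a <= N)%N -> `|diag_sum a| <= Gamma.
Proof.
move=> aN; apply: le_trans (ler_norm_sum _ _ _) _.
apply: (@le_trans _ _ (\sum_(J : N.-bseq bool | size J == a) Gamma * 2 ^- a)).
  by apply: ler_sum => J /eqP <-; apply: form_diag_le tau_le _.
by rewrite sum_level_cst// mulrCA mulfV ?mulr1// expf_neq0.
Qed.

Let cformE s th w (I : n.-bseq bool) : compress s th (mv tau (embed s th w)) I =
  \sum_(L : n.-bseq bool) 2 ^+ size I * (\sum_(K : N.-bseq bool) \sum_(J : N.-bseq bool)
    block R s th I K * form tau K J * block R s th L J) * w L.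
Proof.
rewrite /compress /mv /embed mulr_sumr.
under [RHS]eq_bigr => L _ do rewrite mulr_sumr mulr_suml.
rewrite [RHS]exchange_big; apply: eq_bigr => K _.
rewrite !mulr_sumr.
under [RHS]eq_bigr => L _ do rewrite mulr_sumr mulr_suml.
rewrite [RHS]exchange_big; apply: eq_bigr => J _ /=.
rewrite !mulr_sumr; apply: eq_bigr => L _; rewrite /form.
by move: (block R s th I K) (block R s th L J) (2 ^- size K) => x y z; ring.
Qed.

(* The bound [2 ^- (k0 / 2)] for squares of entries. *)
Let sig : R := Num.sqrt (2 ^- k0).
Let sig_sqr : sig ^+ 2 = 2 ^- k0.
Proof. by rewrite sqr_sqrtr ?invr_ge0 ?exprn_ge0. Qed.

Let sig_ge0 : 0 <= sig. Proof. exact: sqrtr_ge0. Qed.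

Let sig_ge : 2 ^- k0 <= sig.
Proof.
rewrite -sig_sqr expr2 ler_piMl// /sig -[leRHS]sqrtr1 ler_sqrt//.
by rewrite invf_le1 ?exprn_gt0// exprn_ege1// ler1n.
Qed.

(* The second moments, summed over at most [4 ^ n.+1] entries, times the squares of the
   factors [2 ^ n] and [4 ^ n.+1] lost in [nu_matrix_le]. *)
Let sig_le : 6 * Gamma ^+ 2 * sig * 4 ^+ (4 * n + 3) <= kappa ^+ 2.
Proof.
have h : Gamma ^+ 2 * sig * 2 ^+ (8 * n + 9) <= kappa ^+ 2.
  rewrite -(ler_pXn2r (_ : 0 < 2)%N) ?nnegrE ?mulr_ge0 ?exprn_ge0// ?(ltW Gamma_gt0) ?(ltW kappa_gt0)//.
  rewrite !exprMn sig_sqr -exprM.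
  have q4 (x : R) : x ^+ 2 * x ^+ 2 = x ^+ 4 by rewrite -exprD.
  rewrite !q4.
  rewrite (_ : ((8 * n + 9) * 2 = 16 * n + 18)%N); last by lia.
  by rewrite mulrAC ler_pdivrMr ?exprn_gt0.
apply: le_trans h; rewrite (_ : 4 = 2 ^+ 2 :> R); last by rewrite expr2; lra.
rewrite -exprM (_ : (2 * (4 * n + 3) = 8 * n + 6)%N); last by lia.
rewrite (_ : (8 * n + 9 = 3 + (8 * n + 6))%N); last by lia.
rewrite (exprD _ 3); set X : R := 2 ^+ (8 * n + 6).
have X0 : 0 <= Gamma ^+ 2 * sig * X by rewrite !mulr_ge0 ?exprn_ge0// ltW.
have -> : 6 * Gamma ^+ 2 * sig * X = 6 * (Gamma ^+ 2 * sig * X) by ring.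
have -> : Gamma ^+ 2 * sig * (2 ^+ 3 * X) = 8 * (Gamma ^+ 2 * sig * X) by ring.
by lra.
Qed.

(** Levels with almost equal diagonal averages are chosen first, then good signs.  Each
    of the two errors, from the signs and from the unequal averages, is at most
    [kappa]. *)
Lemma stabilize : exists s (th : seq bool -> bool) c,
  [/\ size s = n.+1, sorted ltn s, all (fun i => i < N.+1)%N s,
      exists2 a, (a <= N)%N & c = diag_sum a &
      forall w : n.-bseq bool -> R, nu (fun I =>
        compress s th (mv tau (embed s th w)) I - c * w I)
      <= 2 * kappa * nu w].
Proof.
have [||s [sn ss sN sk stab]] := @stable_levels R diag_sum Gamma (21 * M) n k0 N Gamma_gt0 _ _ N_ge.
- by rewrite muln_gt0.
- by move=> a /andP[_ aN]; apply: diag_le.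
have ksN : (k0 <= N)%N.
  by rewrite -ltnS -subn_gt0; apply: leq_ltn_trans N_ge.
have [|||e eP] := @deviation_small R n N s k0 sn ss sN sk (form tau) Gamma sig.
- by move=> a b ka kb; apply: form_hs_le (ltW Gamma_gt0) tau_le _ _ _ ka kb.
- by move=> J; apply: form_diag_le tau_le J.
- exact: sig_ge.
pose c := diag_sum (nth 0%N s 0).
have s0 i : (i <= n)%N -> nth 0%N s i \in s by move=> i_n; rewrite mem_nth// sn.
exists s, (sign_of e), c; split=> //.
  by exists (nth 0%N s 0) => //; rewrite -ltnS; apply: (allP sN); apply: s0.
move=> w; pose m a := diag_sum (nth 0%N s a) - c.
rewrite (eq_nu S k (w' := fun I =>
    (\sum_L (2 ^+ size I * deviation s (form tau) e I L) * w L) + m (size I) * w I)).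
  apply: le_trans (nuD _ _ _ _) _.
  have -> : 2 * kappa * nu w = kappa * nu w + kappa * nu w by ring.
  apply: lerD.
    pose z : R := 2 ^+ n * Num.sqrt (6 * Gamma ^+ 2 * sig * 4 ^+ n.+1).
    have q0 : 0 <= 6 * Gamma ^+ 2 * sig * 4 ^+ n.+1.
      by rewrite mulr_ge0 ?exprn_ge0// mulr_ge0// mulr_ge0// sqr_ge0.
    apply: le_trans (nu_matrix_le S k (z := z) w _) _ => [I L|].
      rewrite normrM [X in X * _]ger0_norm ?exprn_ge0//; apply: ler_pM => //.
      - by apply: ler_weXn2l; rewrite ?ler1n ?size_bseq.
      - by rewrite -sqrtr_sqr ler_sqrt.
    rewrite ler_wpM2r ?nu_ge0//.
    rewrite -(ler_pXn2r (_ : 0 < 2)%N) ?nnegrE ?(ltW kappa_gt0)//; last first.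
      by rewrite /z !mulr_ge0 ?exprn_ge0 ?sqrtr_ge0.
    apply: le_trans sig_le; rewrite /z !exprMn sqr_sqrtr// -!exprM.
    rewrite (mulnC n 2) exprM (_ : 2 ^+ 2 = 4 :> R); last by rewrite expr2; lra.
    set q := 6 * Gamma ^+ 2 * sig.
    rewrite le_eqVlt; apply/orP; left; apply/eqP.
    rewrite (_ : (4 * n + 3 = n + n.+1 + n.+1 * 2)%N); last by clear; lia.
    by rewrite !exprD; ring.
  apply: le_trans (mult_le (rho := 2 * Gamma / (21 * M)%:R) w _) _ => [a an|].
    by apply: stab; apply: s0.
  rewrite ler_wpM2r ?nu_ge0// natrM.
  have M0 : 0 < M%:R :> R by rewrite ltr0n.
  rewrite mulrA ler_pdivrMr ?mulr_gt0//.
  have : 0 <= M%:R * kappa by rewrite mulr_ge0 ?ltW.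
  by have := M_ge; rewrite mulrCA [kappa * _]mulrC -mulrA; lra.
move=> I; rewrite cformE /m mulrBl addrA; congr (_ - _).
have <- : \sum_(L : n.-bseq bool) 2 ^+ size I * ((I == L)%:R *
    (2 ^- size I * diag_sum (nth 0%N s (size I)))) * w L =
    diag_sum (nth 0%N s (size I)) * w I.
  rewrite (bigD1 I)//= eqxx mul1r mulVKf ?expf_neq0// big1 ?addr0// => L LI.
  by rewrite eq_sym (negPf LI) mul0r mulr0 mul0r.
rewrite -big_split; apply: eq_bigr => L _ /=.
by rewrite -mulrDl -mulrDr /deviation /cform /diag_sum subrK.
Qed.

End Stabilize.
End Factorization.

(** * Dyadic intervals as bit sequences *)

Section Nodes.

Definition num (s : seq bool) : nat := foldl (fun q (b : bool) => (q.*2 + b)%N) 0%N s.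

Lemma num_rcons s b : num (rcons s b) = ((num s).*2 + b)%N.
Proof. by rewrite /num foldl_rcons. Qed.

Lemma num_lt s : (num s < 2 ^ size s)%N.
Proof.
elim/last_ind: s => [//|s b IH]; rewrite num_rcons size_rcons expnS.
by case: b; lia.
Qed.

Fixpoint bits (j p : nat) : seq bool :=
  if j is j'.+1 then rcons (bits j' p./2) (odd p) else [::].

Lemma size_bits j p : size (bits j p) = j.
Proof. by elim: j p => //= j IH p; rewrite size_rcons IH. Qed.

Lemma bitsK j p : (p < 2 ^ j)%N -> num (bits j p) = p.
Proof.
elim: j p => [|j IH] p; first by rewrite expn0; case: p.
rewrite expnS => pj /=; rewrite num_rcons IH; last by lia.
by rewrite addnC odd_double_half.
Qed.

Lemma numK s : bits (size s) (num s) = s.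
Proof.
elim/last_ind: s => [//|s b IH]; rewrite size_rcons num_rcons /=.
rewrite oddD odd_double addbC addbF oddb.
by rewrite addnC half_bit_double IH.
Qed.

Lemma num_inj s s' : size s = size s' -> num s = num s' -> s = s'.
Proof. by move=> ss nn; rewrite -[s]numK -[s']numK ss nn. Qed.

(** [num] is the position, so that [dy s] is the interval whose points have binary
    expansions starting with [s]. *)
Definition dy (s : seq bool) : dyadic :=
  Tagged (fun j => 'I_(2 ^ j)) (Ordinal (num_lt s)).

Definition node (I : dyadic) : seq bool := bits (lvl I) (pos I).

Lemma lvl_dy s : lvl (dy s) = size s. Proof. by []. Qed.
Lemma pos_dy s : pos (dy s) = num s. Proof. by []. Qed.

Lemma dyK : cancel dy node.
Proof. by move=> s; rewrite /node lvl_dy pos_dy numK. Qed.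

Lemma dyadic_ext (I J : dyadic) : lvl I = lvl J -> pos I = pos J -> I = J.
Proof.
case: I J => [i p] [j q]; rewrite /lvl /pos /= => ij; subst j => pq.
by congr existT; apply: val_inj.
Qed.

Lemma nodeK : cancel node dy.
Proof.
move=> I; apply: dyadic_ext; rewrite ?lvl_dy ?pos_dy /node ?size_bits//.
by rewrite bitsK// ltn_ord.
Qed.

Lemma size_node I : size (node I) = lvl I. Proof. exact: size_bits. Qed.

Lemma iota_dy s : iota_dyadic (Some (dy s)) = (2 ^ size s + num s)%N.
Proof. by []. Qed.

End Nodes.

(** * Step functions on the dyadic grid *)

Section Cells.
Variable R : realType.
Local Notation avg := (@avg R _).

Definition cell (s : seq bool) : R -> R := \1_(@Defs.dyadic_itv R (size s) (num s)).

Lemma cellE s t : cell s t =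
  ((num s)%:R <= t * 2 ^+ size s < (num s).+1%:R)%R%:R.
Proof.
rewrite /cell indicE /Defs.dyadic_itv; congr (nat_of_bool _)%:R.
rewrite mem_setE in_itv /= ler_pdivrMr ?exprn_gt0// ltr_pdivlMr ?exprn_gt0//.
Qed.

Lemma cell_nil : cell [::] = \1_(@unit_itv R).
Proof.
apply/funext => t; rewrite cellE expr0 mulr1 indicE /unit_itv mem_setE in_itv /=.
by [].
Qed.

Lemma cell_split s t : cell s t = cell (rcons s false) t + cell (rcons s true) t.
Proof.
rewrite !cellE !num_rcons !size_rcons exprSr mulrA addn0 addn1.
set u := t * 2 ^+ size s; set p := num s.
have -> : (p.*2)%:R = 2 * p%:R :> R by rewrite -mul2n natrM.
have -> : (p.*2.+1)%:R = 2 * p%:R + 1 :> R by rewrite -[p.*2.+1]addn1 natrD -mul2n natrM.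
have -> : (p.*2.+2)%:R = 2 * p%:R + 2 :> R.
  by rewrite -[p.*2.+2]addn2 natrD -mul2n natrM.
rewrite -[p.+1%:R]natr1.
case: (lerP p%:R u) => h1; case: (ltrP u (p%:R + 1)) => h2 /=;
  case: (lerP (2 * p%:R) (u * 2)) => h3; case: (ltrP (u * 2) (2 * p%:R + 1)) => h4 /=;
  case: (lerP (2 * p%:R + 1) (u * 2)) => h5; case: (ltrP (u * 2) (2 * p%:R + 2)) => h6 /=;
  rewrite ?addr0 ?add0r//; exfalso; lra.
Qed.

Lemma haarE s t : @haar R (Some (dy s)) t = cell (rcons s false) t - cell (rcons s true) t.
Proof. by rewrite /cell !num_rcons !size_rcons addn0 addn1. Qed.

Lemma cell01 s t : cell s t = 0 \/ cell s t = 1.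
Proof. by rewrite cellE; case: (_ && _); [right|left]. Qed.

Lemma sum_tuple_rcons (V : nmodType) m (F : seq bool -> V) :
  \sum_(x : m.+1.-tuple bool) F x =
  \sum_(y : m.-tuple bool) (F (rcons y false) + F (rcons y true)).
Proof.
pose h (p : m.-tuple bool * bool) : m.+1.-tuple bool := [tuple of rcons p.1 p.2].
have hI : injective h.
  by move=> [y b] [y' b'] /(congr1 val)/= /rcons_inj[/val_inj -> ->].
have hb : bijective h.
  by apply: inj_card_bij hI _; rewrite card_prod !card_tuple card_bool expnSr.
rewrite (reindex h) /=; last exact: onW_bij.
rewrite -(pair_bigA _ (fun (y : m.-tuple bool) (b : bool) => F (rcons y b))) /=.
by apply: eq_bigr => y _; rewrite big_bool /= addrC.
Qed.

Lemma cell_expand m s t : (size s <= m)%N ->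
  cell s t = \sum_(x : m.-tuple bool) (take (size s) x == s)%:R * cell x t.
Proof.
elim: m => [|m IH] sm.
  have -> : s = [::] by apply/nilP; rewrite /nilp -leqn0.
  rewrite (big_pred1 [tuple]) => [|x]; last by rewrite [x]tuple0; apply/esym/eqP.
  by rewrite eqxx mul1r.
rewrite (sum_tuple_rcons _ (fun x => (take (size s) x == s)%:R * cell x t)).
move: sm; rewrite leq_eqVlt => /predU1P[sm|sm].
  have [s' [b sE]] : exists s' b, s = rcons s' b.
    by case/lastP: s sm {IH} => // s' b _; exists s', b.
  have s'm : size s' == m by move: sm; rewrite sE size_rcons => -[->].
  rewrite (bigD1 (Tuple s'm))//= big1 ?addr0 => [|y yz]; last first.
    rewrite sm !take_oversize ?size_rcons ?size_tuple// sE !eqseq_rcons.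
    by rewrite -[y == s' :> seq bool]/(y == Tuple s'm) (negPf yz) !mul0r addr0.
  rewrite sm !take_oversize ?size_rcons ?(eqP s'm)// sE !eqseq_rcons eqxx.
  by case: b {sE}; rewrite /= mul1r mul0r ?addr0 ?add0r.
rewrite ltnS in sm; rewrite (IH sm); apply: eq_bigr => y _.
by rewrite -!cats1 !takel_cat ?size_tuple// !cats1 (cell_split y) mulrDr.
Qed.

Definition step m (v : m.-tuple bool -> R) : R -> R :=
  fun t => \sum_x v x * cell x t.

(** The indicators of the cells of a grid take the values 0 and 1, and they add up to
    the indicator of the unit interval. *)
Lemma cell_unique m t : (\1_(@unit_itv R) t = 0 :> R /\ forall x : m.-tuple bool, cell x t = 0) \/
  (\1_(@unit_itv R) t = 1 :> R /\ exists x : m.-tuple bool, forall y : m.-tuple bool, cell y t = (y == x)%:R).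
Proof.
have S : \1_(@unit_itv R) t = \sum_(x : m.-tuple bool) cell x t.
  rewrite -cell_nil (@cell_expand m [::])//; apply: eq_bigr => x _.
  by rewrite take0 eqxx mul1r.
have c0 (x : m.-tuple bool) : 0 <= cell x t by case: (cell01 x t) => ->.
case: (pselect (exists x : m.-tuple bool, cell x t = 1)) => [[x x1]|nx]; last first.
  have c (x : m.-tuple bool) : cell x t = 0.
    by case: (cell01 x t) => // x1; case: nx; exists x.
  by left; split=> //; rewrite S big1.
have le1 : \1_(@unit_itv R) t <= 1 :> R by rewrite indicE; case: (_ \in _).
right; split.
  apply/eqP; rewrite eq_le le1 /= S (bigD1 x)//= x1 lerDl.
  by apply: sumr_ge0 => y _; apply: c0.
exists x => y; case: (eqVneq y x) => [->//|yx].
case: (cell01 y t) => // y1; exfalso.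
move: le1; rewrite S (bigD1 x)//= (bigD1 y)//= x1 y1 => le1.
have : 0 <= \sum_(i | (i != x) && (i != y)) cell (i : m.-tuple bool) t.
  by apply: sumr_ge0 => z _; apply: c0.
by lra.
Qed.

Lemma step_out m (v : m.-tuple bool -> R) t : \1_(@unit_itv R) t = 0 :> R ->
  step v t = 0.
Proof.
case: (cell_unique m t) => [[_ c0] _|[-> _] /eqP]; last by rewrite oner_eq0.
by rewrite /step big1// => x _; rewrite c0 mulr0.
Qed.

Lemma step_in m (x : m.-tuple bool) t (v : m.-tuple bool -> R) :
  (forall y : m.-tuple bool, cell y t = (y == x)%:R) -> step v t = v x.
Proof.
move=> cx; rewrite /step (bigD1 x)//= cx eqxx mulr1 big1 ?addr0// => y yx.
by rewrite cx (negPf yx) mulr0.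
Qed.

Lemma cell_point m (x : m.-tuple bool) :
  exists t, forall y : m.-tuple bool, cell y t = (y == x)%:R.
Proof.
exists ((num x)%:R / 2 ^+ m) => y.
rewrite cellE size_tuple mulfVK ?expf_neq0// ler_nat ltr_nat ltnS -eqn_leq.
congr (nat_of_bool _)%:R; apply/eqP/eqP => [/num_inj|-> //].
by rewrite !size_tuple => /(_ erefl) /val_inj.
Qed.

Lemma step_inj m (v w : m.-tuple bool -> R) : step v = step w -> v =1 w.
Proof.
move=> vw x; have [t tx] := cell_point x.
by rewrite -(step_in v tx) -(step_in w tx) vw.
Qed.

Lemma stepD m (v w : m.-tuple bool -> R) : step (fun x => v x + w x) = step v + step w.
Proof.
apply/funext => t; rewrite [RHS](_ : _ = step v t + step w t)// /step -big_split.
by apply: eq_bigr => x _; rewrite mulrDl.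
Qed.

Lemma stepZ m c (v : m.-tuple bool -> R) : step (fun x => c * v x) = c *: step v.
Proof.
apply/funext => t; rewrite [RHS](_ : _ = c * step v t)// /step mulr_sumr.
by apply: eq_bigr => x _; rewrite mulrA.
Qed.

Lemma step_comp m (v : m.-tuple bool -> R) (f : R -> R) t :
  f 0 = 0 -> f (step v t) = step (fun x => f (v x)) t.
Proof.
move=> f0; case: (cell_unique m t) => [[t0 _]|[_ [x cx]]].
  by rewrite !step_out.
by rewrite !(step_in _ cx).
Qed.

Lemma step1 m : step (fun _ : m.-tuple bool => 1) = \1_(@unit_itv R).
Proof.
apply/funext => t; rewrite -cell_nil (@cell_expand m [::])//; apply: eq_bigr => x _.
by rewrite take0.
Qed.

Lemma haar_step m s : (size s < m)%N -> @haar R (Some (dy s)) =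
  step (fun x : m.-tuple bool => (take (size s) x == s)%:R * (-1) ^+ nth false x (size s)).
Proof.
move=> sm; apply/funext => t; rewrite haarE !(@cell_expand m) ?size_rcons//.
rewrite -sumrB; apply: eq_bigr => x _.
rewrite (take_nth false) ?size_tuple// !eqseq_rcons -mulrBl; congr (_ * _).
by case: eqP => _; case: nth => /=; rewrite ?mul1r ?mul0r ?subr0 ?sub0r.
Qed.

(** * Integrals of step functions *)

Local Notation mu := (@lebesgue_measure R).

Lemma measurable_unit : measurable (@unit_itv R).
Proof. exact: measurable_itv. Qed.

Lemma measurable_cell s : measurable_fun setT (cell s).
Proof. by apply: measurable_indic; apply: measurable_itv. Qed.

Lemma measurable_step m (v : m.-tuple bool -> R) : measurable_fun setT (step v).
Proof.
apply: measurable_sum => x; apply: measurable_funM => //.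
exact: measurable_cell.
Qed.

Lemma integral_cell m (x : m.-tuple bool) :
  (\int[mu]_(t in @unit_itv R) (cell x t)%:E = (2 ^- m)%:E)%E.
Proof.
rewrite integral_indic; [|exact: measurable_unit|exact: measurable_itv].
rewrite (_ : _ `&` _ = @Defs.dyadic_itv R (size x) (num x))%classic; last first.
  apply/setIidPl => t tx; have : cell x t = 1.
    by rewrite /cell indicE mem_set.
  rewrite /unit_itv -[`[0, 1[%classic t]/(@unit_itv R t) => c1.
  apply: contrapT => nt; have : cell [::] t = 0.
    by rewrite cell_nil indicE memNset.
  rewrite (@cell_expand m [::])// (bigD1 x)//= take0 eqxx mul1r c1 => E.
  have : 0 <= \sum_(i | i != x) (take 0 (i : m.-tuple bool) == [::])%:R * cell i t.
    by apply: sumr_ge0 => y _; case: (cell01 y t) => ->; rewrite ?mulr0 ?mulr1.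
  by lra.
apply: etrans (lebesgue_measure_itv _) _; rewrite /= lte_fin size_tuple.
rewrite ltr_pM2r ?invr_gt0 ?exprn_gt0// ltr_nat ltnSn -EFinB; congr EFin.
by rewrite -mulrBl -natr1 addrAC subrr add0r mul1r.
Qed.

Lemma integrable_cell s c : mu.-integrable (@unit_itv R) (EFin \o (fun t => c * cell s t)).
Proof.
apply: (@integrableS _ _ _ _ setT) => //; first exact: measurable_unit.
rewrite (_ : EFin \o _ = (fun t => c%:E * (EFin \o cell s) t)%E); last first.
  by apply/funext => t /=; rewrite EFinM.
by apply: integrableZl => //; apply: integrable_indic_itv.
Qed.

Lemma integral_step m (v : m.-tuple bool -> R) :
  (\int[mu]_(t in @unit_itv R) (step v t)%:E = (avg v)%:E)%E.
Proof.
under eq_integral do rewrite /step -sumEFin.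
rewrite integral_sum; [|exact: measurable_unit|]; last first.
  by move=> x; apply: integrable_cell.
rewrite /avg card_tuple card_bool natrX mulr_suml -sumEFin.
apply: eq_bigr => x _; under eq_integral do rewrite EFinM.
rewrite integralZl; [|exact: measurable_unit|]; last first.
  rewrite (_ : (fun t => (cell x t)%:E) = EFin \o (fun t => 1 * cell x t)).
    exact: integrable_cell.
  by apply/funext => t /=; rewrite mul1r.
by rewrite integral_cell -EFinM.
Qed.

Lemma Rintegral_step m (v : m.-tuple bool -> R) :
  \int[mu]_(t in @unit_itv R) step v t = avg v.
Proof. by rewrite /Rintegral integral_step. Qed.

Lemma measure_step m (v : m.-tuple bool -> R) (A : set R) : measurable A ->
  mu (@unit_itv R `&` step v @^-1` A)%classic =
  (avg (fun x => (v x \in A)%:R))%:E.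
Proof.
move=> mA; have mP : measurable (@unit_itv R `&` step v @^-1` A)%classic.
  apply: (@measurable_funTS _ _ _ _ _ (step v)) => //.
    exact: measurable_step.
  exact: measurable_unit.
rewrite -[X in mu X](setIidl (B := @unit_itv R)); last by move=> t [].
rewrite -integral_indic//; last exact: measurable_unit.
rewrite -integral_step; apply: eq_integral => t /set_mem ut; congr EFin.
case: (cell_unique m t) => [[]|[_ [x cx]]].
  by rewrite indicE mem_set// => /eqP; rewrite oner_eq0.
rewrite (step_in _ cx) indicE; congr (nat_of_bool _)%:R.
apply/idP/idP => [/set_mem [_]|/set_mem vA]; last apply/mem_set; rewrite /preimage /= (step_in _ cx)//.
exact: mem_set.
Qed.

End Cells.

(** * Haar system spaces and step norms *)

Section SpaceNorm.
Variable R : realType.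
Variable X : haar_system_space R.
Local Notation avg := (@avg R _).

Lemma Hspace_lin (c : R) (f g : R -> R) : Hspace f -> Hspace g -> Hspace (c *: f + g).
Proof.
move=> Hf Hg; have [_ H] := haar_span_submod_closed R setT.
by apply: set_mem; apply: H; apply: mem_set.
Qed.

Lemma Hspace0 : Hspace (0 : R -> R).
Proof. by have [H _] := haar_span_submod_closed R setT; apply: set_mem H. Qed.

Lemma Hspace_haar I : Hspace (@haar R I).
Proof.
exists (fun J => (J == I)%:R); split.
  apply: sub_finite_set (finite_set1 I) => J /=.
  by case: (eqVneq J I) => //=; rewrite eqxx.
rewrite /haar_sum -(@fsbig_widen _ _ _ _ [set I]%classic) => [|//|J [_ /= JI]].
  by rewrite fsbig_set1/= eqxx scale1r.
by case: eqP => //; rewrite scale0r.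
Qed.

(** The two halves of an interval are recovered from its indicator and its Haar
    function. *)
Lemma Hspace_cell s : Hspace (@cell R s).
Proof.
elim/last_ind: s => [|s b IH]; first by rewrite cell_nil; apply: (Hspace_haar None).
have -> : @cell R (rcons s b) =
    (2^-1 * (-1) ^+ b) *: @haar R (Some (dy s)) + (2^-1 *: @cell R s + 0).
  apply/funext => t; rewrite [RHS](_ : _ = 2^-1 * (-1) ^+ b * @haar R (Some (dy s)) t +
    (2^-1 * cell s t + 0))// haarE (cell_split s t).
  by case: b; rewrite /= ?expr0 ?expr1; lra.
by apply: Hspace_lin; [exact: Hspace_haar|apply: Hspace_lin => //; apply: Hspace0].
Qed.

Lemma Hspace_step m (v : m.-tuple bool -> R) : Hspace (step v).
Proof.
have -> : step v = \sum_x v x *: @cell R x by apply/funext => t; rewrite fct_sumE.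
elim/big_ind: _ => [|f g Hf Hg|x _]; first exact: Hspace0.
  by rewrite -[f]scale1r; apply: Hspace_lin.
by rewrite -[_ *: _]addr0; apply: Hspace_lin (Hspace_cell _) Hspace0.
Qed.

Let sn m (v : m.-tuple bool -> R) : R := X (step v).

Let snD m (v w : m.-tuple bool -> R) : sn (fun x => v x + w x) <= sn v + sn w.
Proof. by rewrite /sn stepD; apply: hs_normD; apply: Hspace_step. Qed.

Let snZ m c (v : m.-tuple bool -> R) : sn (fun x => c * v x) = `|c| * sn v.
Proof. by rewrite /sn stepZ; apply: hs_normZ; apply: Hspace_step. Qed.

Let sn_dist m m' (v : m.-tuple bool -> R) (w : m'.-tuple bool -> R) :
  (forall P : pred R, avg (fun x : m.-tuple bool => (P `|v x|)%:R) =
     avg (fun y : m'.-tuple bool => (P `|w y|)%:R)) -> sn v = sn w.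
Proof.
move=> vw; apply: hs_norm_dist; [exact: Hspace_step|exact: Hspace_step|].
have E l (u : l.-tuple bool -> R) : (fun t => `|step u t|) = step (fun x => `|u x|).
  by apply/funext => t; rewrite (step_comp _ _ (normr0 _)).
rewrite !E => A mA; rewrite !measure_step//; congr EFin.
exact: (vw (fun r => r \in A)).
Qed.

Let sn1 m : sn (fun _ : m.-tuple bool => 1) = 1.
Proof. by rewrite /sn step1 hs_norm1. Qed.

Definition space_norm : step_norm R := StepNorm snD snZ sn_dist sn1.

Lemma space_normE m (v : m.-tuple bool -> R) : snorm space_norm v = X (step v).
Proof. by []. Qed.

End SpaceNorm.

(** * Haar sums *)

Section HaarSums.
Variable R : realType.
Local Notation avg := (@avg R _).

Lemma fsum_nodes (V : nmodType) N (G : dyadicp -> V) :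
  (forall I, (N < lvl I)%N -> G (Some I) = 0) ->
  \sum_(I \in [set: dyadicp]) G I = G None + \sum_(J : N.-bseq bool) G (Some (dy J)).
Proof.
move=> G0; pose r := None :: [seq Some (dy (val J)) | J <- enum {: N.-bseq bool}].
have hI : injective (fun J : N.-bseq bool => Some (dy (val J))).
  by move=> I J /Some_inj /(can_inj dyK) /val_inj.
rewrite (fsbigE r).
- rewrite big_mkcond /= big_cons in_setT; congr (_ + _).
  rewrite big_map big_enum; apply: eq_bigr => J _.
  by rewrite in_setT.
- rewrite /r /= map_inj_uniq ?enum_uniq// andbT; apply/negP => /mapP[J _] //.
- by [].
move=> [I|]; rewrite /r ?mem_head// => _ Ir; apply: G0.
rewrite ltnNge; apply: contra Ir => IN; rewrite in_cons /=.
apply/mapP; exists (insub_bseq N (node I)); first by rewrite mem_enum.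
by rewrite insub_bseqK ?size_node// nodeK.
Qed.

Definition hsum N (w : N.-bseq bool -> R) : R -> R :=
  \sum_(J : N.-bseq bool) w J *: @haar R (Some (dy J)).

(** Only the nodes above [x] contribute, one on each level. *)
Lemma sum_branch N m (x : m.-tuple bool) (G : seq bool -> R) : (N < m)%N ->
  \sum_(J : N.-bseq bool) (take (size J) x == J)%:R * G J =
  \sum_(i < N.+1) G (take i x).
Proof.
move=> Nm; rewrite sum_by_level; apply: eq_bigr => a _.
have aN : (a <= N)%N by rewrite -ltnS.
have st : size (take a x) = a.
  by rewrite size_take size_tuple (leq_ltn_trans aN Nm).
have vt : insub_bseq N (take a x) = take a x :> seq bool.
  by rewrite insub_bseqK ?st.
rewrite (bigD1 (insub_bseq N (take a x))) ?vt ?st//= eqxx mul1r big1 ?addr0//.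
move=> J /andP[/eqP Ja JI]; case: eqP => [E|]; last by rewrite mul0r.
by move: JI; rewrite -val_eqE /= vt -{1}Ja E eqxx.
Qed.

Lemma hsum_step N (w : N.-bseq bool -> R) :
  hsum w = step (fun x : N.+1.-tuple bool => \sum_(i < N.+1) comp w x i).
Proof.
apply/funext => t; rewrite /hsum fct_sumE.
rewrite (eq_bigr (fun J : N.-bseq bool => \sum_(x : N.+1.-tuple bool)
   (take (size J) x == J)%:R * ((-1) ^+ nth false x (size J) * w J) * @cell R x t)).
  rewrite exchange_big; apply: eq_bigr => x _; rewrite -mulr_suml; congr (_ * _).
  pose G (s : seq bool) : R := (-1) ^+ nth false x (size s) * w (insub_bseq N s).
  transitivity (\sum_(J : N.-bseq bool) (take (size J) x == J)%:R * G J).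
    by apply: eq_bigr => J _; rewrite /G insub_bseq_val.
  rewrite sum_branch//; apply: eq_bigr => i _.
  by rewrite /G /comp size_take size_tuple ltn_ord.
move=> J _; have JN : (size J < N.+1)%N by rewrite ltnS size_bseq.
rewrite (_ : (_ *: _) t = w J * @haar R (Some (dy J)) t)// (haar_step R JN) /step mulr_sumr.
by apply: eq_bigr => x _; ring.
Qed.

Lemma hsum_lin N c (w w' : N.-bseq bool -> R) :
  hsum (fun J => c * w J + w' J) = c *: hsum w + hsum w'.
Proof.
rewrite /hsum scaler_sumr -big_split; apply: eq_bigr => J _ /=.
by rewrite scalerDl scalerA.
Qed.

Lemma eq_hsum N (w w' : N.-bseq bool -> R) : w =1 w' -> hsum w = hsum w'.
Proof. by move=> ww; apply: eq_bigr => J _; rewrite ww. Qed.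

(** Every level has mean zero, so the average recovers [c]; then [coef_le_Phi] bounds the
    other coefficients. *)
Lemma hsum_inj0 N (c : R) (w : N.-bseq bool -> R) :
  c *: (\1_(@unit_itv R) : R -> R) + hsum w = 0 -> c = 0 /\ w =1 (fun=> 0).
Proof.
rewrite hsum_step -(step1 R N.+1) -stepZ -stepD => E.
have {}E (x : N.+1.-tuple bool) : c + \sum_(i < N.+1) comp w x i = 0.
  have H : step (fun y : N.+1.-tuple bool => c * 1 + \sum_(i < N.+1) comp w y i) =
      step (fun _ : N.+1.-tuple bool => 0).
    by rewrite E; apply/funext => t; rewrite /step big1// => y _; rewrite mul0r.
  by have := step_inj H x; rewrite mulr1.
have c0 : c = 0.
  have: avg (fun x : N.+1.-tuple bool => c + \sum_(i < N.+1) comp w x i) = 0.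
    by rewrite (eq_avg E) (avg_cst [tuple false | _ < N.+1]).
  rewrite avgD (avg_cst [tuple false | _ < N.+1]) avg_sum big1 ?addr0// => i _.
  apply: (avg_odd (@flipb_inj _ i)) => x.
  by rewrite /comp nth_flipb// take_flipb// eqxx addbT signrN mulNr.
split=> // J; apply/eqP; rewrite -normr_le0.
apply: le_trans (coef_le_Phi Constant w J) _.
rewrite (eq_avg (G := fun=> 0)) ?(avg_cst [tuple false | _ < N.+1])// => x.
by have := E x; rewrite c0 add0r /Phi /radnorm => ->; rewrite normr0 mulr0.
Qed.

Lemma hsum_inj N (w w' : N.-bseq bool -> R) : hsum w = hsum w' -> w =1 w'.
Proof.
move=> E J; apply/eqP; rewrite -subr_eq0; apply/eqP.
have [|_ H] := @hsum_inj0 N 0 (fun J => -1 * w' J + w J).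
  by rewrite scale0r add0r hsum_lin E scaleN1r addNr.
by rewrite -[RHS](H J); ring.
Qed.

Lemma haar_sum_nodes N (a : dyadicp -> R) :
  (forall I, (N < lvl I)%N -> a (Some I) = 0) ->
  haar_sum setT a = a None *: (\1_(@unit_itv R) : R -> R) + hsum (fun J : N.-bseq bool => a (Some (dy J))).
Proof.
by move=> a0; rewrite /haar_sum (@fsum_nodes _ N)// => I /a0 ->; rewrite scale0r.
Qed.

Lemma fin_supp_lvl (a : dyadicp -> R) : fin_supp a ->
  exists N, forall I, (N < lvl I)%N -> a (Some I) = 0.
Proof.
move=> /finite_seqP[r rE]; exists (\max_(I <- r) if I is Some J then lvl J else 0)%N.
move=> I; rewrite ltnNge; apply: contraNeq => aI.
have Ir : Some I \in r by have : [set` r]%classic (Some I) by rewrite -rE; exact: aI.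
by rewrite (big_rem (Some I))//= leq_maxl.
Qed.

Lemma haar_sum_inj (a b : dyadicp -> R) : fin_supp a -> fin_supp b ->
  haar_sum setT a = haar_sum setT b -> a = b.
Proof.
move=> /fin_supp_lvl[N a0] /fin_supp_lvl[M b0].
rewrite (@haar_sum_nodes (maxn N M)); last by move=> I IN; apply: a0; lia.
rewrite (@haar_sum_nodes (maxn N M)); last by move=> I IN; apply: b0; lia.
set L := maxn N M => E.
have [|ab abJ] := @hsum_inj0 L (a None - b None)
    (fun J => -1 * b (Some (dy J)) + a (Some (dy J))).
  rewrite hsum_lin scaleN1r scalerBl [X in _ + X]addrC addrACA -opprD E.
  exact: subrr.
apply/funext => -[I|]; last by apply/eqP; rewrite -subr_eq0 ab.
case: (leqP (lvl I) L) => IL; last by rewrite a0 ?b0//; lia.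
have := abJ (insub_bseq L (node I)); rewrite insub_bseqK ?size_node// nodeK.
by move/eqP; rewrite mulN1r addrC subr_eq0 => /eqP.
Qed.

Definition coef_of N (w : N.-bseq bool -> R) (I : dyadicp) : R :=
  if I is Some J then if (lvl J <= N)%N then w (insub_bseq N (node J)) else 0 else 0.

Lemma coef_of_dy N (w : N.-bseq bool -> R) (J : N.-bseq bool) :
  coef_of w (Some (dy J)) = w J.
Proof. by rewrite /coef_of lvl_dy size_bseq dyK insub_bseq_val. Qed.

Lemma coef_of_gt N (w : N.-bseq bool -> R) I : (N < lvl I)%N -> coef_of w (Some I) = 0.
Proof. by rewrite /coef_of ltnNge => /negPf ->. Qed.

Lemma coef_of_fin N (w : N.-bseq bool -> R) : fin_supp (coef_of w).
Proof.
apply: (@sub_finite_set _ _ [set Some (dy (val J)) | J in [set: N.-bseq bool]]%classic).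
  move=> [I|] /=; rewrite ?eqxx// /coef_of; case: ifP => [IN _|]; last by rewrite eqxx.
  exists (insub_bseq N (node I)) => //.
  by rewrite insub_bseqK ?size_node// nodeK.
by apply: finite_image; apply: finite_finset.
Qed.

Lemma haar_coef_hsum N (w : N.-bseq bool -> R) : haar_coef (hsum w) = coef_of w.
Proof.
have cw : fin_supp (coef_of w) /\ hsum w = haar_sum setT (coef_of w).
  split; first exact: coef_of_fin.
  rewrite (haar_sum_nodes (@coef_of_gt N w)) scale0r add0r.
  by apply: eq_hsum => J; rewrite coef_of_dy.
rewrite /haar_coef; case: xgetP => [a _ [fa ha]|/(_ (coef_of w))//].
by apply: haar_sum_inj => //; rewrite -?ha ?cw.2//; case: cw.
Qed.

(** * The norm of a Haar system Hardy space *)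

Lemma rademacher_step r m : (r < m)%N ->
  rademacher r = step (fun y : m.-tuple bool => (-1) ^+ nth false y r : R).
Proof.
move=> rm; apply/funext => u; rewrite /rademacher.
pose h (s : r.-tuple bool) : 'I_(2 ^ r) :=
  cast_ord (congr1 (expn 2) (size_tuple s)) (Ordinal (num_lt s)).
have hI : injective h.
  move=> s s' /(congr1 val) /= /num_inj; rewrite !size_tuple => /(_ erefl).
  exact: val_inj.
rewrite (reindex h); last first.
  apply: onW_bij; apply: inj_card_bij hI _.
  by rewrite card_ord card_tuple card_bool.
have hE (s : r.-tuple bool) : Tagged (fun j => 'I_(2 ^ j)) (h s) = dy s.
  by apply: dyadic_ext; rewrite ?lvl_dy ?size_tuple.
rewrite (eq_bigr (fun s : r.-tuple bool => \sum_(x : m.-tuple bool)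
   (take r x == s)%:R * (-1) ^+ nth false x r * @cell R x u)); last first.
  move=> s _; rewrite hE (haar_step R (m := m)) ?size_tuple//.
rewrite exchange_big; apply: eq_bigr => x _; rewrite -!mulr_suml.
have st : size (take r x) == r by rewrite size_take size_tuple rm.
rewrite (bigD1 (Tuple st))//= eqxx big1 ?addr0 ?mul1r// => s sx.
by rewrite [take r x == s]eq_sym -[s == _ :> seq bool]/(s == Tuple st) (negPf sx).
Qed.

(** The Rademacher functions met along the branch [x] have the increasing indices
    [2 ^ i + num (take i x)]; their signs at a uniform point are therefore independent
    ([avg_pat]). *)
Lemma rad_integral k N (x : N.+1.-tuple bool) (c : nat -> R) :
  \int[lebesgue_measure]_(u in @unit_itv R)
    `|\sum_(i < N.+1) rad_family k (Some (dy (take i x))) u * c i| = radnorm k N.+1 c.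
Proof.
case: k; rewrite /rad_family /radnorm; last first.
  rewrite (@rademacher_step 0 1)//.
  rewrite -[RHS](avg_cst [tuple false]) -Rintegral_step.
  apply: eq_Rintegral => u _.
  case: (cell_unique 1 u) => [[u0 _]|[_ [y cy]]].
    by rewrite [RHS]step_out// big1 ?normr0// => i _; rewrite step_out// mul0r.
  rewrite !(step_in _ cy) -mulr_sumr normrM normrX normrN1 expr1n.
  by rewrite mul1r.
pose l i := iota_dyadic (Some (dy (take i x))).
have lE i : (i < N.+1)%N -> l i = (2 ^ i + num (take i x))%N.
  by move=> iN; rewrite /l iota_dy size_take size_tuple iN.
have l_lt i : (i < N.+1)%N -> (2 ^ i <= l i < 2 ^ i.+1)%N.
  move=> iN; have := num_lt (take i x); rewrite lE// size_take size_tuple iN expnS.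
  by lia.
pose s := [seq l i | i <- iota 0 N.+1].
have sz : size s = N.+1 by rewrite size_map size_iota.
have nth_s i : (i < N.+1)%N -> nth 0%N s i = l i.
  by move=> iN; rewrite (nth_map 0%N) ?size_iota// nth_iota.
have ss : sorted ltn s.
  apply/(sortedP 0%N) => i; rewrite sz => iN.
  rewrite (nth_s _ iN) (nth_s _ (ltnW iN)).
  by have := l_lt i.+1 iN; have := l_lt i (ltnW iN); lia.
have sM : all (fun j => j < 2 ^ N.+1)%N s.
  apply/(all_nthP 0%N) => i; rewrite sz => iN; rewrite nth_s//.
  have := l_lt i iN; have : (2 ^ i.+1 <= 2 ^ N.+1)%N by rewrite leq_exp2l.
  by lia.
have := avg_pat (fun=> false) ss sM
  (fun e => `|\sum_(i < N.+1) (-1) ^+ nth false e i * c i| : R).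
rewrite sz => <-; rewrite -Rintegral_step; apply: eq_Rintegral => u _.
rewrite -(step_comp _ _ (normr0 _)); congr (`| _ |).
rewrite /step; under [RHS]eq_bigr => y _ do rewrite mulr_suml.
rewrite exchange_big; apply: eq_bigr => i _.
rewrite (@rademacher_step _ (2 ^ N.+1)); last first.
  by rewrite -/(l i) -nth_s//; apply: (allP sM); apply: mem_nth; rewrite sz.
rewrite /step mulr_suml; apply: eq_bigr => y _.
rewrite (nth_map 0%N) ?sz// nth_s// /tbit addbF /l.
by rewrite mulrAC.
Qed.

(** At a point of the cell [x] only the branch above [x] is seen, and [rad_integral]
    computes the inner integral. *)
Lemma hardy_norm_hsum (X : haar_system_space R) k N (w : N.-bseq bool -> R) :
  hardy_norm X k (hsum w) = nu (space_norm X) k w.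
Proof.
rewrite /hardy_norm haar_coef_hsum /coef_norm /nu space_normE; congr (X _).
apply/funext => t.
have E u : \sum_(I \in [set: dyadicp]) rad_family k I u * coef_of w I * @haar R I t =
    \sum_(J : N.-bseq bool) rad_family k (Some (dy J)) u * w J * @haar R (Some (dy J)) t.
  rewrite (@fsum_nodes _ N) => [|I /coef_of_gt ->]; last by rewrite mulr0 mul0r.
  rewrite [coef_of w None]/= mulr0 mul0r add0r.
  by apply: eq_bigr => J _; rewrite coef_of_dy.
under eq_Rintegral => u _ do rewrite E.
have H (J : N.-bseq bool) : @haar R (Some (dy J)) t =
    step (fun x : N.+1.-tuple bool => (take (size J) x == J)%:R * (-1) ^+ nth false x (size J)) t.
  by rewrite (haar_step R (m := N.+1)) ?ltnS ?size_bseq.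
case: (cell_unique N.+1 t) => [[t0 _]|[_ [x cx]]].
  rewrite step_out//; transitivity (\int[lebesgue_measure]_(u in @unit_itv R) (step (fun _ : 0.-tuple bool => 0 : R) u)).
    apply: eq_Rintegral => u _; rewrite big1 ?normr0; first by rewrite /step big1// => y _; rewrite mul0r.
    by move=> J _; rewrite H step_out// mulr0.
  by rewrite Rintegral_step (avg_cst [tuple]).
rewrite (step_in _ cx) /Phi -(rad_integral k x).
apply: eq_Rintegral => u _; congr (`| _ |).
pose G (s : seq bool) : R := rad_family k (Some (dy s)) u * (w (insub_bseq N s) * (-1) ^+ nth false x (size s)).
transitivity (\sum_(J : N.-bseq bool) (take (size J) x == J)%:R * G J).
  by apply: eq_bigr => J _; rewrite H (step_in _ cx) /G insub_bseq_val; ring.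
rewrite sum_branch//; apply: eq_bigr => i _.
rewrite /G /comp size_take size_tuple ltn_ord; congr (_ * _).
exact: mulrC.
Qed.

Lemma pairing_hsum N (w : N.-bseq bool -> R) (J : N.-bseq bool) :
  pairing (@haar R (Some (dy J))) (hsum w) = 2 ^- size J * w J.
Proof.
have JN : (size J < N.+1)%N by rewrite ltnS size_bseq.
rewrite /pairing hsum_step (haar_step R JN).
pose v (x : N.+1.-tuple bool) := \sum_(i < N.+1) ((take (size J) x == J)%:R *
  ((-1) ^+ nth false x (size J) * comp w x i)).
transitivity (\int[lebesgue_measure]_(t in @unit_itv R) step v t).
  apply: eq_Rintegral => t _; case: (cell_unique N.+1 t) => [[t0 _]|[_ [x cx]]].
    by rewrite !step_out// mul0r.
  rewrite !(step_in _ cx) /v mulr_sumr.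
  by apply: eq_bigr => i _; rewrite mulrA.
rewrite Rintegral_step /v avg_sum.
have E (i : 'I_N.+1) : avg (fun x : N.+1.-tuple bool => (take (size J) x == J)%:R *
    ((-1) ^+ nth false x (size J) * comp w x i)) =
    2 ^- size J * (if (i : nat) == size J then w J else 0).
  rewrite -(avg_comp_haar w J (ltn_ord i)) -avgZ; apply: eq_avg => x.
  by rewrite -!mulrA mulKf// expf_neq0.
rewrite (eq_bigr _ (fun i _ => E i)) -mulr_sumr (bigD1 (Ordinal JN))//= eqxx.
rewrite big1 ?addr0// => i iJ; case: eqP => // iE.
by case/eqP: iJ; apply: val_inj.
Qed.

(** * Unconditionality *)

Lemma unconditional_nu (X : haar_system_space R) k K n (w : n.-bseq bool -> R)
    (e : n.-bseq bool -> bool) : unconditional X k K ->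
  nu (space_norm X) k (fun J => (-1) ^+ e J * w J) <= K * nu (space_norm X) k w.
Proof.
move=> unc; pose a (I : dyadic) : R := coef_of w (Some I).
have fa : fin_supp a.
  have := coef_of_fin w; apply: (@finite_preimage _ _ _ (fun I : dyadic => Some I)).
  by move=> I J _ _ [].
have E (b : dyadic -> R) : (forall I, (n < lvl I)%N -> b I = 0) ->
    \sum_(I \in [set: dyadic]) b I *: @haar R (Some I) =
    hsum (fun J : n.-bseq bool => b (dy J)).
  move=> b0; pose G (I : dyadicp) : R -> R := if I is Some J then b J *: haar I else 0.
  have <- : \sum_(I \in [set: dyadicp]) G I = hsum (fun J : n.-bseq bool => b (dy J)).
    rewrite (@fsum_nodes _ n G) => [|I /b0 bI]; last by rewrite /G bI scale0r.
    by rewrite [G None]/= add0r.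
  rewrite -(@fsbig_widen _ _ _ _ [set Some I | I in [set: dyadic]]%classic) => [|//|].
    by rewrite fsbig_image// => I J _ _ [].
  by move=> [I|] [_ nI] //=; case: nI; exists I.
have := unc a (fun I => e (insub_bseq n (node I))) fa.
rewrite !E => [|I In|I In]; last 2 first.
- by rewrite /a coef_of_gt ?mulr0.
- by rewrite /a coef_of_gt ?mulr0.
rewrite !hardy_norm_hsum.
rewrite [X in _ <= _ * X](eq_nu _ _ (w' := w)) => [|J]; last by rewrite /a coef_of_dy.
congr (_ <= _); apply: eq_nu => J.
by rewrite /a coef_of_dy dyK insub_bseq_val.
Qed.

(** A multiplier with entries of modulus at most [rho] is a convex combination of
    multipliers with entries [rho] and [- rho]. *)
Lemma unconditional_mul (X : haar_system_space R) k K n (m : n.-bseq bool -> R) rho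
    (w : n.-bseq bool -> R) : unconditional X k K ->
  (forall J, `|m J| <= rho) ->
  nu (space_norm X) k (fun J => m J * w J) <= K * rho * nu (space_norm X) k w.
Proof.
move=> unc; have main (r : seq (n.-bseq bool)) : forall m : n.-bseq bool -> R,
    (forall J, `|m J| <= rho) -> (forall J, J \notin r -> `|m J| = rho) ->
    nu (space_norm X) k (fun J => m J * w J) <= K * rho * nu (space_norm X) k w.
  elim: r => [|J0 r IH] {}m m_le m_eq.
    have rho0 : 0 <= rho by apply: le_trans (m_le (insub_bseq n [::])).
    rewrite (eq_nu _ _ (w' := fun J => rho * ((-1) ^+ (m J < 0)%R * w J))).
      rewrite nuZ ger0_norm// [K * _]mulrC -mulrA ler_wpM2l//.
      exact: unconditional_nu.
    move=> J; rewrite mulrA -(m_eq J)// [X in X * _ = _](_ : _ = `|m J| * (-1) ^+ (m J < 0)%R)//.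
    by rewrite mulrC -numEsign.
  have rho0 : 0 <= rho by apply: le_trans (m_le (insub_bseq n [::])).
  have [r0|r0] := eqVneq rho 0.
    rewrite (eq_nu _ _ (w' := fun=> 0)) ?nu0 ?r0 ?mulr0 ?mul0r// => J.
    have := m_le J; rewrite r0 normr_le0 => /eqP ->.
    by rewrite mul0r.
  pose m1 J := if J == J0 then rho else m J.
  pose m2 J := if J == J0 then - rho else m J.
  pose l := (1 + m J0 / rho) / 2.
  have rgt : 0 < rho by rewrite lt_neqAle eq_sym r0.
  have /andP[l0 l1] : - 1 <= m J0 / rho <= 1.
    by rewrite -ler_norml normrM normfV [X in _ / X]ger0_norm// ler_pdivrMr// mul1r.
  have H1 : nu (space_norm X) k (fun J => m1 J * w J) <= K * rho * nu (space_norm X) k w.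
    apply: IH => J; rewrite /m1.
      by case: eqP => [_|_]; rewrite ?normrN ?(ger0_norm rho0).
    case: eqP => [_ _|/eqP JJ Jr]; first by rewrite ?normrN ger0_norm.
    by apply: m_eq; rewrite in_cons negb_or JJ.
  have H2 : nu (space_norm X) k (fun J => m2 J * w J) <= K * rho * nu (space_norm X) k w.
    apply: IH => J; rewrite /m2.
      by case: eqP => [_|_]; rewrite ?normrN ?(ger0_norm rho0).
    case: eqP => [_ _|/eqP JJ Jr]; first by rewrite ?normrN ger0_norm.
    by apply: m_eq; rewrite in_cons negb_or JJ.
  rewrite (eq_nu _ _ (w' := fun J => l * (m1 J * w J) + (1 - l) * (m2 J * w J))).
    apply: le_trans (nuD _ _ _ _) _; rewrite !nuZ.
    have l0' : 0 <= l by rewrite /l; lra.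
    have l1' : 0 <= 1 - l by rewrite /l; lra.
    rewrite !ger0_norm//; apply: le_trans (lerD (ler_wpM2l l0' H1) (ler_wpM2l l1' H2)) _.
    by rewrite -mulrDl subrKC mul1r.
  move=> J; rewrite /m1 /m2; case: eqP => [->|_]; last by ring.
  by rewrite /l; field.
move=> m_le; apply: (main (enum {: n.-bseq bool})) => // J.
by rewrite mem_enum.
Qed.

End HaarSums.

(** * The finite-dimensional spaces and their operators *)

Section Spaces.
Variable R : realType.

Definition coefY n (f : Yspace R n) (J : n.-bseq bool) : R :=
  haar_coef (val f) (Some (dy J)).

Lemma hsum_Ypred n (w : n.-bseq bool -> R) : hsum w \in @Ypred R n.
Proof.
apply: rpred_sum => J _; apply: rpredZ; apply: haar_Ypred.
by rewrite lvl_dy size_bseq.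
Qed.

Definition toY n (w : n.-bseq bool -> R) : Yspace R n := exist _ (hsum w) (hsum_Ypred w).

Lemma val_toY n (w : n.-bseq bool -> R) : val (toY w) = hsum w. Proof. by []. Qed.

Lemma coefY_toY n (w : n.-bseq bool -> R) : coefY (toY w) =1 w.
Proof. by move=> J; rewrite /coefY val_toY haar_coef_hsum coef_of_dy. Qed.

Lemma val_coefY n (f : Yspace R n) : val f = hsum (coefY f).
Proof.
have : val f \in @Ypred R n by apply: valP.
move=> /set_mem [a [_ fE]].
suff fa : val f = hsum (fun J : n.-bseq bool => a (Some (dy J))).
  rewrite [LHS]fa; apply: eq_hsum => J.
  by rewrite /coefY fa haar_coef_hsum coef_of_dy.
rewrite fE /haar_sum (fsbigE [seq Some (dy (val J)) | J <- enum {: n.-bseq bool}]).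
- rewrite big_mkcond big_map big_enum; apply: eq_bigr => J _.
  rewrite mem_set//; exists (dy J) => //.
  exact: size_bseq.
- rewrite map_inj_uniq ?enum_uniq// => I J /Some_inj /(can_inj dyK).
  exact: val_inj.
- move=> _ /mapP[J _ ->]; exists (dy J) => //.
  exact: size_bseq.
- move=> _ [I /= In <-] /negP[]; apply/mapP; exists (insub_bseq n (node I)).
    by rewrite mem_enum.
  by rewrite insub_bseqK ?size_node// nodeK.
Qed.

Lemma haarY_single n (J : n.-bseq bool) (Jn : (lvl (dy J) <= n)%N) :
  haarY R Jn = toY (single R J).
Proof.
apply: val_inj; rewrite /= /hsum (bigD1 J)//= big1 ?addr0.
  by rewrite /single eqxx scale1r.
by move=> K /negPf KJ; rewrite /single KJ scale0r.
Qed.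

Lemma toY_coefY n (f : Yspace R n) : toY (coefY f) = f.
Proof. by apply: val_inj; rewrite [RHS]val_coefY. Qed.

Lemma coefY_lin n c (f g : Yspace R n) J : coefY (c *: f + g) J = c * coefY f J + coefY g J.
Proof.
have E : hsum (coefY (c *: f + g)) = hsum (fun K => c * coefY f K + coefY g K).
  by rewrite -val_coefY hsum_lin -!val_coefY GRing.valD GRing.valZ.
exact: hsum_inj E J.
Qed.

Lemma coefY0 n J : coefY (0 : Yspace R n) J = 0.
Proof. by have := coefY_lin (-1) (0 : Yspace R n) 0 J; rewrite scaler0 addr0; lra. Qed.

Lemma coefY_sum n (I : Type) (r : seq I) (c : I -> R) (f : I -> Yspace R n) J :
  coefY (\sum_(i <- r) c i *: f i) J = \sum_(i <- r) c i * coefY (f i) J.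
Proof.
elim: r => [|i r IH]; first by rewrite !big_nil coefY0.
by rewrite !big_cons coefY_lin IH.
Qed.

Definition linY n N (M : N.-bseq bool -> n.-bseq bool -> R) (f : Yspace R n) : Yspace R N :=
  toY (mv M (coefY f)).

Lemma linY_linear n N (M : N.-bseq bool -> n.-bseq bool -> R) : linear (linY M).
Proof.
move=> c f g; apply: val_inj; rewrite GRing.valD GRing.valZ !val_toY -hsum_lin.
apply: eq_hsum => I; rewrite /mv mulr_sumr -big_split; apply: eq_bigr => J _ /=.
by rewrite coefY_lin mulrDr mulrCA.
Qed.

HB.instance Definition _ n N (M : N.-bseq bool -> n.-bseq bool -> R) :=
  GRing.isLinear.Build R (Yspace R n) (Yspace R N) _ (linY M) (linY_linear M).

(** The matrix of an operator with respect to the Haar bases. *)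
Definition matY n N (T : Yspace R n -> Yspace R N) (I : N.-bseq bool) (J : n.-bseq bool) : R :=
  coefY (T (toY (single R J))) I.

Lemma coefY_op n N (T : {linear Yspace R n -> Yspace R N}) f : coefY (T f) =1 mv (matY T) (coefY f).
Proof.
move=> I; have fE : f = \sum_J coefY f J *: toY (single R J).
  rewrite -[LHS]toY_coefY; apply: val_inj; rewrite val_toY.
  rewrite [RHS]val_coefY; apply: eq_hsum => J; rewrite coefY_sum.
  rewrite (bigD1 J)//= coefY_toY /single eqxx mulr1 big1 ?addr0// => K KJ.
  by rewrite coefY_toY eq_sym (negPf KJ) mulr0.
rewrite {1}fE linear_sum /mv.
under eq_bigr do rewrite linearZ.
by rewrite coefY_sum; apply: eq_bigr => J _; rewrite mulrC.
Qed.

Variables (X : haar_system_space R) (k : rad_kind).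
Local Notation nu := (nu (space_norm X) k).

Lemma Ynorm_nu n (f : Yspace R n) : Ynorm X k f = nu (coefY f).
Proof. by rewrite /Ynorm val_coefY hardy_norm_hsum. Qed.

(** The definition only tests elements of norm at most one; an element of norm zero is
    scaled up arbitrarily, others are normalized. *)
Lemma opnorm_matrix n N (T : {linear Yspace R n -> Yspace R N}) (C : R) : 
  (opnorm X k T <= C%:E)%E ->
  forall w : n.-bseq bool -> R, nu (mv (matY T) w) <= C * nu w.
Proof.
move=> TC.
have H w : nu w <= 1 -> nu (mv (matY T) w) <= C.
  move=> w1; rewrite -lee_fin; apply: le_trans TC; apply: ereal_sup_ubound.
  exists (toY w); first by rewrite /= Ynorm_nu (eq_nu _ _ (coefY_toY w)).
  rewrite Ynorm_nu (eq_nu _ _ (coefY_op T (toY w))).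
  by congr EFin; apply: eq_nu => I; apply: eq_mv => //; apply: coefY_toY.
have mvZ c w : nu (mv (matY T) (fun J => c * w J)) = `|c| * nu (mv (matY T) w).
  rewrite -nuZ; apply: eq_nu => I; rewrite /mv mulr_sumr.
  by apply: eq_bigr => J _; rewrite mulrCA.
move=> w; have [w0|w0] := eqVneq (nu w) 0.
  have C0 : 0 <= C by apply: le_trans (H (fun=> 0) _); rewrite ?nu0 ?nu_ge0.
  rewrite w0 mulr0 leNgt; apply/negP => T0.
  have := H (fun J => ((C + 1) / nu (mv (matY T) w)) * w J).
  rewrite nuZ w0 mulr0 mvZ ger0_norm ?divr_ge0 ?nu_ge0 ?addr_ge0//.
  by rewrite mulfVK ?gt_eqF// => /(_ ler01); lra.
have wp : 0 < nu w by rewrite lt_neqAle eq_sym w0 nu_ge0.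
have := H (fun J => (nu w)^-1 * w J).
rewrite nuZ mvZ ger0_norm ?invr_ge0 ?nu_ge0// mulVf// => /(_ (lexx _)).
by rewrite ler_pdivrMl// mulrC.
Qed.

Lemma opnorm_linY n N (M : N.-bseq bool -> n.-bseq bool -> R) (C : R) : 0 <= C ->
  (forall w, nu (mv M w) <= C * nu w) ->
  (0 <= opnorm X k (linY M) /\ opnorm X k (linY M) <= C%:E)%E.
Proof.
move=> C0 MC; have E f : Ynorm X k (linY M f) = nu (mv M (coefY f)).
  by rewrite Ynorm_nu; apply: eq_nu; apply: coefY_toY.
split.
  apply: (@le_trans _ _ (Ynorm X k (linY M 0))%:E); first by rewrite lee_fin Ynorm_nu nu_ge0.
  apply: ereal_sup_ubound; exists 0 => //=.
  by rewrite Ynorm_nu (eq_nu _ _ (@coefY0 n)) nu0.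
apply: ub_ereal_sup => _ [f /= f1 <-]; rewrite lee_fin E.
apply: le_trans (MC _) _; rewrite -[leRHS]mulr1 ler_wpM2l//.
by rewrite -Ynorm_nu.
Qed.

Lemma factors_of_matrix n N (T : {linear Yspace R N -> Yspace R N}) C : 0 <= C ->
  matrix_factor (space_norm X) k n (matY T) C ->
  factors_through X k (idfun : Yspace R n -> Yspace R n) T C.
Proof.
move=> C0 [B [A [B1 AC AB]]]; exists (linY B), (linY A); split.
  have [|B0 B1'] := @opnorm_linY _ _ B 1 ler01; first by move=> w; rewrite mul1r.
  have [A0 AC'] := opnorm_linY C0 AC.
  apply: le_trans (lee_pmul A0 B0 AC' B1') _.
  by rewrite mule1.
move=> f /=; rewrite -[LHS]toY_coefY; apply: val_inj; rewrite !val_toY.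
apply: eq_hsum => I; rewrite -[LHS](AB (coefY f) I); apply: eq_mv => // J.
rewrite (coefY_op T); apply: eq_mv => // K.
by rewrite coefY_toY.
Qed.

End Spaces.

(** * The factorization theorem *)

Section Main.
Variable R : realType.
Variables (X : haar_system_space R) (k : rad_kind) (Gamma delta eps : R) (n N : nat).
Hypotheses (Gamma_gt0 : 0 < Gamma) (delta_gt0 : 0 < delta) (eps_gt0 : 0 < eps).
Local Notation nu := (nu (space_norm X) k).
Let q : R := (1 + eps)^-1.

Let kappa : R := (1 - q) / 6 * delta.

Let q_gt0 : 0 < q. Proof. by rewrite invr_gt0 addr_gt0. Qed.
Let q_lt1 : q < 1.
Proof. by rewrite invf_lt1 ?addr_gt0// ltrDl. Qed.
Let kappa_gt0 : 0 < kappa.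
Proof. by rewrite mulr_gt0// divr_gt0// subr_gt0. Qed.
Let qE : q^-1 = 1 + eps. Proof. exact: invrK. Qed.

Section Operator.
Variable T : {linear Yspace R N -> Yspace R N}.
Hypothesis T_le : (opnorm X k T <= Gamma%:E)%E.

Let tau_le (w : N.-bseq bool -> R) : nu (mv (matY T) w) <= Gamma * nu w.
Proof. exact: opnorm_matrix. Qed.

Let half_gap (c : R) : delta = 1 -> 2^-1 <= c ->
  2 * kappa < c /\ (c - 2 * kappa)^-1 <= 2 * (1 + eps).
Proof.
move=> d1 c2; have k2 : q / 2 <= c - 2 * kappa.
  by have := q_lt1; rewrite /kappa d1 mulr1; lra.
have q2 : 0 < q / 2 by rewrite divr_gt0.
split; first by lra.
have -> : 2 * (1 + eps) = (q / 2)^-1 by rewrite invfM qE invrK mulrC.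
by rewrite lef_pV2 ?posrE// (lt_le_trans q2).
Qed.

Let factor_compl C : 0 <= C ->
  matrix_factor (space_norm X) k n (fun I J => (I == J)%:R - matY T I J) C ->
  factors_through X k (idfun : Yspace R n -> Yspace R n) (idfun \- T) C.
Proof.
move=> C0 [B [A [B1 AC AB]]]; apply: factors_of_matrix => //.
exists B, A; split=> // w I; rewrite -[RHS](AB w I); apply: eq_mv => // J.
apply: eq_mv => // K; rewrite /matY /= -scaleN1r addrC coefY_lin coefY_toY /single.
by rewrite mulN1r addrC.
Qed.

(** The scalar [c] of [stabilize] is an average of diagonal entries.  So it is at least
    [delta] if these are; in any case [c] or [1 - c] is at least [2^-1]. *)
Lemma conclusions_of_stabilized (Lambda : R) (M k0 : nat) : (0 < M)%N ->
  (forall (m : nat -> R) (rho : R) (w : n.-bseq bool -> R),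
     (forall a, (a <= n)%N -> `|m a| <= rho) ->
     nu (fun I => m (size I) * w I) <= Lambda * rho * nu w) ->
  Lambda * Gamma <= M%:R * kappa ->
  Gamma ^+ 4 * 2 ^+ (16 * n + 18) <= kappa ^+ 4 * 2 ^+ k0 ->
  (n * (21 * M).+1 < N.+1 - k0)%N ->
  (delta = 1 ->
     factors_through X k (idfun : Yspace R n -> Yspace R n) T (2 * (1 + eps)) \/
     factors_through X k (idfun : Yspace R n -> Yspace R n) (idfun \- T) (2 * (1 + eps))) /\
  (large_positive_diagonal delta T ->
     factors_through X k (idfun : Yspace R n -> Yspace R n) T ((1 + eps) / delta)).
Proof.
move=> M0 mult MG k0G NG.
have [s [th [c [sn ss sN [a aN ca] cT]]]] :=
  @stabilize R (space_norm X) k n N (matY T) Gamma kappa Lambda M k0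
    Gamma_gt0 kappa_gt0 M0 tau_le mult MG k0G NG.
split=> [d1|diag].
  have C0 : 0 <= 2 * (1 + eps) by have := eps_gt0; lra.
  case: (lerP 2^-1 c) => c2.
    left; have [h1 h2] := half_gap d1 c2.
    apply: factors_of_matrix => //.
    exact: (factor_of_approx sn ss sN cT h1 h2).
  right; have c2' : 2^-1 <= 1 - c by lra.
  have [h1 h2] := half_gap d1 c2'.
  apply: factor_compl => //.
  exact: (factor_of_approx_compl sn ss sN cT h1 h2).
apply: factors_of_matrix; first by rewrite divr_ge0 ?addr_ge0// ltW.
have dc : delta <= c.
  rewrite ca /diag_sum.
  have -> : delta = \sum_(J : N.-bseq bool | size J == a) delta * 2 ^- a.
    by rewrite sum_level_cst// mulrCA mulfV ?mulr1// expf_neq0.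
  apply: ler_sum => J /eqP Ja.
  have JN : (lvl (dy J) <= N)%N by rewrite lvl_dy size_bseq.
  have := diag (dy J) JN; rewrite /len lvl_dy Ja => /le_trans; apply.
  by rewrite val_coefY pairing_hsum haarY_single /form /matY Ja.
have k2 : delta * q <= c - 2 * kappa.
  have : 0 < delta * (1 - q) by rewrite mulr_gt0// subr_gt0.
  by rewrite /kappa; lra.
have dq : 0 < delta * q by rewrite mulr_gt0.
apply: (factor_of_approx sn ss sN cT); first by lra.
by rewrite -qE -invfM mulrC lef_pV2 ?posrE//; lra.
Qed.

(** If the norm of the operator is less than [kappa], its compression to the first
    levels is already close to zero. *)
Lemma conclusion_small : Gamma < kappa -> delta = 1 -> (n <= N)%N ->
  factors_through X k (idfun : Yspace R n -> Yspace R n) (idfun \- T) (2 * (1 + eps)).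
Proof.
move=> Gk d1 nN; apply: factor_compl; first by rewrite mulr_ge0// addr_ge0// ltW.
have sn : size (iota 0 n.+1) = n.+1 by rewrite size_iota.
have ss := iota_ltn_sorted 0 n.+1.
have sN : all (fun i => i < N.+1)%N (iota 0 n.+1) by apply: all_iota_lt.
have [|h1 h2] := @half_gap (1 - 0) d1; first by lra.
apply: (factor_of_approx_compl sn ss sN (th := fun=> false) _ h1 h2) => w.
rewrite (eq_nu _ _ (w' := compress (iota 0 n.+1) (fun=> false)
  (mv (matY T) (embed (iota 0 n.+1) (fun=> false) w)))) => [|I]; last by rewrite mul0r subr0.
apply: le_trans (nu_compress _ _ _ sn ss sN _) _.
apply: le_trans (tau_le _) _; rewrite (nu_embed _ _ _ sn ss sN).
by apply: ler_wpM2r; [exact: nu_ge0|have := kappa_gt0; lra].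
Qed.

(** A diagonal entry is at most the norm. *)
Lemma delta_le_Gamma : large_positive_diagonal delta T -> delta <= Gamma.
Proof.
move=> diag; pose J : N.-bseq bool := insub_bseq N [::].
have Js : size J = 0%N by rewrite insub_bseqK.
have JN : (lvl (dy J) <= N)%N by rewrite lvl_dy size_bseq.
have := diag (dy J) JN; rewrite /len lvl_dy Js expr0 invr1 mulr1 => /le_trans; apply.
rewrite val_coefY pairing_hsum Js expr0 invr1 mul1r.
rewrite haarY_single.
have := form_diag_le tau_le J.
by rewrite /form Js expr0 invr1 mul1r mulr1 => /(le_trans (ler_norm _)).
Qed.

End Operator.

(** The first level is [16 n + 19 + floor (4 log2 (Gamma / kappa))].  The rest of the
    levels exceed [n * (21 M + 1)], as needed for the pigeonhole argument.  When
    [Gamma < kappa], the logarithm is negative and the bound on [N] says nothing;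
    then either [conclusion_small] applies or the diagonal cannot be large. *)
Lemma conclusions_of_bound (Lambda : R) (M : nat) : (0 < M)%N ->
  (forall (m : nat -> R) (rho : R) (w : n.-bseq bool -> R),
     (forall a, (a <= n)%N -> `|m a| <= rho) ->
     nu (fun I => m (size I) * w I) <= Lambda * rho * nu w) ->
  Lambda * Gamma <= M%:R * kappa ->
  42 * (n * M)%N%:Z + 42 + Num.floor (4 * log2 (Gamma / kappa)) <= N%:Z ->
  forall T : {linear Yspace R N -> Yspace R N}, (opnorm X k T <= Gamma%:E)%E ->
    (delta = 1 -> (n <= N)%N ->
     factors_through X k (idfun : Yspace R n -> Yspace R n) T (2 * (1 + eps)) \/
     factors_through X k (idfun : Yspace R n -> Yspace R n) (idfun \- T) (2 * (1 + eps))) /\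
    (large_positive_diagonal delta T ->
     factors_through X k (idfun : Yspace R n -> Yspace R n) T ((1 + eps) / delta)).
Proof.
move=> M0 mult MG NG T TG; case: (ltrP Gamma kappa) => Gk.
  split=> [d1 nN|diag]; first by right; apply: conclusion_small.
  have := delta_le_Gamma TG diag.
  have : 0 < q * delta by rewrite mulr_gt0.
  by move: Gk delta_gt0; rewrite /kappa => *; exfalso; lra.
set x := Gamma / kappa in NG.
have x1 : 1 <= x by rewrite ler_pdivlMr// mul1r.
have x0 : 0 < x by lra.
have l2 : 0 < ln 2 :> R by apply: ln_gt0; rewrite ltr1n.
have lx : 0 <= log2 x by apply: divr_ge0; [exact: ln_ge0|exact: ltW].
have fl0 : 0 <= Num.floor (4 * log2 x) by rewrite floor_ge0 mulr_ge0.
pose L := `|Num.floor (4 * log2 x)|%N.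
have LE : Num.floor (4 * log2 x) = L by rewrite gez0_abs.
have xL : x ^+ 4 <= 2 ^+ L.+1.
  have := floorD1_gt (4 * log2 x); rewrite LE -[X in (X + 1)]/(Posz L) -PoszD addn1 => h.
  rewrite -ler_ln ?posrE ?exprn_gt0// !lnXn// -[leLHS]mulr_natl -[leRHS]mulr_natl.
  by move: h; rewrite /log2 mulrA ltr_pdivrMr// => /ltW.
have [||H1 H2] := @conclusions_of_stabilized T TG Lambda M (16 * n + 19 + L) M0 mult MG.
- rewrite (_ : (16 * n + 19 + L = (16 * n + 18) + L.+1)%N); last first.
    by move: (L) => l; clear; lia.
  rewrite [X in _ <= _ * X]exprD [leRHS]mulrA [leRHS]mulrAC ler_wpM2r ?exprn_ge0//.
  by rewrite [leRHS]mulrC -ler_pdivrMr ?exprn_gt0// -expr_div_n.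
- have nM : (n <= n * M)%N by rewrite leq_pmulr.
  rewrite mulnS mulnCA; move: NG nM; rewrite LE.
  by move: (n * M)%N (L) => p l; clear; lia.
by split=> // d1 _; apply: H1.
Qed.

End Main.

Theorem theorem1p2 (R : realType) (X : haar_system_space R) (k : rad_kind)
    (Gamma delta eps : R)
    (Gamma_gt0 : 0 < Gamma) (delta_gt0 : 0 < delta) (eps_gt0 : 0 < eps)
    (n N : nat) :
  let eta := eps / (6 * (1 + eps)) in
  let conclusions := forall T : {linear Yspace R N -> Yspace R N},
    (opnorm X k T <= Gamma%:E)%E ->
    (delta = 1 -> (n <= N)%N ->
       factors_through X k (idfun : Yspace R n -> Yspace R n) T (2 * (1 + eps)) \/
       factors_through X k (idfun : Yspace R n -> Yspace R n)
         (idfun \- T) (2 * (1 + eps))) /\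
    (large_positive_diagonal delta T ->
       factors_through X k (idfun : Yspace R n -> Yspace R n) T
         ((1 + eps) / delta)) in
  (42 * (n * (n + 1))%N%:Z * Num.ceil (Gamma / (eta * delta)) + 42
     + Num.floor (4 * log2 (Gamma / (eta * delta))) <= N%:Z -> conclusions)
  /\
  (forall K : R, 1 <= K -> unconditional X k K ->
   42 * n%:Z * Num.ceil (K * Gamma / (eta * delta)) + 42
     + Num.floor (4 * log2 (Gamma / (eta * delta))) <= N%:Z -> conclusions).
Proof.
move=> eta conclusions.
have etaE : eta = (1 - (1 + eps)^-1) / 6.
  by rewrite /eta; field; rewrite gt_eqF//; lra.
have e0 : 0 < eta * delta.
  by rewrite mulr_gt0// /eta divr_gt0// mulr_gt0//; lra.
have ceilP (y : R) : 0 < y -> exists M : nat,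
    [/\ Num.ceil y = M :> int, (0 < M)%N & y <= M%:R].
  move=> y0; have c0 : 0 < Num.ceil y by rewrite ceil_gt0.
  exists `|Num.ceil y|%N; split; first by rewrite gez0_abs// ltW.
    by rewrite absz_gt0 gt_eqF.
  by apply: le_trans (ceil_ge y) _; rewrite -[X in X%:~R]gez0_abs ?(ltW c0).
split=> [NG|K K1 unc NG].
  have [|P [PE P0 yP]] := ceilP (Gamma / (eta * delta)); first by rewrite divr_gt0.
  apply: (@conclusions_of_bound R X k Gamma delta eps n N Gamma_gt0 delta_gt0 eps_gt0
    n.+1%:R (n.+1 * P)).
  - by rewrite muln_gt0.
  - by move=> m rho w; apply: nu_level_mul.
  - rewrite -etaE natrM -mulrA ler_wpM2l//.
    by rewrite -ler_pdivrMr.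
  - have -> : (n * (n.+1 * P) = n * (n + 1) * P)%N by rewrite addn1 mulnA.
    by move: NG; rewrite -etaE PE (PoszM (n * (n + 1)) P) mulrA.
have [|P [PE P0 yP]] := ceilP (K * Gamma / (eta * delta)).
  by rewrite divr_gt0// mulr_gt0//; lra.
apply: (@conclusions_of_bound R X k Gamma delta eps n N Gamma_gt0 delta_gt0 eps_gt0 K P).
- exact: P0.
- move=> m rho w mr; apply: (unconditional_mul (m := fun J : n.-bseq bool => m (size J))) => // J.
  by apply: mr; rewrite size_bseq.
- by rewrite -etaE -ler_pdivrMr.
- by move: NG; rewrite -etaE PE (PoszM n P) mulrA.
Qed.
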